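(* Let $(H,\alpha)$ be a monoidal Hom-Hopf algebra over a commutative ring $k$. Then the mutually inverse equivalences $$F=(H\otimes-,\alpha\otimes-):\widetilde{\mathcal{H}}(\mathcal{M}_k)\to{}^{H}_{H}\widetilde{\mathcal{H}}(\mathcal{M}_k),\qquad G={}^{coH}(-):{}^{H}_{H}\widetilde{\mathcal{H}}(\mathcal{M}_k)\to\widetilde{\mathcal{H}}(\mathcal{M}_k)$$ induce tensor (monoidal) equivalences between (1) the category of right $(H,\alpha)$-Hom-modules and the category of left-covariant $(H,\alpha)$-Hom-bimodules; (2) the category of right-right $(H,\alpha)$-Hom-Yetter-Drinfeld modules and the category of bicovariant $(H,\alpha)$-Hom-bimodules.
   Context: Conventions: $k$ is a commutative ring, $\otimes=\otimes_k$, Sweedler notation without summation signs. $\widetilde{\mathcal{H}}(\mathcal{M}_k)$ is the category of pairs $(M,\mu)$, $M$ a $k$-module, $\mu$ a $k$-linear automorphism of $M$; morphisms $f:(M,\mu)\to(N,\nu)$ are $k$-linear maps with $\nu f=f\mu$. It is monoidal with $(M,\mu)\otimes(N,\nu)=(M\otimes N,\mu\otimes\nu)$, unit $(k,id)$, associativity constraint $\tilde a((m\otimes n)\otimes p)=\mu(m)\otimes(n\otimes\pi^{-1}(p))$ (for $(P,\pi)\ni p$), unit constraints $x\otimes m\mapsto x\mu(m)$ and $m\otimes x\mapsto x\mu(m)$. A monoidal Hom-bialgebra $(H,\alpha)$ is an object of $\widetilde{\mathcal{H}}(\mathcal{M}_k)$ with a $k$-bilinear product, an element $1_H$, and $k$-linear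 maps $\Delta(h)=h_1\otimes h_2$, $\varepsilon:H\to k$ such that $\alpha(ab)=\alpha(a)\alpha(b)$, $\alpha(1_H)=1_H$, $\alpha(a)(bc)=(ab)\alpha(c)$, $a1_H=1_Ha=\alpha(a)$; $\Delta(\alpha(c))=\alpha(c_1)\otimes\alpha(c_2)$, $\varepsilon\alpha=\varepsilon$, $\alpha^{-1}(c_1)\otimes\Delta(c_2)=c_{11}\otimes(c_{12}\otimes\alpha^{-1}(c_2))$, $c_1\varepsilon(c_2)=\alpha^{-1}(c)=\varepsilon(c_1)c_2$; and $\Delta(ab)=\Delta(a)\Delta(b)$, $\Delta(1_H)=1_H\otimes1_H$, $\varepsilon(ab)=\varepsilon(a)\varepsilon(b)$, $\varepsilon(1_H)=1$. It is a monoidal Hom-Hopf algebra if there is a $k$-linear $S:H\to H$ (antipode) with $S\alpha=\alpha S$ and $S(h_1)h_2=\varepsilon(h)1_H=h_1S(h_2)$. All actions and coactions below are morphisms in $\widetilde{\mathcal{H}}(\mathcal{M}_k)$. Left Hom-module $(M,\mu)$: $\alpha(g)(hm)=(gh)\mu(m)$, $1_Hm=\mu(m)$. Right Hom-module: $(mg)\alpha(h)=\mu(m)(gh)$, $m1_H=\mu(m)$. Hom-bimodule: both, with $(gm)\alpha(h)=\alpha(g)(mh)$. Left Hom-comodule, $\rho(m)=m_{(-1)}\otimes m_{(0)}$: $\Delta(m_{(-1)})\otimes\mu^{-1}(m_{(0)})=(\alpha^{-1}(m_{(-1)})\otimes m_{(0)(-1)})\otimes m_{(0)(0)}$, $\varepsilon(m_{(-1)})m_{(0)}=\mu^{-1}(m)$.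 Right Hom-comodule, $\sigma(m)=m_{[0]}\otimes m_{[1]}$: $\mu^{-1}(m_{[0]})\otimes\Delta(m_{[1]})=m_{[0][0]}\otimes(m_{[0][1]}\otimes\alpha^{-1}(m_{[1]}))$, $m_{[0]}\varepsilon(m_{[1]})=\mu^{-1}(m)$. ${}^{H}_{H}\widetilde{\mathcal{H}}(\mathcal{M}_k)$ is the category of left Hom-Hopf modules: left Hom-modules and left Hom-comodules with $\rho(hm)=h_1m_{(-1)}\otimes h_2m_{(0)}$, with left $H$-linear and left $H$-colinear morphisms. ${}^{coH}M=\{m\in M:\rho(m)=1_H\otimes\mu^{-1}(m)\}$. $F(V,\nu)=(H\otimes V,\alpha\otimes\nu)$ with action $h(g\otimes v)=\alpha^{-1}(h)g\otimes\nu(v)$ and coaction $h\otimes v\mapsto\alpha(h_1)\otimes(h_2\otimes\nu^{-1}(v))$; $F$ and $G$ are known to be inverse equivalences. A left-covariant Hom-bimodule is a Hom-bimodule with a left Hom-coaction $\rho$ such that $\rho((hm)\alpha(g))=\Delta(\alpha(h))(\rho(m)\Delta(g))$ (componentwise actions); morphisms are $H$-linear on both sides and left $H$-colinear. A bicovariant Hom-bimodule is a left-covariant Hom-bimodule with also a right Hom-coaction $\sigma$ such that $\sigma((hm)\alpha(g))=\Delta(\alpha(h))(\sigma(m)\Delta(g))$ and $m_{(-1)}\otimes(m_{(0)[0]}\otimes m_{(0)[1]})=\alpha(m_{[0](-1)})\otimes(m_{[0](0)}\otimes\alpha^{-1}(m_{[1]}))$; morphisms are linear and colinear on both sides. A right-right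 Hom-Yetter-Drinfeld module $(N,\nu)$ is a right Hom-module ($\lhd$) and right Hom-comodule ($n\mapsto n_{(0)}\otimes n_{(1)}$) with $n_{(0)}\lhd\alpha^{-1}(h_1)\otimes n_{(1)}\alpha^{-1}(h_2)=(n\lhd h_2)_{(0)}\otimes\alpha^{-1}(h_1(n\lhd h_2)_{(1)})$; morphisms are right linear and right colinear. Induced structures: for a right Hom-module $V$, $H\otimes V$ has right action $(h\otimes v)g=hg_1\otimes v\lhd g_2$; for a Yetter-Drinfeld module $V$, $H\otimes V$ has moreover right coaction $h\otimes v\mapsto(h_1\otimes v_{(0)})\otimes h_2v_{(1)}$. Conversely ${}^{coH}M$ has right action $m\lhd h=P_L(mh)$ with $P_L(m)=S(m_{(-1)})m_{(0)}$, and (bicovariant case) the restricted right coaction. Monoidal structures: on right Hom-modules and on Yetter-Drinfeld modules, $\otimes_k$ with $(m\otimes n)\lhd h=m\lhd h_1\otimes n\lhd h_2$ (and coaction $(m_{(0)}\otimes n_{(0)})\otimes m_{(1)}n_{(1)}$), unit $k$ with trivial structures $x\lhd h=\varepsilon(h)x$ (and $x\mapsto x\otimes1_H$), constraints of $\widetilde{\mathcal{H}}(\mathcal{M}_k)$. On left-covariant and bicovariant bimodules, $M\otimes_HN$ is the quotient of $M\otimes N$ by the relations $mh\otimes n=\mu(m)\otimes h\nu^{-1}(n)$, with automorphism $\mu\otimes_H\nu$, $h(m\otimes_Hn)=\alpha^{-1}(h)m\otimes_H\nu(n)$, $(m\otimes_Hn)h=\mu(m)\otimes_Hn\alpha^{-1}(h)$,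 $\rho(m\otimes_Hn)=m_{(-1)}n_{(-1)}\otimes(m_{(0)}\otimes_Hn_{(0)})$ (and $\sigma(m\otimes_Hn)=(m_{[0]}\otimes_Hn_{[0]})\otimes m_{[1]}n_{[1]}$); unit $(H,\alpha)$ with product and coproduct as structure maps; associator $(m\otimes_Hn)\otimes_Hp\mapsto\mu(m)\otimes_H(n\otimes_H\pi^{-1}(p))$; unit constraints $h\otimes_Hm\mapsto hm$, $m\otimes_Hh\mapsto mh$. *)

(* Defs.v *)
From HB Require Import structures.
From mathcomp Require Import all_boot all_order all_algebra.
From mathcomp Require Import boolp classical_sets.

Set Implicit Arguments.
Unset Strict Implicit.
Unset Printing Implicit Defensive.

Import GRing.Theory.
Local Open Scope ring_scope.
Local Open Scope quotient_scope.

Section Bilinear.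
Variables (k : comPzRingType) (M N P : lmodType k).

(* The library's [{bilinear _ -> _ -> _}] requires a nontrivial ring. *)
Definition bilin (f : M -> N -> P) : Prop :=
  (forall m, linear (f m)) /\ (forall n, linear (f ^~ n)).

Lemma linD (U V : lmodType k) (f : U -> V) : linear f -> {morph f : x y / x + y}.
Proof. by move=> lf x y; have := lf 1 x y; rewrite !scale1r. Qed.

Lemma lin0 (U V : lmodType k) (f : U -> V) : linear f -> f 0 = 0.
Proof.
by move=> lf; have := lf (-1) 0 0; rewrite scaler0 addr0 scaleN1r addNr.
Qed.

Lemma linZ (U V : lmodType k) (f : U -> V) : linear f ->
  forall a x, f (a *: x) = a *: f x.
Proof. by move=> lf a x; have := lf a x 0; rewrite !addr0 (lin0 lf) addr0. Qed.

End Bilinear.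

(* M (x) N: formal sums of pairs (m, n), two of them being identified when
   every bilinear map on M x N takes the same value on both.  [tensor_universal]
   below is the universal property. *)
Section Tensor.
Variables (k : comPzRingType) (M N : lmodType k).

Definition tensor_rel (s t : seq (M * N)) : bool :=
  `[< forall (P : lmodType k) (f : M -> N -> P), bilin f ->
        \sum_(p <- s) f p.1 p.2 = \sum_(p <- t) f p.1 p.2 >].

Lemma tensor_rel_refl : reflexive tensor_rel.
Proof. by move=> s; apply/asboolP. Qed.

Lemma tensor_rel_sym : symmetric tensor_rel.
Proof.
by move=> s t; apply/asboolP/asboolP=> h P f bf; rewrite (h P f bf).
Qed.

Lemma tensor_rel_trans : transitive tensor_rel.
Proof.
move=> t s u /asboolP st /asboolP tu; apply/asboolP=> P f bf.
by rewrite (st P f bf) (tu P f bf).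
Qed.

Canonical tensor_equiv :=
  EquivRel tensor_rel tensor_rel_refl tensor_rel_sym tensor_rel_trans.

Definition tensor := {eq_quot tensor_equiv}.
HB.instance Definition _ := Choice.on tensor.
HB.instance Definition _ := EqQuotient.on tensor.

Definition pure (m : M) (n : N) : tensor := \pi_tensor [:: (m, n)].

(* The linear map on M (x) N induced by f when f is bilinear; no meaning
   otherwise. *)
Definition tlift (P : lmodType k) (f : M -> N -> P) (x : tensor) : P :=
  \sum_(p <- repr x) f p.1 p.2.

Lemma tlift_pi (P : lmodType k) (f : M -> N -> P) s : bilin f ->
  tlift f (\pi_tensor s) = \sum_(p <- s) f p.1 p.2.
Proof.
move=> bf; rewrite /tlift.
have /eqP : repr (\pi_tensor s) = s %[mod tensor] by rewrite reprK.
by rewrite eqquotE => /asboolP/(_ P f bf).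
Qed.

Lemma tensor_ext (x y : tensor) :
  (forall (P : lmodType k) (f : M -> N -> P), bilin f -> tlift f x = tlift f y) ->
  x = y.
Proof.
move=> h; rewrite -[x]reprK -[y]reprK; apply/eqP; rewrite eqquotE.
by apply/asboolP=> P f /h.
Qed.

Let tadd (x y : tensor) : tensor := \pi_tensor (repr x ++ repr y).
Let tzero : tensor := \pi_tensor [::].
Let tscale (a : k) (x : tensor) : tensor :=
  \pi_tensor [seq (a *: p.1, p.2) | p <- repr x].

Let tlift_add (P : lmodType k) (f : M -> N -> P) x y : bilin f ->
  tlift f (tadd x y) = tlift f x + tlift f y.
Proof. by move=> bf; rewrite tlift_pi // big_cat. Qed.

Let tlift_zero (P : lmodType k) (f : M -> N -> P) : bilin f ->
  tlift f tzero = 0.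
Proof. by move=> bf; rewrite tlift_pi // big_nil. Qed.

Let tlift_scale (P : lmodType k) (f : M -> N -> P) a x : bilin f ->
  tlift f (tscale a x) = a *: tlift f x.
Proof.
move=> bf; rewrite tlift_pi // big_map scaler_sumr; apply: eq_bigr=> p _ /=.
exact: (linZ (bf.2 p.2)).
Qed.

Let taddA : associative tadd.
Proof. by move=> x y z; apply: tensor_ext=> P f bf; rewrite !tlift_add // addrA. Qed.
Let taddC : commutative tadd.
Proof. by move=> x y; apply: tensor_ext=> P f bf; rewrite !tlift_add // addrC. Qed.
Let tadd0 : left_id tzero tadd.
Proof.
by move=> x; apply: tensor_ext=> P f bf; rewrite tlift_add // tlift_zero // add0r.
Qed.
Let taddN : left_inverse tzero (tscale (-1)) tadd.
Proof.
move=> x; apply: tensor_ext=> P f bf.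
by rewrite tlift_add // tlift_zero // tlift_scale // scaleN1r addNr.
Qed.

HB.instance Definition _ := GRing.isZmodule.Build tensor taddA taddC tadd0 taddN.

Let tscaleA a b x : tscale a (tscale b x) = tscale (a * b) x.
Proof. by apply: tensor_ext=> P f bf; rewrite !tlift_scale // scalerA. Qed.
Let tscale1 : left_id 1 tscale.
Proof. by move=> x; apply: tensor_ext=> P f bf; rewrite tlift_scale // scale1r. Qed.
Let tscaleDr : right_distributive tscale +%R.
Proof.
move=> a x y; apply: tensor_ext=> P f bf.
by rewrite !(tlift_scale, tlift_add) // scalerDr.
Qed.
Let tscaleDl x : {morph tscale^~ x : a b / a + b}.
Proof.
move=> a b; apply: tensor_ext=> P f bf.
by rewrite !(tlift_scale, tlift_add) // scalerDl.
Qed.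

HB.instance Definition _ := GRing.Zmodule_isLmodule.Build k tensor
  tscaleA tscale1 tscaleDr tscaleDl.

Lemma tlift_linear (P : lmodType k) (f : M -> N -> P) : bilin f -> linear (tlift f).
Proof. by move=> bf a x y; rewrite -[RHS]/(_ + _) -tlift_scale // -tlift_add. Qed.

Lemma tlift_pure (P : lmodType k) (f : M -> N -> P) m n : bilin f ->
  tlift f (pure m n) = f m n.
Proof. by move=> bf; rewrite tlift_pi // big_seq1. Qed.

Lemma pure_bilin : bilin pure.
Proof.
split=> [m|n] a x y; apply: tensor_ext=> P f bf;
  rewrite (tlift_linear bf) !tlift_pure //; [exact: bf.1|exact: bf.2].
Qed.

Lemma tlift_eta (x : tensor) : tlift pure x = x.
Proof.
apply: tensor_ext=> P f bf; have -> : tlift pure x = \sum_(p <- repr x) pure p.1 p.2 by [].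
rewrite (big_morph (tlift f) (linD (tlift_linear bf)) (lin0 (tlift_linear bf))).
by apply: eq_bigr=> p _; rewrite tlift_pure.
Qed.

Lemma linear_tlift (P : lmodType k) (g : tensor -> P) x : linear g ->
  g x = tlift (fun m n => g (pure m n)) x.
Proof.
move=> lg; rewrite -{1}(tlift_eta x).
have -> : tlift pure x = \sum_(p <- repr x) pure p.1 p.2 by [].
by rewrite (big_morph g (linD lg) (lin0 lg)).
Qed.

Theorem tensor_universal (P : lmodType k) (f : M -> N -> P) : bilin f ->
  exists! g : tensor -> P, linear g /\ forall m n, g (pure m n) = f m n.
Proof.
move=> bf; exists (tlift f); split.
  by split=> [|m n]; [exact: tlift_linear|rewrite tlift_pure].
move=> g [lg gE]; apply/funext=> x; rewrite (linear_tlift x lg).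
by congr tlift; apply/funext=> m; apply/funext=> n; rewrite gE.
Qed.

End Tensor.

Notation "m ⊗ n" := (pure m n) (at level 45, no associativity).

(* Sweedler notation: [slet a ⊗ b := x in e] is e(x_1, x_2), linear in
   x = x_1 ⊗ x_2, provided e is bilinear in (a, b). *)
Notation "'slet' a ⊗ b := x 'in' e" := (tlift (fun a b => e) x)
  (at level 200, a name, b name, x at level 200, e at level 200).

Definition tmap (k : comPzRingType) (M M' N N' : lmodType k)
    (f : M -> M') (g : N -> N') (x : tensor M N) : tensor M' N' :=
  slet m ⊗ n := x in f m ⊗ g n.

Lemma tmap_bilin (k : comPzRingType) (M M' N N' : lmodType k)
    (f : M -> M') (g : N -> N') : linear f -> linear g ->
  bilin (fun m n => f m ⊗ g n).
Proof.
move=> lf lg; split=> [m|n] a x y /=; rewrite ?lf ?lg.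
  exact: (pure_bilin _ _).1.
exact: ((pure_bilin _ _).2).
Qed.

Lemma tmap_pure (k : comPzRingType) (M M' N N' : lmodType k)
    (f : M -> M') (g : N -> N') m n : linear f -> linear g ->
  tmap f g (m ⊗ n) = f m ⊗ g n.
Proof. by move=> lf lg; rewrite /tmap tlift_pure //; exact: tmap_bilin. Qed.

Lemma tmap_linear (k : comPzRingType) (M M' N N' : lmodType k)
    (f : M -> M') (g : N -> N') : linear f -> linear g -> linear (tmap f g).
Proof. by move=> lf lg; apply: tlift_linear; exact: tmap_bilin. Qed.

Lemma tmap_id (k : comPzRingType) (M N : lmodType k) (x : tensor M N) :
  tmap id id x = x.
Proof. exact: tlift_eta. Qed.

Lemma lin_comp (k : comPzRingType) (U V W : lmodType k) (g : V -> W)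
  (f : U -> V) : linear g -> linear f -> linear (g \o f).
Proof. by move=> lg lf a x y /=; rewrite lf lg. Qed.

Lemma tmap_comp (k : comPzRingType) (M M' M'' N N' N'' : lmodType k)
    (f' : M' -> M'') (f : M -> M') (g' : N' -> N'') (g : N -> N') x :
  linear f -> linear g -> linear f' -> linear g' ->
  tmap f' g' (tmap f g x) = tmap (f' \o f) (g' \o g) x.
Proof.
move=> lf lg lf' lg'.
have l1 : linear (tmap f' g' \o tmap f g) by apply: lin_comp; exact: tmap_linear.
rewrite -[LHS]/((tmap f' g' \o tmap f g) x) (linear_tlift x l1); congr tlift.
by apply/funext=> m; apply/funext=> n /=; rewrite !tmap_pure.
Qed.

Section Quotient.
Variables (k : comPzRingType) (V : lmodType k).

Definition is_submod (W : V -> Prop) : Prop :=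
  W 0 /\ forall (a : k) u v, W u -> W v -> W (a *: u + v).

Definition span (S : V -> Prop) (v : V) : Prop :=
  forall W, is_submod W -> (forall s, S s -> W s) -> W v.

Lemma span_submod S : is_submod (span S).
Proof.
split=> [W [] //|a u v su sv W hW SW].
by case: (hW) => _; apply; [exact: su|exact: sv].
Qed.

Variable S : V -> Prop.

Definition quot_rel (u v : V) : bool := `[< span S (u - v) >].

Lemma quot_rel_refl : reflexive quot_rel.
Proof. by move=> u; apply/asboolP; rewrite subrr; case: (span_submod S). Qed.

Let spanN u : span S u -> span S (- u).
Proof.
case: (span_submod S) => s0 sl su.
by have := sl (-1) u 0 su s0; rewrite scaleN1r addr0.
Qed.

Let spanD u v : span S u -> span S v -> span S (u + v).
Proof.
by case: (span_submod S) => _ sl su sv; have := sl 1 u v su sv; rewrite scale1r.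
Qed.

Lemma quot_rel_sym : symmetric quot_rel.
Proof.
by move=> u v; apply/asboolP/asboolP=> /spanN; rewrite opprB.
Qed.

Lemma quot_rel_trans : transitive quot_rel.
Proof.
move=> v u w /asboolP uv /asboolP vw; apply/asboolP.
by have := spanD uv vw; rewrite addrA subrK.
Qed.

Canonical quot_equiv := EquivRel quot_rel quot_rel_refl quot_rel_sym quot_rel_trans.

Definition quotm := {eq_quot quot_equiv}.
HB.instance Definition _ := Choice.on quotm.
HB.instance Definition _ := EqQuotient.on quotm.

Definition qproj (v : V) : quotm := \pi_quotm v.

Lemma qprojP u v : qproj u = qproj v <-> span S (u - v).
Proof.
split=> [/eqP|h]; first by rewrite /qproj eqquotE => /asboolP.
by apply/eqP; rewrite /qproj eqquotE; apply/asboolP.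
Qed.

Lemma qreprK (x : quotm) : qproj (repr x) = x.
Proof. exact: reprK. Qed.

Lemma repr_qproj v : span S (repr (qproj v) - v).
Proof. by apply/qprojP; rewrite qreprK. Qed.

Let qadd (x y : quotm) : quotm := qproj (repr x + repr y).
Let qopp (x : quotm) : quotm := qproj (- repr x).
Let qscale (a : k) (x : quotm) : quotm := qproj (a *: repr x).

Let qaddE u v : qadd (qproj u) (qproj v) = qproj (u + v).
Proof.
by apply/qprojP; rewrite opprD addrACA; apply: spanD; exact: repr_qproj.
Qed.
Let qoppE u : qopp (qproj u) = qproj (- u).
Proof. by apply/qprojP; rewrite -opprD; apply: spanN; exact: repr_qproj. Qed.
Let qscaleE a u : qscale a (qproj u) = qproj (a *: u).
Proof.
apply/qprojP; rewrite -scalerBr -[_ *: _]addr0.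
by case: (span_submod S) => s0; apply=> //; exact: repr_qproj.
Qed.

Let qaddA : associative qadd.
Proof.
move=> x y z; rewrite -(qreprK x) -(qreprK y) -(qreprK z).
by rewrite !qaddE addrA.
Qed.
Let qaddC : commutative qadd.
Proof. by move=> x y; rewrite -(qreprK x) -(qreprK y) !qaddE addrC. Qed.
Let qadd0 : left_id (qproj 0) qadd.
Proof. by move=> x; rewrite -(qreprK x) qaddE add0r. Qed.
Let qaddN : left_inverse (qproj 0) qopp qadd.
Proof. by move=> x; rewrite -(qreprK x) qoppE qaddE addNr. Qed.

HB.instance Definition _ := GRing.isZmodule.Build quotm qaddA qaddC qadd0 qaddN.

Let qscaleA a b x : qscale a (qscale b x) = qscale (a * b) x.
Proof. by rewrite -(qreprK x) !qscaleE scalerA. Qed.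
Let qscale1 : left_id 1 qscale.
Proof. by move=> x; rewrite -(qreprK x) qscaleE scale1r. Qed.
Let qscaleDr : right_distributive qscale +%R.
Proof.
move=> a x y; rewrite -(qreprK x) -(qreprK y).
by rewrite -[_ + _]/(qadd _ _) -[RHS]/(qadd _ _) !(qaddE, qscaleE) scalerDr.
Qed.
Let qscaleDl x : {morph qscale^~ x : a b / a + b}.
Proof.
by move=> a b; rewrite -(qreprK x) -[RHS]/(qadd _ _) !(qaddE, qscaleE) scalerDl.
Qed.

HB.instance Definition _ := GRing.Zmodule_isLmodule.Build k quotm
  qscaleA qscale1 qscaleDr qscaleDl.

Lemma qproj_linear : linear qproj.
Proof.
move=> a u v; rewrite -[RHS]/(qadd (qscale a (qproj u)) (qproj v)).
by rewrite qscaleE qaddE.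
Qed.

End Quotient.

Section Submodule.
Variables (k : comPzRingType) (V : lmodType k) (W : V -> Prop).

Definition submod_pred (hW : is_submod W) : {pred V} := [pred v | `[< W v >]].

Lemma submod_pred_closed hW : submod_closed (submod_pred hW).
Proof.
split=> [|a u v]; first by apply/asboolP; case: (hW).
by move=> /asboolP Wu /asboolP Wv; apply/asboolP; case: (hW) => _; apply.
Qed.

HB.instance Definition _ hW :=
  GRing.isSubmodClosed.Build k V (submod_pred hW) (submod_pred_closed hW).

Record submod (hW : is_submod W) :=
  Submod { submod_val : V; _ : submod_val \in submod_pred hW }.

HB.instance Definition _ hW := [isSub for @submod_val hW].
HB.instance Definition _ hW := [Choice of submod hW by <:].
HB.instance Definition _ hW := [SubChoice_isSubLmodule of submod hW by <:].

End Submodule.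

Record category := Category {
  ob :> Type;
  homc : ob -> ob -> Type;
  idc : forall A, homc A A;
  compc : forall A B C, homc B C -> homc A B -> homc A C;
  comp1c : forall A B (f : homc A B), compc (idc B) f = f;
  compc1 : forall A B (f : homc A B), compc f (idc A) = f;
  compcA : forall A B C D (h : homc C D) (g : homc B C) (f : homc A B),
    compc h (compc g f) = compc (compc h g) f
}.
Arguments idc {c} A.
Notation "g ∘ f" := (compc g f) (at level 40, left associativity).

Definition is_iso (C : category) (A B : C) (f : homc A B) : Prop :=
  exists g : homc B A, g ∘ f = idc A /\ f ∘ g = idc B.

Record functor (C D : category) := Functor {
  fob :> C -> D;
  fmap : forall A B, homc A B -> homc (fob A) (fob B);
  fmap_id : forall A, fmap (idc A) = idc (fob A);
  fmap_comp : forall A B E (g : homc B E) (f : homc A B),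
    fmap (g ∘ f) = fmap g ∘ fmap f
}.
Arguments fmap {C D} F {A B} _ : rename.

Record equivalence (C D : category) (F : functor C D) (G : functor D C) :=
  Equivalence {
  eq_unit : forall A : C, homc A (G (F A));
  eq_counit : forall B : D, homc (F (G B)) B;
  eq_unit_nat : forall A A' (f : homc A A'),
    eq_unit A' ∘ f = fmap G (fmap F f) ∘ eq_unit A;
  eq_counit_nat : forall B B' (f : homc B B'),
    eq_counit B' ∘ fmap F (fmap G f) = f ∘ eq_counit B;
  eq_unit_iso : forall A, is_iso (eq_unit A);
  eq_counit_iso : forall B, is_iso (eq_counit B)
}.

Record monoidal (C : category) := Monoidal {
  tens : C -> C -> C;
  tensf : forall A A' B B', homc A A' -> homc B B' -> homc (tens A B) (tens A' B');
  tunit : C;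
  tassoc : forall A B E, homc (tens (tens A B) E) (tens A (tens B E));
  tlun : forall A, homc (tens tunit A) A;
  trun : forall A, homc (tens A tunit) A;
  tensf_id : forall A B, tensf (idc A) (idc B) = idc (tens A B);
  tensf_comp : forall A A' A'' B B' B'' (f' : homc A' A'') (f : homc A A')
      (g' : homc B' B'') (g : homc B B'),
    tensf (f' ∘ f) (g' ∘ g) = tensf f' g' ∘ tensf f g;
  tassoc_nat : forall A A' B B' E E' (f : homc A A') (g : homc B B') (h : homc E E'),
    tassoc A' B' E' ∘ tensf (tensf f g) h = tensf f (tensf g h) ∘ tassoc A B E;
  tlun_nat : forall A A' (f : homc A A'), tlun A' ∘ tensf (idc tunit) f = f ∘ tlun A;
  trun_nat : forall A A' (f : homc A A'), trun A' ∘ tensf f (idc tunit) = f ∘ trun A;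
  tassoc_iso : forall A B E, is_iso (tassoc A B E);
  tlun_iso : forall A, is_iso (tlun A);
  trun_iso : forall A, is_iso (trun A);
  tpentagon : forall A B E D,
    tensf (idc A) (tassoc B E D) ∘ tassoc A (tens B E) D ∘ tensf (tassoc A B E) (idc D)
    = tassoc A B (tens E D) ∘ tassoc (tens A B) E D;
  ttriangle : forall A B,
    tensf (idc A) (tlun B) ∘ tassoc A tunit B = tensf (trun A) (idc B)
}.

Section MonoidalFunctor.
Variables (C D : category) (TC : monoidal C) (TD : monoidal D).

Record strong_monoidal (F : functor C D) := StrongMonoidal {
  mf2 : forall A B, homc (tens TD (F A) (F B)) (F (tens TC A B));
  mf0 : homc (tunit TD) (F (tunit TC));
  mf2_nat : forall A A' B B' (f : homc A A') (g : homc B B'),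
    mf2 A' B' ∘ tensf TD (fmap F f) (fmap F g) = fmap F (tensf TC f g) ∘ mf2 A B;
  mf2_iso : forall A B, is_iso (mf2 A B);
  mf0_iso : is_iso mf0;
  mf_assoc : forall A B E,
    fmap F (tassoc TC A B E) ∘ mf2 (tens TC A B) E ∘ tensf TD (mf2 A B) (idc (F E))
    = mf2 A (tens TC B E) ∘ tensf TD (idc (F A)) (mf2 B E)
        ∘ tassoc TD (F A) (F B) (F E);
  mf_lun : forall A,
    fmap F (tlun TC A) ∘ mf2 (tunit TC) A ∘ tensf TD mf0 (idc (F A)) = tlun TD (F A);
  mf_run : forall A,
    fmap F (trun TC A) ∘ mf2 A (tunit TC) ∘ tensf TD (idc (F A)) mf0 = trun TD (F A)
}.
End MonoidalFunctor.

(* The four equations say that the unit Id -> GF and the counit FG -> Id are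
   monoidal natural transformations, for the composite monoidal structures on
   GF and FG. *)
Definition tensor_equivalence (C D : category) (TC : monoidal C) (TD : monoidal D)
    (F : functor C D) (G : functor D C) (E : equivalence F G) : Prop :=
  exists (phi : strong_monoidal TC TD F) (psi : strong_monoidal TD TC G),
  [/\ forall A B, fmap G (mf2 phi A B) ∘ mf2 psi (F A) (F B)
                    ∘ tensf TC (eq_unit E A) (eq_unit E B)
                  = eq_unit E (tens TC A B),
      fmap G (mf0 phi) ∘ mf0 psi = eq_unit E (tunit TC),
      forall A B, eq_counit E (tens TD A B)
                    ∘ (fmap F (mf2 psi A B) ∘ mf2 phi (G A) (G B))
                  = tensf TD (eq_counit E A) (eq_counit E B)
    & eq_counit E (tunit TD) ∘ (fmap F (mf0 psi) ∘ mf0 phi) = idc (tunit TD)].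

(* Objects are the structures satisfying [cvalid]; morphisms are the functions
   satisfying [cmor].  Keeping the structure [cdat] apart from its axioms makes
   it possible to write down a structure before it is known to satisfy them. *)
Record ccat (k : comPzRingType) := CCat {
  cdat : Type;
  ccar : cdat -> lmodType k;
  cvalid : cdat -> Prop;
  cmor : forall A B : cdat, (ccar A -> ccar B) -> Prop;
  cmor_id : forall A, cmor (fun x : ccar A => x);
  cmor_comp : forall A B E (g : ccar B -> ccar E) (f : ccar A -> ccar B),
    cmor g -> cmor f -> cmor (g \o f)
}.

Section Concrete.
Variables (k : comPzRingType) (C : ccat k).

Record cob := Cob { cob_dat :> cdat C; cobP : cvalid cob_dat }.

Record chom (A B : cob) := CHom { chom_fun :> ccar A -> ccar B; chomP : cmor chom_fun }.

Lemma chom_eq A B (f g : chom A B) : chom_fun f =1 chom_fun g -> f = g.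
Proof.
case: f g => [f pf] [g pg] /= /funext fg; move: pf pg; rewrite fg => pf pg.
by congr CHom; exact: Prop_irrelevance.
Qed.

Definition cat_of : category.
Proof.
refine (@Category cob chom (fun A => CHom (@cmor_id k C A))
  (fun A B E g f => CHom (cmor_comp (chomP g) (chomP f))) _ _ _).
- by move=> A B f; exact: chom_eq.
- by move=> A B f; exact: chom_eq.
- by move=> A B E D h g f; exact: chom_eq.
Defined.

End Concrete.
Coercion cat_of : ccat >-> category.

Definition dat (k : comPzRingType) (C : ccat k) (A : C) : cdat C := @cob_dat k C A.

(* A function together with its source and target, so that functions between
   provably equal modules can be compared. *)
Record arrow (k : comPzRingType) :=
  Arrow { arr_src : lmodType k; arr_tgt : lmodType k; arr_fun : arr_src -> arr_tgt }.
Arguments Arrow {k} arr_src arr_tgt arr_fun.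

Definition fn (k : comPzRingType) (C : ccat k) (A B : C) (f : homc A B) :
  ccar (dat A) -> ccar (dat B) := @chom_fun k C A B f.

Definition arr (k : comPzRingType) (C : ccat k) (A B : C) (f : homc A B) : arrow k :=
  Arrow _ _ (fn f).

(* Formulas for a tensor product, its unit and its constraints, which make sense
   before the axioms of a monoidal category are known; [is_given_by] says that a
   monoidal category is the one they describe. *)
Record tensor_formulas (k : comPzRingType) (C : ccat k) := TensorFormulas {
  tf_tens : cdat C -> cdat C -> cdat C;
  tf_tensf : forall A A' B B' : cdat C, (ccar A -> ccar A') -> (ccar B -> ccar B') ->
    ccar (tf_tens A B) -> ccar (tf_tens A' B');
  tf_unit : cdat C;
  tf_assoc : forall A B E : cdat C,
    ccar (tf_tens (tf_tens A B) E) -> ccar (tf_tens A (tf_tens B E));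
  tf_lun : forall A : cdat C, ccar (tf_tens tf_unit A) -> ccar A;
  tf_run : forall A : cdat C, ccar (tf_tens A tf_unit) -> ccar A
}.

Record is_given_by (k : comPzRingType) (C : ccat k) (T : monoidal C)
    (t : tensor_formulas C) : Prop := IsGivenBy {
  gb_tens : forall A B : C, dat (tens T A B) = tf_tens t (dat A) (dat B);
  gb_tensf : forall (A A' B B' : C) (f : homc A A') (g : homc B B'),
    arr (tensf T f g) = Arrow _ _ (tf_tensf (t := t) (fn f) (fn g));
  gb_unit : dat (tunit T) = tf_unit t;
  gb_assoc : forall A B E : C,
    arr (tassoc T A B E) = Arrow _ _ (tf_assoc (t := t) (A := dat A) (B := dat B) (E := dat E));
  gb_lun : forall A : C, arr (tlun T A) = Arrow _ _ (tf_lun (t := t) (A := dat A));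
  gb_run : forall A : C, arr (trun T A) = Arrow _ _ (tf_run (t := t) (A := dat A))
}.

(* The inverse of the automorphism is kept as data; [is_hmod] determines it. *)
Record hmod_data (k : comPzRingType) := HModData {
  hm_car :> lmodType k;
  aut : hm_car -> hm_car;
  autV : hm_car -> hm_car
}.
Arguments aut {k h} _.
Arguments autV {k h} _.

Definition is_hmod (k : comPzRingType) (M : hmod_data k) : Prop :=
  [/\ linear (@aut k M), cancel (@aut k M) autV & cancel (@autV k M) aut].

Definition is_hmor (k : comPzRingType) (M N : hmod_data k) (f : M -> N) : Prop :=
  linear f /\ forall m, f (aut m) = aut (f m).

Record monHomBialg (k : comPzRingType) := MonHomBialg {
  hb_base :> hmod_data k;
  hmul : hb_base -> hb_base -> hb_base;
  hone : hb_base;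
  Delta : hb_base -> tensor hb_base hb_base;
  eps : hb_base -> k;
  hb_hmod : is_hmod hb_base;
  hmul_bilin : bilin hmul;
  Delta_linear : linear Delta;
  eps_linear : scalar eps;
  aut_hmul : forall a b, aut (hmul a b) = hmul (aut a) (aut b);
  aut_hone : aut hone = hone;
  hmulA : forall a b c, hmul (aut a) (hmul b c) = hmul (hmul a b) (aut c);
  hmul1 : forall a, hmul a hone = aut a;
  hmul1l : forall a, hmul hone a = aut a;
  Delta_aut : forall c, Delta (aut c) = slet c1 ⊗ c2 := Delta c in aut c1 ⊗ aut c2;
  eps_aut : forall c, eps (aut c) = eps c;
  DeltaA : forall c,
    (slet c1 ⊗ c2 := Delta c in autV c1 ⊗ Delta c2)
    = (slet c1 ⊗ c2 := Delta c in slet c11 ⊗ c12 := Delta c1 in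
         c11 ⊗ (c12 ⊗ autV c2));
  eps_counitr : forall c, (slet c1 ⊗ c2 := Delta c in eps c2 *: c1) = autV c;
  eps_counitl : forall c, (slet c1 ⊗ c2 := Delta c in eps c1 *: c2) = autV c;
  Delta_hmul : forall a b, Delta (hmul a b)
    = slet a1 ⊗ a2 := Delta a in slet b1 ⊗ b2 := Delta b in hmul a1 b1 ⊗ hmul a2 b2;
  Delta_hone : Delta hone = hone ⊗ hone;
  eps_hmul : forall a b, eps (hmul a b) = eps a * eps b;
  eps_hone : eps hone = 1
}.
Arguments hone {k} m.
Notation "a ⋅ b" := (hmul a b) (at level 40, left associativity).

Record monHomHopf (k : comPzRingType) := MonHomHopf {
  hh_bialg :> monHomBialg k;
  antip : hh_bialg -> hh_bialg;
  antip_linear : linear antip;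
  antip_aut : forall h, antip (aut h) = aut (antip h);
  antipl : forall h, (slet h1 ⊗ h2 := Delta h in antip h1 ⋅ h2) = eps h *: hone hh_bialg;
  antipr : forall h, (slet h1 ⊗ h2 := Delta h in h1 ⋅ antip h2) = eps h *: hone hh_bialg
}.

Section HomModules.
Variables (k : comPzRingType) (H : monHomHopf k) (M : hmod_data k).

Section LeftModule.
Variable lact : H -> M -> M.
Local Notation "h ▷ m" := (lact h m) (at level 40).

Record is_lmodule : Prop := IsLModule {
  lact_bilin : bilin lact;
  aut_lact : forall h m, aut (h ▷ m) = aut h ▷ aut m;
  lactA : forall g h m, aut g ▷ (h ▷ m) = (g ⋅ h) ▷ aut m;
  lact1 : forall m, hone H ▷ m = aut m
}.
End LeftModule.

Section RightModule.
Variable ract : M -> H -> M.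
Local Notation "m ◁ h" := (ract m h) (at level 40).

Record is_rmodule : Prop := IsRModule {
  ract_bilin : bilin ract;
  aut_ract : forall m h, aut (m ◁ h) = aut m ◁ aut h;
  ractA : forall m g h, (m ◁ g) ◁ aut h = aut m ◁ (g ⋅ h);
  ract1 : forall m, m ◁ hone H = aut m
}.
End RightModule.

Record is_lcomodule (rho : M -> tensor H M) : Prop := IsLComodule {
  lcoact_linear : linear rho;
  lcoact_aut : forall m, rho (aut m) = slet h ⊗ n := rho m in aut h ⊗ aut n;
  lcoactA : forall m,
    (slet h ⊗ n := rho m in Delta h ⊗ autV n)
    = (slet h ⊗ n := rho m in slet g ⊗ p := rho n in (autV h ⊗ g) ⊗ p);
  lcoact_eps : forall m, (slet h ⊗ n := rho m in eps h *: n) = autV m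
}.

Record is_rcomodule (sigma : M -> tensor M H) : Prop := IsRComodule {
  rcoact_linear : linear sigma;
  rcoact_aut : forall m, sigma (aut m) = slet n ⊗ h := sigma m in aut n ⊗ aut h;
  rcoactA : forall m,
    (slet n ⊗ h := sigma m in autV n ⊗ Delta h)
    = (slet n ⊗ h := sigma m in slet p ⊗ g := sigma n in p ⊗ (g ⊗ autV h));
  rcoact_eps : forall m, (slet n ⊗ h := sigma m in eps h *: n) = autV m
}.

Section Compatibility.
Variables (lact : H -> M -> M) (ract : M -> H -> M).
Variables (rho : M -> tensor H M) (sigma : M -> tensor M H).
Local Notation "h ▷ m" := (lact h m) (at level 40).
Local Notation "m ◁ h" := (ract m h) (at level 40).

Definition bimodule_compat : Prop :=
  forall g m h, (g ▷ m) ◁ aut h = aut g ▷ (m ◁ h).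

Definition hopf_compat : Prop := forall h m,
  rho (h ▷ m) = slet h1 ⊗ h2 := Delta h in slet a ⊗ n := rho m in
                  (h1 ⋅ a) ⊗ (h2 ▷ n).

Definition lcovariant : Prop := forall h m g,
  rho ((h ▷ m) ◁ aut g)
  = slet h1 ⊗ h2 := Delta (aut h) in slet a ⊗ n := rho m in
    slet g1 ⊗ g2 := Delta g in
      (h1 ⋅ (a ⋅ g1)) ⊗ (h2 ▷ (n ◁ g2)).

Definition rcovariant : Prop := forall h m g,
  sigma ((h ▷ m) ◁ aut g)
  = slet h1 ⊗ h2 := Delta (aut h) in slet n ⊗ a := sigma m in
    slet g1 ⊗ g2 := Delta g in
      (h1 ▷ (n ◁ g1)) ⊗ (h2 ⋅ (a ⋅ g2)).

Definition bicomodule_compat : Prop := forall m,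
  (slet a ⊗ n := rho m in a ⊗ sigma n)
  = (slet n ⊗ h := sigma m in slet a ⊗ p := rho n in aut a ⊗ (p ⊗ autV h)).

Definition yd_compat : Prop := forall n h,
  (slet n0 ⊗ n1 := sigma n in slet h1 ⊗ h2 := Delta h in
     (n0 ◁ autV h1) ⊗ (n1 ⋅ autV h2))
  = (slet h1 ⊗ h2 := Delta h in slet p0 ⊗ p1 := sigma (n ◁ h2) in
       p0 ⊗ autV (h1 ⋅ p1)).

End Compatibility.
End HomModules.

Section HMod.
Variable k : comPzRingType.

Lemma is_hmor_id (M : hmod_data k) : is_hmor (fun m : M => m).
Proof. by []. Qed.

Lemma is_hmor_comp (M N P : hmod_data k) (g : N -> P) (f : M -> N) :
  is_hmor g -> is_hmor f -> is_hmor (g \o f).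
Proof.
by move=> [lg gc] [lf fc]; split=> [|m /=]; [exact: lin_comp|rewrite fc gc].
Qed.

Definition HM : ccat k := CCat (ccar := @hm_car k) (@is_hmod k) is_hmor_id is_hmor_comp.

End HMod.

Section Categories.
Variables (k : comPzRingType) (H : monHomHopf k).

Lemma lcolinear_comp (M N P : lmodType k) (rM : M -> tensor H M)
    (rN : N -> tensor H N) (rP : P -> tensor H P) (g : N -> P) (f : M -> N) :
  linear g -> linear f ->
  (forall n, rP (g n) = slet h ⊗ p := rN n in h ⊗ g p) ->
  (forall m, rN (f m) = slet h ⊗ p := rM m in h ⊗ f p) ->
  forall m, rP ((g \o f) m) = slet h ⊗ p := rM m in h ⊗ (g \o f) p.
Proof.
move=> lg lf eg ef m /=; rewrite eg ef.
by rewrite -[LHS]/(tmap id g (tmap id f (rM m))) tmap_comp.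
Qed.

Lemma rcolinear_comp (M N P : lmodType k) (rM : M -> tensor M H)
    (rN : N -> tensor N H) (rP : P -> tensor P H) (g : N -> P) (f : M -> N) :
  linear g -> linear f ->
  (forall n, rP (g n) = slet p ⊗ h := rN n in g p ⊗ h) ->
  (forall m, rN (f m) = slet p ⊗ h := rM m in f p ⊗ h) ->
  forall m, rP ((g \o f) m) = slet p ⊗ h := rM m in (g \o f) p ⊗ h.
Proof.
move=> lg lf eg ef m /=; rewrite eg ef.
by rewrite -[LHS]/(tmap g id (tmap f id (rM m))) tmap_comp.
Qed.

Record hopf_data := HopfData {
  hp_base :> hmod_data k;
  hp_act : H -> hp_base -> hp_base;
  hp_coact : hp_base -> tensor H hp_base
}.

Record is_hopf (M : hopf_data) : Prop := IsHopf {
  hopf_hmod : is_hmod M;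
  hopf_lmodule : is_lmodule (@hp_act M);
  hopf_lcomodule : is_lcomodule (@hp_coact M);
  hopf_compatible : hopf_compat (@hp_act M) (@hp_coact M)
}.

Record is_hopf_mor (M N : hopf_data) (f : M -> N) : Prop := IsHopfMor {
  hopf_hmor : is_hmor f;
  hopf_llinear : forall h m, f (hp_act h m) = hp_act h (f m);
  hopf_lcolinear : forall m, hp_coact (f m) = slet h ⊗ n := hp_coact m in h ⊗ f n
}.

Lemma is_hopf_mor_id M : is_hopf_mor (fun m : hp_base M => m).
Proof. by split=> // m; rewrite [RHS]tlift_eta. Qed.

Lemma is_hopf_mor_comp (M N P : hopf_data) (g : N -> P) (f : M -> N) :
  is_hopf_mor g -> is_hopf_mor f -> is_hopf_mor (g \o f).
Proof.
move=> [hg lg cg] [hf lf cf]; split.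
- exact: is_hmor_comp.
- by move=> h m /=; rewrite lf lg.
- by apply: lcolinear_comp cg cf; [case: hg|case: hf].
Qed.

Definition HopfMod : ccat k :=
  CCat (ccar := fun M : hopf_data => M) is_hopf is_hopf_mor_id is_hopf_mor_comp.

Record rmod_data := RModData {
  rm_base :> hmod_data k;
  rm_act : rm_base -> H -> rm_base
}.

Record is_rmod (M : rmod_data) : Prop := IsRMod {
  rmod_hmod : is_hmod M;
  rmod_rmodule : is_rmodule (@rm_act M)
}.

Record is_rmod_mor (M N : rmod_data) (f : M -> N) : Prop := IsRModMor {
  rmod_hmor : is_hmor f;
  rmod_rlinear : forall m h, f (rm_act m h) = rm_act (f m) h
}.

Lemma is_rmod_mor_id M : is_rmod_mor (fun m : rm_base M => m).
Proof. by split. Qed.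

Lemma is_rmod_mor_comp (M N P : rmod_data) (g : N -> P) (f : M -> N) :
  is_rmod_mor g -> is_rmod_mor f -> is_rmod_mor (g \o f).
Proof.
move=> [hg lg] [hf lf]; split; first exact: is_hmor_comp.
by move=> m h /=; rewrite lf lg.
Qed.

Definition RMod : ccat k :=
  CCat (ccar := fun M : rmod_data => M) is_rmod is_rmod_mor_id is_rmod_mor_comp.

Record yd_data := YDData {
  yd_rmod :> rmod_data;
  yd_coact : yd_rmod -> tensor yd_rmod H
}.

Record is_yd (M : yd_data) : Prop := IsYD {
  yd_is_rmod : is_rmod M;
  yd_rcomodule : is_rcomodule (@yd_coact M);
  yd_compatible : yd_compat (@rm_act M) (@yd_coact M)
}.

Record is_yd_mor (M N : yd_data) (f : M -> N) : Prop := IsYDMor {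
  yd_rmod_mor : is_rmod_mor f;
  yd_rcolinear : forall m, yd_coact (f m) = slet n ⊗ h := yd_coact m in f n ⊗ h
}.

Lemma is_yd_mor_id M : is_yd_mor (fun m : yd_rmod M => m).
Proof.
by split=> [|m]; [exact: is_rmod_mor_id|rewrite [RHS]tlift_eta].
Qed.

Lemma is_yd_mor_comp (M N P : yd_data) (g : N -> P) (f : M -> N) :
  is_yd_mor g -> is_yd_mor f -> is_yd_mor (g \o f).
Proof.
move=> [hg cg] [hf cf]; split; first exact: is_rmod_mor_comp.
by apply: rcolinear_comp cg cf; [case: hg => [[]]|case: hf => [[]]].
Qed.

Definition YD : ccat k :=
  CCat (ccar := fun M : yd_data => M) is_yd is_yd_mor_id is_yd_mor_comp.

Record lcov_data := LCovData {
  lc_hopf :> hopf_data;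
  lc_act : lc_hopf -> H -> lc_hopf
}.

Record is_lcov (M : lcov_data) : Prop := IsLCov {
  lcov_hmod : is_hmod M;
  lcov_lmodule : is_lmodule (@hp_act M);
  lcov_rmodule : is_rmodule (@lc_act M);
  lcov_bimodule : bimodule_compat (@hp_act M) (@lc_act M);
  lcov_lcomodule : is_lcomodule (@hp_coact M);
  lcov_covariant : lcovariant (@hp_act M) (@lc_act M) (@hp_coact M)
}.

Record is_lcov_mor (M N : lcov_data) (f : M -> N) : Prop := IsLCovMor {
  lcov_hopf_mor : is_hopf_mor f;
  lcov_rlinear : forall m h, f (lc_act m h) = lc_act (f m) h
}.

Lemma is_lcov_mor_id M : is_lcov_mor (fun m : lc_hopf M => m).
Proof. by split=> //; exact: is_hopf_mor_id. Qed.

Lemma is_lcov_mor_comp (M N P : lcov_data) (g : N -> P) (f : M -> N) :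
  is_lcov_mor g -> is_lcov_mor f -> is_lcov_mor (g \o f).
Proof.
move=> [hg lg] [hf lf]; split; first exact: is_hopf_mor_comp.
by move=> m h /=; rewrite lf lg.
Qed.

Definition LCov : ccat k :=
  CCat (ccar := fun M : lcov_data => M) is_lcov is_lcov_mor_id is_lcov_mor_comp.

Record bicov_data := BicovData {
  bc_lcov :> lcov_data;
  bc_coact : bc_lcov -> tensor bc_lcov H
}.

Record is_bicov (M : bicov_data) : Prop := IsBicov {
  bicov_is_lcov : is_lcov M;
  bicov_rcomodule : is_rcomodule (@bc_coact M);
  bicov_covariant : rcovariant (@hp_act M) (@lc_act M) (@bc_coact M);
  bicov_bicomodule : bicomodule_compat (@hp_coact M) (@bc_coact M)
}.

Record is_bicov_mor (M N : bicov_data) (f : M -> N) : Prop := IsBicovMor {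
  bicov_lcov_mor : is_lcov_mor f;
  bicov_rcolinear : forall m, bc_coact (f m) = slet n ⊗ h := bc_coact m in f n ⊗ h
}.

Lemma is_bicov_mor_id M : is_bicov_mor (fun m : bc_lcov M => m).
Proof.
by split=> [|m]; [exact: is_lcov_mor_id|rewrite [RHS]tlift_eta].
Qed.

Lemma is_bicov_mor_comp (M N P : bicov_data) (g : N -> P) (f : M -> N) :
  is_bicov_mor g -> is_bicov_mor f -> is_bicov_mor (g \o f).
Proof.
move=> [hg cg] [hf cf]; split; first exact: is_lcov_mor_comp.
by apply: rcolinear_comp cg cf; [case: hg => [[[]]]|case: hf => [[[]]]].
Qed.

Definition Bicov : ccat k :=
  CCat (ccar := fun M : bicov_data => M) is_bicov is_bicov_mor_id is_bicov_mor_comp.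

Lemma tlift_tmap (M M' N N' P : lmodType k) (u : M -> M') (v : N -> N')
    (f : M' -> N' -> P) x : linear u -> linear v -> bilin f ->
  tlift f (tmap u v x) = slet m ⊗ n := x in f (u m) (v n).
Proof.
move=> lu lv bf.
have l : linear (tlift f \o tmap u v).
  by apply: lin_comp; [exact: tlift_linear|exact: tmap_linear].
rewrite -[LHS]/((tlift f \o tmap u v) x) (linear_tlift x l); congr tlift.
by apply/funext=> m; apply/funext=> n /=; rewrite tmap_pure // tlift_pure.
Qed.

Lemma is_lcov_hopf (M : lcov_data) : is_lcov M -> is_hopf M.
Proof.
case=> hM hl hr hb hc cov; split=> // h m.
have [lM autK autVK] := hM; have [lH HK HVK] := hb_hmod H.
have := cov (autV h) (autV m) (hone H).
rewrite aut_hone (ract1 hr) (aut_lact hl) HVK autVK => ->.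
rewrite -{2}[m]autVK (lcoact_aut hc) -/(tmap _ _ _).
congr tlift; apply/funext=> h1; apply/funext=> h2.
have lm := (hmul_bilin H).1; have la := (lact_bilin hl).1.
rewrite tlift_tmap //; last exact: (@tmap_bilin k).
congr tlift; apply/funext=> a; apply/funext=> n.
rewrite Delta_hone tlift_pure; first by rewrite hmul1 (ract1 hr).
apply: (@tmap_bilin k _ _ _ _ (fun g1 => h1 ⋅ (a ⋅ g1))
  (fun g2 => hp_act h2 (lc_act n g2))) => b x y.
  by rewrite !lm.
by rewrite (ract_bilin hr).1 la.
Qed.

Definition RMod_HM_ob (A : RMod) : HM k :=
  @Cob k (HM k) (rm_base (dat A)) (rmod_hmod (cobP A)).

Definition RMod_HM : functor RMod (HM k).
Proof.
refine (@Functor RMod (HM k) RMod_HM_ob (fun A B f =>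
  @CHom k (HM k) (RMod_HM_ob A) (RMod_HM_ob B) (fn f) (rmod_hmor (chomP f))) _ _).
- by move=> A; exact: chom_eq.
- by move=> A B E g f; exact: chom_eq.
Defined.

Definition YD_HM_ob (A : YD) : HM k :=
  @Cob k (HM k) (rm_base (yd_rmod (dat A))) (rmod_hmod (yd_is_rmod (cobP A))).

Definition YD_HM : functor YD (HM k).
Proof.
refine (@Functor YD (HM k) YD_HM_ob (fun A B f =>
  @CHom k (HM k) (YD_HM_ob A) (YD_HM_ob B) (fn f) (rmod_hmor (yd_rmod_mor (chomP f)))) _ _).
- by move=> A; exact: chom_eq.
- by move=> A B E g f; exact: chom_eq.
Defined.

Definition LCov_HopfMod_ob (A : LCov) : HopfMod :=
  @Cob k HopfMod (lc_hopf (dat A)) (is_lcov_hopf (cobP A)).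

Definition LCov_HopfMod : functor LCov HopfMod.
Proof.
refine (@Functor LCov HopfMod LCov_HopfMod_ob (fun A B f =>
  @CHom k HopfMod (LCov_HopfMod_ob A) (LCov_HopfMod_ob B) (fn f) (lcov_hopf_mor (chomP f))) _ _).
- by move=> A; exact: chom_eq.
- by move=> A B E g f; exact: chom_eq.
Defined.

Definition Bicov_HopfMod_ob (A : Bicov) : HopfMod :=
  @Cob k HopfMod (lc_hopf (bc_lcov (dat A))) 
    (is_lcov_hopf (bicov_is_lcov (cobP A))).

Definition Bicov_HopfMod : functor Bicov HopfMod.
Proof.
refine (@Functor Bicov HopfMod Bicov_HopfMod_ob (fun A B f =>
  @CHom k HopfMod (Bicov_HopfMod_ob A) (Bicov_HopfMod_ob B) (fn f) 
    (lcov_hopf_mor (bicov_lcov_mor (chomP f)))) _ _).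
- by move=> A; exact: chom_eq.
- by move=> A B E g f; exact: chom_eq.
Defined.

Definition hm_tens (M N : hmod_data k) : hmod_data k :=
  HModData (tmap (@aut k M) (@aut k N)) (tmap (@autV k M) (@autV k N)).

Definition hm_unit : hmod_data k := @HModData k k^o id id.

Definition hm_assoc (M N P : hmod_data k) (x : tensor (tensor M N) P) :
    tensor M (tensor N P) :=
  slet y ⊗ p := x in slet m ⊗ n := y in aut m ⊗ (n ⊗ autV p).

Definition hm_lun (M : hmod_data k) (y : tensor k^o M) : M :=
  tlift (fun (x : k^o) (m : M) => (x : k) *: aut m) y.

Definition hm_run (M : hmod_data k) (y : tensor M k^o) : M :=
  tlift (fun (m : M) (x : k^o) => (x : k) *: aut m) y.

Definition rmod_tens (M N : rmod_data) : rmod_data :=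
  @RModData (hm_tens M N) (fun x h =>
    slet m ⊗ n := x in slet h1 ⊗ h2 := Delta h in rm_act m h1 ⊗ rm_act n h2).

Definition rmod_unit : rmod_data :=
  @RModData hm_unit (fun x h => eps h * (x : k)).

Definition RMod_tensor : tensor_formulas RMod :=
  @TensorFormulas k RMod rmod_tens (fun _ _ _ _ f g => tmap f g) rmod_unit
    (fun M N P => @hm_assoc M N P) (fun M => @hm_lun M) (fun M => @hm_run M).

Definition yd_tens (M N : yd_data) : yd_data :=
  @YDData (rmod_tens M N) (fun x =>
    slet m ⊗ n := x in slet m0 ⊗ m1 := yd_coact m in slet n0 ⊗ n1 := yd_coact n in
      (m0 ⊗ n0) ⊗ (m1 ⋅ n1)).

Definition yd_unit : yd_data := @YDData rmod_unit (fun x => x ⊗ hone H).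

Definition YD_tensor : tensor_formulas YD :=
  @TensorFormulas k YD yd_tens (fun _ _ _ _ f g => tmap f g) yd_unit
    (fun M N P => @hm_assoc M N P) (fun M => @hm_lun M) (fun M => @hm_run M).

Section TensorH.
Variables M N : lcov_data.

Definition tensorH_rel (x : tensor M N) : Prop :=
  exists (m : M) (h : H) (n : N),
    x = lc_act m h ⊗ n - aut m ⊗ hp_act h (autV n).

Definition tensorH : lmodType k := quotm tensorH_rel.

Definition pureH (m : M) (n : N) : tensorH := qproj tensorH_rel (m ⊗ n).

(* The linear map on the quotient induced by f when f is bilinear and respects
   the relations; no meaning otherwise. *)
Definition tliftH (P : lmodType k) (f : M -> N -> P) (y : tensorH) : P :=
  tlift f (repr (y : quotm tensorH_rel)).

End TensorH.

Local Notation "m ⊗H n" := (pureH m n) (at level 45, no associativity).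
Local Notation "'sletH' a ⊗ b := x 'in' e" := (tliftH (fun a b => e) x)
  (at level 200, a name, b name, x at level 200, e at level 200).

Definition tensorH_map (M M' N N' : lcov_data) (f : M -> M') (g : N -> N')
    (y : tensorH M N) : tensorH M' N' :=
  sletH m ⊗ n := y in f m ⊗H g n.

Definition lcov_tens (M N : lcov_data) : lcov_data :=
  @LCovData
    (@HopfData
      (@HModData k (tensorH M N)
        (tensorH_map (@aut k M) (@aut k N)) (tensorH_map (@autV k M) (@autV k N)))
      (fun h y => sletH m ⊗ n := y in hp_act (autV h) m ⊗H aut n)
      (fun y => sletH m ⊗ n := y in
         slet a ⊗ m0 := hp_coact m in slet b ⊗ n0 := hp_coact n in
           (a ⋅ b) ⊗ (m0 ⊗H n0)))
    (fun y h => sletH m ⊗ n := y in aut m ⊗H lc_act n (autV h)).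

Definition lcov_unit : lcov_data :=
  @LCovData (@HopfData H (fun h g => h ⋅ g) (@Delta k H)) (fun g h => g ⋅ h).

Definition tensorH_assoc (M N P : lcov_data) (y : tensorH (lcov_tens M N) P) :
    tensorH M (lcov_tens N P) :=
  tliftH (fun (x : lcov_tens M N) (p : P) =>
    sletH m ⊗ n := (x : tensorH M N) in
      aut m ⊗H ((n ⊗H autV p : tensorH N P) : lcov_tens N P)) y.

Definition tensorH_lun (M : lcov_data) (y : tensorH lcov_unit M) : M :=
  tliftH (fun (h : lcov_unit) (m : M) => hp_act (h : H) m) y.

Definition tensorH_run (M : lcov_data) (y : tensorH M lcov_unit) : M :=
  tliftH (fun (m : M) (h : lcov_unit) => lc_act m (h : H)) y.

Definition LCov_tensor : tensor_formulas LCov :=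
  @TensorFormulas k LCov lcov_tens (fun _ _ _ _ f g => tensorH_map f g) lcov_unit
    (fun M N P => @tensorH_assoc M N P) (fun M => @tensorH_lun M)
    (fun M => @tensorH_run M).

Definition bicov_tens (M N : bicov_data) : bicov_data :=
  @BicovData (lcov_tens M N) (fun y => sletH m ⊗ n := y in
    slet m0 ⊗ m1 := bc_coact m in slet n0 ⊗ n1 := bc_coact n in
      (m0 ⊗H n0) ⊗ (m1 ⋅ n1)).

Definition bicov_unit : bicov_data := @BicovData lcov_unit (@Delta k H).

Definition Bicov_tensor : tensor_formulas Bicov :=
  @TensorFormulas k Bicov bicov_tens (fun _ _ _ _ f g => tensorH_map f g) bicov_unit
    (fun M N P => @tensorH_assoc M N P) (fun M => @tensorH_lun M)
    (fun M => @tensorH_run M).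

Definition F_hopf (V : hmod_data k) : hopf_data :=
  @HopfData (hm_tens H V)
    (fun h x => slet g ⊗ v := x in (autV h ⋅ g) ⊗ aut v)
    (fun x => slet h ⊗ v := x in slet h1 ⊗ h2 := Delta h in
       aut h1 ⊗ (h2 ⊗ autV v)).

Definition F_lcov (V : rmod_data) : lcov_data :=
  @LCovData (F_hopf V) (fun x g =>
    slet h ⊗ v := x in slet g1 ⊗ g2 := Delta g in (h ⋅ g1) ⊗ rm_act v g2).

Definition F_bicov (V : yd_data) : bicov_data :=
  @BicovData (F_lcov V) (fun x =>
    slet h ⊗ v := x in slet h1 ⊗ h2 := Delta h in slet v0 ⊗ v1 := yd_coact v in
      (h1 ⊗ v0) ⊗ (h2 ⋅ v1)).

Definition coinvariant (M : hopf_data) (m : M) : Prop :=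
  hp_coact m = hone H ⊗ autV m.

Lemma coinvariant_submod (M : hopf_data) :
  is_hmod M -> is_lcomodule (@hp_coact M) -> is_submod (@coinvariant M).
Proof.
move=> [lM K VK] hc.
have lV : linear (@autV k M).
  by move=> a x y; rewrite -[LHS]/(autV _) -{1}(VK x) -{1}(VK y) -lM K.
have lp := (pure_bilin H M).1 (hone H).
split=> [|a u v]; rewrite /coinvariant.
  by rewrite (lin0 (lcoact_linear hc)) (lin0 lV) (lin0 lp).
by move=> cu cv; rewrite (lcoact_linear hc) cu cv lV lp.
Qed.

Section Coinvariants.
Variables (M : hopf_data) (hM : is_submod (@coinvariant M)).

(* m itself when m is coinvariant, and 0 otherwise. *)
Definition to_coH (m : M) : submod hM := insubd (0 : submod hM) m.

Definition coH : hmod_data k :=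
  @HModData k (submod hM)
    (fun m => to_coH (aut (val m))) (fun m => to_coH (autV (val m))).

End Coinvariants.

Definition PL (M : hopf_data) (m : M) : M :=
  slet h ⊗ n := hp_coact m in hp_act (antip h) n.

Definition lcov_coinv (M : lcov_data) (hM : is_lcov M) :
    is_submod (@coinvariant M) :=
  coinvariant_submod (lcov_hmod hM) (lcov_lcomodule hM).

Definition G_hopf (M : HopfMod) : hmod_data k :=
  coH (coinvariant_submod (hopf_hmod (cobP M)) (hopf_lcomodule (cobP M))).

Definition G_mor (M N : HopfMod) (f : homc M N) (m : G_hopf M) : G_hopf N :=
  to_coH _ (fn f (val m)).

Definition coH_rmod (M : lcov_data) (hM : is_lcov M) : rmod_data :=
  @RModData (coH (lcov_coinv hM)) (fun m h =>
    to_coH (lcov_coinv hM) (PL (lc_act (val m : M) h))).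

Definition G_lcov (M : LCov) : rmod_data := coH_rmod (cobP M).

(* The restricted coaction: sigma(m), for m coinvariant, is read in
   coH(M) ⊗ H through the inclusion coH(M) ⊗ H -> M ⊗ H. *)
Definition G_bicov (M : Bicov) : yd_data :=
  let hM := bicov_is_lcov (cobP M) in
  @YDData (coH_rmod hM) (fun m =>
    xget 0 [set y | tmap (fun n : submod (lcov_coinv hM) => val n) id y
                    = bc_coact (val m)]%classic).

End Categories.

Section Induced.
Variables (k : comPzRingType) (C0 D0 C D : ccat k).
Variables (U : functor C C0) (V : functor D D0).

(* E lies strictly over E0 along the forgetful functors U and V.  Objects of a
   [ccat] are equal when their structures [dat] are, and morphisms are compared
   through their underlying functions. *)
Record induced_by (F0 : functor C0 D0) (G0 : functor D0 C0) (E0 : equivalence F0 G0)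
    (F : functor C D) (G : functor D C) (E : equivalence F G) : Prop := InducedBy {
  ind_F : forall A : C, dat (V (F A)) = dat (F0 (U A));
  ind_fmapF : forall (A B : C) (f : homc A B), arr (fmap F f) = arr (fmap F0 (fmap U f));
  ind_G : forall A : D, dat (U (G A)) = dat (G0 (V A));
  ind_fmapG : forall (A B : D) (g : homc A B), arr (fmap G g) = arr (fmap G0 (fmap V g));
  ind_unit : forall A : C, arr (eq_unit E A) = arr (eq_unit E0 (U A));
  ind_counit : forall A : D, arr (eq_counit E A) = arr (eq_counit E0 (V A))
}.

(* [FC] and [GD] are the structures that the induced functors must put on the
   objects; [tC] and [tD] are the tensor products. *)
Definition induces_tensor_equivalence (F0 : functor C0 D0) (G0 : functor D0 C0)
    (E0 : equivalence F0 G0) (tC : tensor_formulas C) (tD : tensor_formulas D)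
    (FC : cdat C -> cdat D) (GD : D -> cdat C) : Prop :=
  exists (TC : monoidal C) (TD : monoidal D) (F : functor C D) (G : functor D C)
         (E : equivalence F G),
  [/\ is_given_by TC tC /\ is_given_by TD tD,
      forall A : C, dat (F A) = FC (dat A),
      forall B : D, dat (G B) = GD B,
      induced_by E0 E
    & tensor_equivalence TC TD E].

End Induced.

(* Main.v *)
Require Import Defs.
From mathcomp Require Import all_boot all_order all_algebra.
From mathcomp Require Import boolp classical_sets.

(* The automorphisms alpha, mu only twist the classical argument.  For a left
   Hom-Hopf module M the map P_L(m) = S(m_(-1)) m_(0) projects M onto its
   coinvariants and m = m_(-1) P_L(m_(0)), so h (x) v |-> h v is an isomorphism
   from H (x) coH(M) to M, whose inverse is m |-> m_(-1) (x) P_L(m_(0)); this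
   isomorphism respects the right action (and coaction) as soon as coH(M) carries
   m <| h = P_L(m h) (and the restricted coaction).

   The free functor is strong monoidal through
     (h (x) v) (x)_H (g (x) w) |->
        h alpha(g_1) (x) (nu^-1(v) <| g_2 (x) w),
   the inverse of h (x) (v (x) w) |-> (alpha^-1(h) (x) v) (x)_H (1 (x) w).
   Since the unit and the counit satisfy the triangle identities, the mates of
   this structure under the adjunction make the coinvariants functor strong
   monoidal, and the unit and the counit monoidal. *)

Set Implicit Arguments.
Unset Strict Implicit.
Unset Printing Implicit Defensive.

Import GRing.Theory.
Local Open Scope ring_scope.

(** * Monoidal structure on an adjoint equivalence *)

(** Two levels are kept apart. Abstractly, a strong monoidal structure on the free functor alone is
    enough: the triangle identities, which [equivalence] does not contain and which are proved for
    the concrete unit and counit, force the structure on the coinvariants functor. Concretely, every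
    identity is an equation between linear maps on iterated tensor products and is checked on pure
    tensors; the recurring difficulty is to bring two Sweedler sums to the same iterated coproduct
    with the right powers of the twist, which is why coassociativity is always stated solved for one
    of its sides. That P_L has coinvariant values rests on the antipode reversing Delta, which is
    not an axiom and comes from the uniqueness of convolution inverses. For bicovariant bimodules
    the coherence equations are those of the left-covariant case, because the underlying functions
    are the same; only colinearity is new. The Yetter-Drinfeld condition of V is what makes the
    right coaction of H ⊗ V compatible with the right action, and what makes the tensor comparison
    right colinear. Conversely it holds on coH(M) because the right coaction of v h can be computed
    in two ways. *)

Section Isomorphisms.
Variable C : category.

Lemma is_iso_comp (A B E : C) (g : homc B E) (f : homc A B) :
  is_iso g -> is_iso f -> is_iso (g ∘ f).
Proof.
move=> [g' [g'g gg']] [f' [f'f ff']]; exists (f' ∘ g'); split.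
  by rewrite -compcA [g' ∘ _]compcA g'g comp1c.
by rewrite -compcA [f ∘ _]compcA ff' comp1c.
Qed.

Lemma iso_epi (A B E : C) (f : homc A B) (g h : homc B E) :
  is_iso f -> g ∘ f = h ∘ f -> g = h.
Proof.
by move=> [f' [_ ff']] gh; rewrite -[g]compc1 -[h]compc1 -ff' !compcA gh.
Qed.

Lemma is_iso_id (A : C) : is_iso (idc A).
Proof. by exists (idc A); rewrite !comp1c. Qed.

End Isomorphisms.

Lemma is_iso_fmap (C D : category) (F : functor C D) (A B : C) (f : homc A B) :
  is_iso f -> is_iso (fmap F f).
Proof.
by move=> [g [gf fg]]; exists (fmap F g); rewrite -!fmap_comp gf fg !fmap_id.
Qed.

Lemma is_iso_tensf (C : category) (T : monoidal C) (A A' B B' : C)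
    (f : homc A A') (g : homc B B') :
  is_iso f -> is_iso g -> is_iso (tensf T f g).
Proof.
move=> [f' [f'f ff']] [g' [g'g gg']]; exists (tensf T f' g').
by rewrite -!tensf_comp f'f g'g ff' gg' !tensf_id.
Qed.

Section DoctrinalAdjunction.
Variables (C D : category) (TC : monoidal C) (TD : monoidal D).
Variables (F : functor C D) (G : functor D C) (E : equivalence F G).
(** [equivalence] carries no triangle identity, so its unit and counit need not form an adjunction.
    The identities are assumed here and verified later on the concrete unit and counit. *)
Hypothesis zig : forall A, eq_counit E (F A) ∘ fmap F (eq_unit E A) = idc (F A).
Hypothesis zag : forall B, fmap G (eq_counit E B) ∘ eq_unit E (G B) = idc (G B).
Variable phi : strong_monoidal TC TD F.

Local Notation η := (eq_unit E).
Local Notation ε := (eq_counit E).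

(** The transpose [f ↦ ε ∘ F f] has the retraction [u ↦ G u ∘ η], by naturality of the unit and
    [zag]. It carries each coherence law of [G] to an equation in [D], where [psi2E] applies. *)
Let transpose_inj (A : C) (B : D) (f g : homc A (G B)) :
  ε B ∘ fmap F f = ε B ∘ fmap F g -> f = g.
Proof.
have K h : fmap G (ε B ∘ fmap F h) ∘ η A = h.
  by rewrite fmap_comp -compcA -eq_unit_nat compcA zag comp1c.
by move=> fg; rewrite -(K f) fg K.
Qed.

Variables (psi2 : forall A B : D, homc (tens TC (G A) (G B)) (G (tens TD A B)))
  (psi0 : homc (tunit TC) (G (tunit TD))).
(** Up to the isomorphism [mf2 phi], the transpose of [psi2] is [ε ⊗ ε]: this determines [psi2] as
    the mate of the inverse of [mf2 phi]. It is also the compatibility of the counit with tensor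
    products. *)
Hypothesis psi2E : forall A B,
  ε (tens TD A B) ∘ (fmap F (psi2 A B) ∘ mf2 phi (G A) (G B)) = tensf TD (ε A) (ε B).
Hypothesis psi0E : ε (tunit TD) ∘ (fmap F psi0 ∘ mf0 phi) = idc (tunit TD).
Hypotheses (psi2_iso : forall A B, is_iso (psi2 A B)) (psi0_iso : is_iso psi0).

(** Composites are kept associated to the right; this variant and the next rewrite at the head of
    such a composite. *)
Let psi2E_pre (A B : D) X (x : homc X _) :
  ε (tens TD A B) ∘ (fmap F (psi2 A B) ∘ (mf2 phi (G A) (G B) ∘ x))
  = tensf TD (ε A) (ε B) ∘ x.
Proof. by rewrite -psi2E -!compcA. Qed.

Let counit_nat_pre (B B' : D) (f : homc B B') X (x : homc X _) :
  ε B' ∘ (fmap F (fmap G f) ∘ x) = f ∘ (ε B ∘ x).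
Proof. by rewrite compcA eq_counit_nat compcA. Qed.

(** Once transposed and with [mf2 phi] cancelled, the square is the naturality of the counit in each
    factor. *)
Let psi2_nat (A A' B B' : D) (f : homc A A') (g : homc B B') :
  psi2 A' B' ∘ tensf TC (fmap G f) (fmap G g) = fmap G (tensf TD f g) ∘ psi2 A B.
Proof.
apply: transpose_inj; apply: (iso_epi (mf2_iso phi (G A) (G B))).
rewrite !fmap_comp -!compcA -mf2_nat psi2E_pre counit_nat_pre psi2E.
by rewrite -!tensf_comp !eq_counit_nat.
Qed.

(** The associativity of [phi] trades the associator of [C] for that of [D]. When every [psi2] has
    been transposed, what remains is the naturality of the associator of [D] at three counits; the
    unit laws below go the same way. *)
Let psi_assoc (A B X : D) :
  fmap G (tassoc TD A B X) ∘ psi2 (tens TD A B) X ∘ tensf TC (psi2 A B) (idc (G X))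
  = psi2 A (tens TD B X) ∘ tensf TC (idc (G A)) (psi2 B X)
      ∘ tassoc TC (G A) (G B) (G X).
Proof.
apply: transpose_inj; apply: (iso_epi (mf2_iso phi _ _)).
apply: (iso_epi (f := tensf TD (mf2 phi (G A) (G B)) (idc (F (G X))))).
  by apply: is_iso_tensf; [exact: mf2_iso|exact: is_iso_id].
rewrite !fmap_comp -!compcA.
rewrite [fmap F (tassoc _ _ _ _) ∘ _]compcA mf_assoc -!compcA.
rewrite [fmap F (tensf TC _ (psi2 B X)) ∘ _]compcA -mf2_nat -!compcA psi2E_pre.
rewrite [fmap F (tensf TC (psi2 A B) _) ∘ _]compcA -mf2_nat -!compcA.
rewrite counit_nat_pre psi2E_pre !fmap_id [tensf TD (idc _) _ ∘ (_ ∘ _)]compcA.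
rewrite [tensf TD (ε A) _ ∘ (_ ∘ _)]compcA -!tensf_comp !compc1 !psi2E.
by rewrite tassoc_nat.
Qed.

Let psi_lun (A : D) :
  fmap G (tlun TD A) ∘ psi2 (tunit TD) A ∘ tensf TC psi0 (idc (G A)) = tlun TC (G A).
Proof.
apply: transpose_inj; apply: (iso_epi (mf2_iso phi _ _)).
apply: (iso_epi (f := tensf TD (mf0 phi) (idc (F (G A))))).
  by apply: is_iso_tensf; [exact: mf0_iso|exact: is_iso_id].
rewrite !fmap_comp -!compcA.
rewrite [fmap F (tensf TC _ _) ∘ _]compcA -mf2_nat -!compcA.
rewrite counit_nat_pre psi2E_pre !fmap_id -!tensf_comp !compc1 psi0E.
by rewrite tlun_nat -(mf_lun phi) -!compcA.
Qed.

Let psi_run (A : D) :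
  fmap G (trun TD A) ∘ psi2 A (tunit TD) ∘ tensf TC (idc (G A)) psi0 = trun TC (G A).
Proof.
apply: transpose_inj; apply: (iso_epi (mf2_iso phi _ _)).
apply: (iso_epi (f := tensf TD (idc (F (G A))) (mf0 phi))).
  by apply: is_iso_tensf; [exact: is_iso_id|exact: mf0_iso].
rewrite !fmap_comp -!compcA.
rewrite [fmap F (tensf TC _ _) ∘ _]compcA -mf2_nat -!compcA.
rewrite counit_nat_pre psi2E_pre !fmap_id -!tensf_comp !compc1 psi0E.
by rewrite trun_nat -(mf_run phi) -!compcA.
Qed.

(** The conditions on the counit are the hypotheses [psi2E] and [psi0E]. Those on the unit become,
    after transposition, consequences of [zig] in each tensor factor. *)
Lemma tensor_equivalence_mates : tensor_equivalence TC TD E.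
Proof.
exists phi.
exists (StrongMonoidal psi2_nat psi2_iso psi0_iso psi_assoc psi_lun psi_run).
split=> /= [A B||A B|]; [| |exact: psi2E|exact: psi0E].
- apply: transpose_inj; apply: (iso_epi (mf2_iso phi _ _)).
  rewrite zig comp1c !fmap_comp -!compcA -mf2_nat.
  by rewrite counit_nat_pre psi2E_pre -tensf_comp !zig tensf_id compc1.
- apply: transpose_inj; apply: (iso_epi (mf0_iso phi)).
  by rewrite zig comp1c !fmap_comp -!compcA counit_nat_pre psi0E compc1.
Qed.

End DoctrinalAdjunction.

Section TensorEquivalence.
Variables (C D : category) (TC : monoidal C) (TD : monoidal D).
Variables (F : functor C D) (G : functor D C) (E : equivalence F G).
Hypothesis zig : forall A, eq_counit E (F A) ∘ fmap F (eq_unit E A) = idc (F A).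
Hypothesis zag : forall B, fmap G (eq_counit E B) ∘ eq_unit E (G B) = idc (G B).

Local Notation η := (eq_unit E).
Local Notation ε := (eq_counit E).

Let transposeK (A : C) (B : D) (u : homc (F A) B) :
  ε B ∘ fmap F (fmap G u ∘ η A) = u.
Proof. by rewrite fmap_comp compcA eq_counit_nat -compcA zig compc1. Qed.

Lemma tensor_equivalence_of_strong (phi : strong_monoidal TC TD F) :
  tensor_equivalence TC TD E.
Proof.
(* [is_iso] is a mere existence statement, so an inverse of each [mf2 phi A B] has to be chosen. *)
pose v2 A B := sval (cid (mf2_iso phi A B)).
have v2K A B : v2 A B ∘ mf2 phi A B = idc _ /\ mf2 phi A B ∘ v2 A B = idc _.
  exact: svalP (cid (mf2_iso phi A B)).
have [v0 v0K] := mf0_iso phi.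
(* The structure on [G] is the transpose of [ε ⊗ ε] composed with the inverse of [phi], the only
   choice compatible with the counit. It is invertible because [η] and [ε] are. *)
apply: (@tensor_equivalence_mates _ _ TC TD F G E zig zag phi
  (fun A B => fmap G (tensf TD (ε A) (ε B) ∘ v2 (G A) (G B)) ∘ η (tens TC (G A) (G B)))
  (fmap G v0 ∘ η (tunit TC))).
- by move=> A B; rewrite compcA transposeK -compcA (v2K _ _).1 compc1.
- by rewrite compcA transposeK v0K.1.
- move=> A B; apply: is_iso_comp (eq_unit_iso E _); apply: is_iso_fmap.
  apply: is_iso_comp; first by apply: is_iso_tensf; exact: eq_counit_iso.
  by exists (mf2 phi (G A) (G B)); case: (v2K (G A) (G B)).
- apply: is_iso_comp (eq_unit_iso E _); apply: is_iso_fmap.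
  by exists (mf0 phi); case: v0K.
Qed.

End TensorEquivalence.

(** * Linear and balanced maps *)

Section Linearity.
Variable k : comPzRingType.
Implicit Types U V W M N P : lmodType k.

(* [linear] remembers only the semimodules underlying [U] and [V]. *)
Definition klinear U V (f : U -> V) : Prop := linear f.

Lemma lin_id U : klinear (fun x : U => x).
Proof. by []. Qed.

Lemma lin_app U V W (g : V -> W) (f : U -> V) :
  klinear g -> klinear f -> klinear (fun x => g (f x)).
Proof. exact: lin_comp. Qed.

(** The representative of [t] stays fixed while [x] varies, so the sum is linear in [x] term by
    term. *)
Lemma lin_tlift_fun U M N P (F : U -> M -> N -> P) (t : tensor M N) :
  (forall a b, klinear (fun x => F x a b)) -> klinear (fun x => tlift (F x) t).
Proof.
move=> lF a x y; rewrite /tlift scaler_sumr -big_split /=.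
by apply: eq_bigr=> p _; exact: lF.
Qed.

Lemma lin_scaler U V (a : k) (f : U -> V) : klinear f -> klinear (fun x => a *: f x).
Proof.
by move=> lf b x y; rewrite -[f _]/(f (b *: x + y)) lf scalerDr !scalerA mulrC.
Qed.

Lemma lin_scalel U V (f : U -> k) (v : V) :
  klinear (f : U -> k^o) -> klinear (fun x => f x *: v).
Proof.
move=> lf b x y; have -> : f (b *: x + y) = b * f x + f y by exact: lf.
by rewrite scalerDl scalerA.
Qed.

Lemma lin_mulr U (a : k) (f : U -> k^o) : klinear f -> klinear (fun x => a * f x : k^o).
Proof.
move=> lf b x y; have -> : f (b *: x + y) = b * f x + f y by exact: lf.
by rewrite mulrDr mulrCA.
Qed.

Lemma lin_mull U (a : k) (f : U -> k^o) : klinear f -> klinear (fun x => f x * a : k^o).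
Proof.
move=> lf b x y; have -> : f (b *: x + y) = b * f x + f y by exact: lf.
by rewrite mulrDl -mulrA.
Qed.

Lemma bilinP M N P (f : M -> N -> P) :
  (forall m, klinear (f m)) -> (forall n, klinear (fun m => f m n)) -> bilin f.
Proof. by move=> lr ll; split=> x; [exact: lr|exact: ll]. Qed.

Lemma tlift_klin M N P (f : M -> N -> P) : bilin f -> klinear (tlift f).
Proof. exact: tlift_linear. Qed.

(** A linear map is the lift of its restriction to pure tensors. This is the induction principle
    behind the tactic [tind]. *)
Lemma tensor_eq M N P (f g : tensor M N -> P) : klinear f -> klinear g ->
  (forall m n, f (m ⊗ n) = g (m ⊗ n)) -> forall t, f t = g t.
Proof.
move=> lf lg fg t; rewrite (@linear_tlift _ _ _ _ f t lf) (@linear_tlift _ _ _ _ g t lg).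
by congr tlift; apply/funext=> m; apply/funext=> n.
Qed.

Lemma eq_tlift M N P (f g : M -> N -> P) t :
  (forall m n, f m n = g m n) -> tlift f t = tlift g t.
Proof. by move=> fg; congr tlift; apply/funext=> m; apply/funext=> n. Qed.

Lemma lin_autV (M : hmod_data k) : is_hmod M -> klinear (@autV k M).
Proof.
by move=> [lM K VK] a x y; rewrite -{1}(VK x) -{1}(VK y) -lM K.
Qed.

Lemma lin_aut (M : hmod_data k) : is_hmod M -> klinear (@aut k M).
Proof. by case=> + _ _; exact. Qed.

Lemma hmod_autK (M : hmod_data k) : is_hmod M -> cancel (@aut k M) autV.
Proof. by case. Qed.

Lemma hmod_autVK (M : hmod_data k) : is_hmod M -> cancel (@autV k M) aut.
Proof. by case. Qed.

End Linearity.

(** [tlift] is a finite sum, hence commutes with linear maps; this is how Sweedler sums are moved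
    outside. *)
Lemma lin_pull (k : comPzRingType) (M N P Q : lmodType k) (L : P -> Q)
    (G : M -> N -> P) t : klinear L -> L (tlift G t) = tlift (fun a b => L (G a b)) t.
Proof. by move=> lL; rewrite /tlift (big_morph L (linD lL) (lin0 lL)). Qed.

Lemma tlift_mapr (k : comPzRingType) (M N N' P : lmodType k) (v : N -> N')
    (f : M -> N' -> P) x : klinear v -> bilin f ->
  tlift (fun m n => f m (v n)) x = tlift f (tmap id v x).
Proof. by move=> lv bf; rewrite tlift_tmap. Qed.

Lemma tlift_mapl (k : comPzRingType) (M M' N P : lmodType k) (u : M -> M')
    (f : M' -> N -> P) x : klinear u -> bilin f ->
  tlift (fun m n => f (u m) n) x = tlift f (tmap u id x).
Proof. by move=> lu bf; rewrite tlift_tmap. Qed.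

(* The hints of [lin] are tried again in [lin_conv], where they apply up to
   conversion, which is much slower. *)
Create HintDb lin_conv.
Create HintDb lin discriminated.
#[export] Hint Constants Opaque : lin.

Section HopfLinearity.
Variables (k : comPzRingType) (H : monHomHopf k).

Lemma hopf_linr (M : hopf_data H) h : is_hopf M -> klinear (@hp_act k H M h).
Proof. by move=> hM; exact: (lact_bilin (hopf_lmodule hM)).1. Qed.
Lemma hopf_linl (M : hopf_data H) m : is_hopf M -> klinear (fun h => @hp_act k H M h m).
Proof. by move=> hM; exact: (lact_bilin (hopf_lmodule hM)).2. Qed.
Lemma hopf_colin (M : hopf_data H) : is_hopf M -> klinear (@hp_coact k H M).
Proof. by move=> hM; exact: lcoact_linear (hopf_lcomodule hM). Qed.
Lemma rmod_linr (M : rmod_data H) m : is_rmod M -> klinear (@rm_act k H M m).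
Proof. by move=> hM; exact: (ract_bilin (rmod_rmodule hM)).1. Qed.
Lemma rmod_linl (M : rmod_data H) h : is_rmod M -> klinear (fun m => @rm_act k H M m h).
Proof. by move=> hM; exact: (ract_bilin (rmod_rmodule hM)).2. Qed.
Lemma lcov_linr (M : lcov_data H) m : is_lcov M -> klinear (@lc_act k H M m).
Proof. by move=> hM; exact: (ract_bilin (lcov_rmodule hM)).1. Qed.
Lemma lcov_linl (M : lcov_data H) h : is_lcov M -> klinear (fun m => @lc_act k H M m h).
Proof. by move=> hM; exact: (ract_bilin (lcov_rmodule hM)).2. Qed.
Lemma yd_colin (M : yd_data H) : is_yd M -> klinear (@yd_coact k H M).
Proof. by move=> hM; exact: rcoact_linear (yd_rcomodule hM). Qed.
Lemma bicov_colin (M : bicov_data H) : is_bicov M -> klinear (@bc_coact k H M).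
Proof. by move=> hM; exact: rcoact_linear (bicov_rcomodule hM). Qed.

Lemma eps_klin : klinear (@eps k H : H -> k^o).
Proof. exact: eps_linear. Qed.
Lemma hmul_linr (a : H) : klinear (hmul a).
Proof. exact: (hmul_bilin H).1. Qed.
Lemma hmul_linl (b : H) : klinear (fun a : H => a ⋅ b).
Proof. exact: (hmul_bilin H).2. Qed.

Lemma pure_linr (M N : lmodType k) (m : M) : klinear (@pure k M N m).
Proof. exact: (pure_bilin M N).1. Qed.
Lemma pure_linl (M N : lmodType k) (n : N) : klinear (fun m : M => m ⊗ n).
Proof. exact: (pure_bilin M N).2. Qed.

End HopfLinearity.

Section TensorLinearity.
Variables (k : comPzRingType) (H : monHomHopf k) (M M' N N' : lmodType k).

Lemma tmap_klin (f : M -> M') (g : N -> N') :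
  klinear f -> klinear g -> klinear (tmap f g).
Proof. exact: tmap_linear. Qed.

Lemma comp_klin (f : M' -> N) (g : M -> M') :
  klinear f -> klinear g -> klinear (f \o g).
Proof. exact: lin_comp. Qed.

Lemma Delta_klin : klinear (@Delta k H).
Proof. exact: Delta_linear. Qed.

Lemma antip_klin : klinear (@antip k H).
Proof. exact: antip_linear. Qed.

Lemma pureZr (a : k) (m : M) (n : N) : m ⊗ (a *: n) = a *: (m ⊗ n).
Proof. exact: linZ ((pure_bilin M N).1 m) a n. Qed.

Lemma pureZl (a : k) (m : M) (n : N) : (a *: m) ⊗ n = a *: (m ⊗ n).
Proof. exact: linZ ((pure_bilin M N).2 n) a m. Qed.

Lemma val_klin (V : lmodType k) (W : V -> Prop) (hW : is_submod W) :
  klinear (val : submod hW -> V).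
Proof. exact: GRing.linearP. Qed.

Lemma pure_biklin : bilin (@pure k M N).
Proof. exact: pure_bilin. Qed.

End TensorLinearity.

#[export] Hint Resolve hopf_linr hopf_linl hopf_colin rmod_linr rmod_linl lcov_linr
  lcov_linl yd_colin bicov_colin hmul_linr hmul_linl pure_linr pure_linl
  Delta_klin antip_klin eps_klin lin_aut lin_autV hb_hmod
  hopf_hmod rmod_hmod lcov_hmod yd_is_rmod bicov_is_lcov is_lcov_hopf
  pure_biklin tmap_klin comp_klin lin_id : lin lin_conv.

Section BalancedTensor.
Variables (k : comPzRingType) (H : monHomHopf k) (M N : lcov_data H).
Implicit Types P : lmodType k.
Local Notation "m ⊗H n" := (@pureH k H M N m n) (at level 45, no associativity).

Definition balanced P (f : M -> N -> P) : Prop :=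
  bilin f /\ forall m h n, f (lc_act m h) n = f (aut m) (hp_act h (autV n)).

Lemma tliftH_proj P (f : M -> N -> P) s : balanced f ->
  tliftH f (qproj (@tensorH_rel k H M N) s) = tlift f s.
Proof.
move=> [bf ff]; have lf := tlift_linear bf; rewrite /tliftH.
suff h : tlift f (repr (qproj (@tensorH_rel k H M N) s) - s) = 0.
  by rewrite -[repr _](subrK s) (linD lf) h add0r.
(* [span] is the intersection of the submodules containing the relations, so it suffices that the
   kernel of [tlift f] is one of them; it contains the relations because [f] is balanced. *)
apply: (@repr_qproj _ _ (@tensorH_rel k H M N) s (fun v => tlift f v = 0)).
  by split=> [|a u v hu hv]; rewrite ?(lin0 lf) // lf hu hv scaler0 addr0.
move=> _ [m [h [n ->]]].
by rewrite -scaleN1r addrC lf !tlift_pure // ff scaleN1r addNr.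
Qed.

Lemma tliftH_pure P (f : M -> N -> P) m n : balanced f -> tliftH f (m ⊗H n) = f m n.
Proof. by move=> bf; rewrite /pureH tliftH_proj // tlift_pure //; case: bf. Qed.

Lemma tliftH_klin P (f : M -> N -> P) : balanced f -> @klinear k (tensorH M N) P (tliftH f).
Proof.
move=> bf a x y; rewrite -(qreprK x) -(qreprK y) -qproj_linear !tliftH_proj //.
by case: bf => bf _; exact: tlift_linear.
Qed.

Lemma pureH_linr m : @klinear k N (tensorH M N) (@pureH k H M N m).
Proof. by apply: lin_app; [exact: qproj_linear|exact: (pure_bilin M N).1]. Qed.

Lemma pureH_linl n : @klinear k M (tensorH M N) (fun m => m ⊗H n).
Proof. by apply: lin_app; [exact: qproj_linear|exact: (pure_bilin M N).2]. Qed.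

Lemma pureH_bal m h n : lc_act m h ⊗H n = aut m ⊗H hp_act h (autV n).
Proof.
by apply/qprojP => W _; apply; exists m, h, n.
Qed.

Lemma tensorH_eq P (f g : tensorH M N -> P) : klinear f -> klinear g ->
  (forall m n, f (m ⊗H n) = g (m ⊗H n)) -> forall t, f t = g t.
Proof.
move=> lf lg fg t; rewrite -(qreprK t).
pose q := qproj (@tensorH_rel k H M N).
have lq : klinear (q : tensor M N -> tensorH M N) by exact: qproj_linear.
exact: (@tensor_eq _ _ _ _ (f \o q) (g \o q) (lin_comp lf lq) (lin_comp lg lq) fg).
Qed.

Lemma lin_tliftH_fun (U P : lmodType k) (F : U -> M -> N -> P) (t : tensorH M N) :
  (forall a b, klinear (fun x => F x a b)) -> klinear (fun x => tliftH (F x) t).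
Proof. exact: lin_tlift_fun. Qed.

End BalancedTensor.

#[export] Hint Resolve pureH_linr pureH_linl : lin lin_conv.

(* [change] recomputes the two modules from the type of [f]. *)
Ltac lin_head :=
  solve [ lazymatch goal with
          | |- klinear (@pure ?k ?M ?N ?m) => exact (@pure_linr k M N m)
          | |- klinear (fun x => @pure ?k ?M ?N x ?n) => exact (@pure_linl k M N n)
          | |- klinear (@pureH ?k ?H ?M ?N ?m) => exact (@pureH_linr k H M N m)
          | |- klinear (fun x => @pureH ?k ?H ?M ?N x ?n) => exact (@pureH_linl k H M N n)
          end
        | assumption | eauto 8 with lin nocore | eauto 8 with lin_conv nocore
        | exact: val_klin
        | lazymatch goal with
          | |- klinear ?f => change (klinear f); eauto 8 with lin_conv nocore
          end ].

(* Pattern variables under a binder may capture the bound variable; the lemma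
   applications then fail, which selects the branch. *)
Ltac lin :=
  cbv beta;
  lazymatch goal with
  | |- balanced _ => lin_head
  | |- bilin _ => first [ lin_head | apply: bilinP; intros ?; lin ]
  | |- klinear (fun x => x) => exact: lin_id
  | |- klinear (@tlift ?k ?M ?N ?P ?F) => refine (@tlift_klin k M N P F _); lin
  | |- klinear (@tliftH ?k ?H ?M ?N ?P ?F) =>
      refine (@tliftH_klin k H M N P F _); lin_head
  | |- @klinear ?k ?U ?V (fun x => @?a x *: @?f x) =>
      first [ apply: (@lin_scaler k U V (a 0) f)
            | apply: (@lin_scalel k U V a (f 0)) ]; lin
  | |- @klinear ?k ?U _ (fun x => @?f x * @?g x) =>
      first [ apply: (@lin_mulr k U (f 0) g) | apply: (@lin_mull k U (g 0) f) ]; lin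
  | |- @klinear ?k ?U ?V (fun x => ?f (@?g x)) =>
      lazymatch g with
      | (fun x => x) =>
          lazymatch f with
          | @tlift ?k ?M ?N ?P ?F => refine (@tlift_klin k M N P F _); lin
          | @tliftH ?k ?H ?M ?N ?P ?F =>
              refine (@tliftH_klin k H M N P F _); lin_head
          | _ =>
              first [ change (klinear f); lin_head
                    | lazymatch goal with
                      | |- @klinear ?k ?U ?V _ => change (@klinear k U V f)
                      end; lin_head ]
          end
      | _ =>
        first [ apply: (@lin_app k U _ V f g)
              | lazymatch goal with
                | |- klinear (fun x => tlift (@?F x) ?t) =>
                    apply: (@lin_tlift_fun _ _ _ _ _ F t); intros ? ?
                | |- klinear (fun x => tliftH (@?F x) ?t) =>
                    apply: (@lin_tliftH_fun _ _ _ _ _ _ F t); intros ? ?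
                | |- klinear (fun x => ?h (@?g' x) ?b) =>
                    lazymatch g' with
                    | (fun x => x) => idtac
                    | _ => apply: (@lin_app k U _ V (fun y => h y b) g')
                    end
                end ];
        lazymatch goal with
        | |- klinear (fun x => ?h x ?b) => lin_head
        | _ => lin
        end
      end
  | |- klinear _ => lin_head
  | |- @GRing.linear_for _ _ _ _ ?f => change (klinear f); lin
  end.

Ltac tpure :=
  repeat first [ rewrite tlift_pure; [| by lin]; cbv beta
               | rewrite tliftH_pure; [| by lin]; cbv beta
               | rewrite tmap_pure; [| by lin | by lin] ].

(* Replaces the tensor [x] by a pure tensor [a ⊗ b], after checking that both sides of the goal are
   linear in [x]. The variant [tindH] does the same over [H]. *)
Tactic Notation "tind" constr(x) ident(a) ident(b) :=
  cbv beta; generalize x; try clear x;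
  lazymatch goal with
  | |- forall t, @?L t = @?R t =>
      apply: (@tensor_eq _ _ _ _ L R); [by lin | by lin | intros a b; cbv beta]
  end.

Tactic Notation "tindH" constr(x) ident(a) ident(b) :=
  cbv beta; generalize x; try clear x;
  lazymatch goal with
  | |- forall t, @?L t = @?R t =>
      apply: (@tensorH_eq _ _ _ _ _ L R); [by lin | by lin | intros a b; cbv beta]
  end.

(** A tensor in which no sum and no pure tensor is left to expand: a sum over it may become
    outermost. *)
Ltac atomic s :=
  lazymatch s with
  | context [@tlift] => fail
  | context [@pure] => fail
  | context [@tmap] => fail
  | _ => idtac
  end.

(* On a goal [E = ?X]: instantiates [?X] with [E] where all the sums over
   tensors have been moved outside, after simplifying with [tac]. *)
Ltac sweedler tac :=
  cbv beta; tac;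
  lazymatch goal with
  | |- @tlift _ _ _ _ _ (pure _ _) = _ =>
      etransitivity; [ apply: tlift_pure; by lin | sweedler tac ]
  | |- ?E = _ =>
      first
      [ lazymatch E with
        | tlift _ ?s => atomic s
        end;
        apply: eq_tlift; intros ? ?; sweedler tac
      | match E with
        | context [@tlift ?k ?M ?N ?P ?G ?s] =>
            atomic s;
            lazymatch eval pattern (@tlift k M N P G s) in E with
            | ?L _ => etransitivity; [ refine (@lin_pull k M N P _ L G s _); by lin | ]
            end
        end; sweedler tac
      | (etransitivity;
         [ match E with
           | context [@tlift ?k ?M ?N ?P ?G (pure ?m ?n)] =>
               lazymatch eval pattern (@tlift k M N P G (pure m n)) in E with
               | ?L _ => apply: (f_equal L (@tlift_pure k M N P G m n _)); by lin
               end
           | context [tmap ?f ?g (pure ?m ?n)] =>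
               lazymatch eval pattern (tmap f g (pure m n)) in E with
               | ?L _ => apply: (f_equal L (tmap_pure m n _ _)); by lin
               end
           end | ]); sweedler tac
      | lazymatch E with context [@tmap] => idtac end; unfold tmap; sweedler tac
      | reflexivity ]
  end.

Ltac snl tac := etransitivity; [ sweedler tac | ].
Ltac snr tac := symmetry; etransitivity; [ sweedler tac | symmetry ].

(* [foldr v t] turns a sum over [t] whose summand only depends on [b] through
   [v b] into a sum over [tmap id v t], to which coassociativity applies; [foldl]
   is its mirror image. *)
Ltac foldr v t :=
  cbv beta;
  match goal with
  | |- context [@tlift ?k ?M ?N ?P ?E t] =>
      let F := constr:(fun (tl_a : M) (tl_b : N) => ltac:(
        let e := eval cbv beta in (E tl_a tl_b) in
        lazymatch eval pattern (v tl_b) in e with ?f _ => exact f end)) in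
      let F := eval cbv beta in (fun tl_a tl_y => F tl_a 0 tl_y) in
      rewrite [@tlift k M N P E t](@tlift_mapr k M N _ P v F t); [ | by lin | by lin ]
  end.

Ltac foldl u t :=
  cbv beta;
  match goal with
  | |- context [@tlift ?k ?M ?N ?P ?E t] =>
      let F := constr:(fun (tl_a : M) (tl_b : N) => ltac:(
        let e := eval cbv beta in (E tl_a tl_b) in
        lazymatch eval pattern (u tl_a) in e with ?f _ => exact f end)) in
      let F := eval cbv beta in (fun tl_y tl_b => F 0 tl_b tl_y) in
      rewrite [@tlift k M N P E t](@tlift_mapl k M _ N P u F t); [ | by lin | by lin ]
  end.

(** * Twists and iterated coproducts in a monoidal Hom-Hopf algebra *)

Section HopfRules.
Variables (k : comPzRingType) (H : monHomHopf k).
Implicit Types a b c h g : H.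

Let HK := hmod_autK (hb_hmod H).
Let HVK := hmod_autVK (hb_hmod H).

Lemma hautK : cancel (@aut k H) autV. Proof. exact: HK. Qed.
Lemma hautVK : cancel (@autV k H) aut. Proof. exact: HVK. Qed.

Lemma autV_hmul a b : autV (a ⋅ b) = autV a ⋅ autV b.
Proof. by rewrite -[RHS]HK aut_hmul !HVK. Qed.

Lemma autV_hone : autV (hone H) = hone H.
Proof. by rewrite -{1}(aut_hone H) HK. Qed.

Lemma antip_autV h : antip (autV h) = autV (antip h).
Proof. by rewrite -{2}[h]HVK antip_aut HK. Qed.

Lemma eps_autV h : eps (autV h) = eps h.
Proof. by rewrite -[in RHS](HVK h) eps_aut. Qed.

Lemma hmulA' a b c : (a ⋅ b) ⋅ c = aut a ⋅ (b ⋅ autV c).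
Proof. by rewrite hmulA HVK. Qed.

(** As rewrite rules these give a normal form in [H]: [aut] and [autV] are pushed through products,
    and products are nested to the right, the twists of Hom-associativity being absorbed by the
    outer factors. Equalities up to twists then become syntactic. *)
Definition hrules := (hautK, hautVK, @aut_hmul k H, autV_hmul, aut_hone H, autV_hone,
  @antip_aut k H, antip_autV, @eps_aut k H, eps_autV, hmulA', @hmul1 k H, @hmul1l k H).

Lemma Delta_tmap c : Delta (aut c) = tmap aut aut (Delta c).
Proof. exact: Delta_aut. Qed.

Lemma Delta_autV c : Delta (autV c) = tmap autV autV (Delta c).
Proof.
have l := lin_aut (hb_hmod H); have lV := lin_autV (hb_hmod H).
rewrite -{2}[c]HVK Delta_tmap tmap_comp //.
tind (Delta (autV c)) a b.
rewrite tmap_pure /= ?HK //. all: lin.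
Qed.

End HopfRules.

Section Coassociativity.
Variables (k : comPzRingType) (H : monHomHopf k).

(** [DeltaA] solved for the left iterate: c_11 ⊗ c_12 ⊗ c_2 becomes α^{-1}(c_1) ⊗ c_21 ⊗ α(c_22). It
    turns sums over either iterated coproduct into sums over the right one. *)
Lemma Delta_coassoc (c : H) : tmap (@Delta k H) id (Delta c)
  = slet a ⊗ y := tmap id (@Delta k H) (Delta c) in
    slet b ⊗ d := y in (autV a ⊗ b) ⊗ aut d.
Proof.
have e := DeltaA c.
have -> : tmap (@Delta k H) id (Delta c)
  = slet a ⊗ y := (slet c1 ⊗ c2 := Delta c in
        slet c11 ⊗ c12 := Delta c1 in c11 ⊗ (c12 ⊗ autV c2)) in
      slet b ⊗ d := y in (a ⊗ b) ⊗ aut d.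
  foldl (@Delta k H) (Delta c).
  tind (tmap (@Delta k H) id (Delta c)) y d; tind y a b; tpure.
  by rewrite hautVK.
rewrite -e.
foldr (@Delta k H) (Delta c).
by tind (tmap id (@Delta k H) (Delta c)) a y; tind y b d; tpure.
Qed.

(** For right coactions the axiom is solved the other way, so that all sums run over m_[0][0] ⊗
    m_[0][1] ⊗ m_[1]. *)
Lemma rcoact_coassoc (M : hmod_data k) (sigma : M -> tensor M H) m :
  is_hmod M -> is_rcomodule sigma ->
  tmap id (@Delta k H) (sigma m)
  = slet y ⊗ h := tmap sigma id (sigma m) in
    slet p ⊗ g := y in aut p ⊗ (g ⊗ autV h).
Proof.
move=> hM hs; have ls : klinear sigma := rcoact_linear hs.
have e := rcoactA hs m.
have -> : tmap id (@Delta k H) (sigma m)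
  = tmap aut id (slet n ⊗ h := sigma m in autV n ⊗ Delta h).
  foldr (@Delta k H) (sigma m).
  by tind (tmap id (@Delta k H) (sigma m)) p y; tpure; rewrite (hmod_autVK hM).
rewrite e; foldl sigma (sigma m).
by tind (tmap sigma id (sigma m)) y h; tind y p g; tpure.
Qed.

Lemma lcoact_coassoc (M : hmod_data k) (rho : M -> tensor H M) m :
  is_hmod M -> is_lcomodule rho ->
  tmap (@Delta k H) id (rho m)
  = slet a ⊗ y := tmap id rho (rho m) in
    slet b ⊗ n := y in (autV a ⊗ b) ⊗ aut n.
Proof.
move=> hM hs; have ls : klinear rho := lcoact_linear hs.
have e := lcoactA hs m.
have -> : tmap (@Delta k H) id (rho m)
  = tmap id aut (slet n ⊗ h := rho m in Delta n ⊗ autV h).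
  foldl (@Delta k H) (rho m).
  by tind (tmap (@Delta k H) id (rho m)) y p; tpure; rewrite (hmod_autVK hM).
rewrite e; foldr rho (rho m).
by tind (tmap id rho (rho m)) a y; tind y b n; tpure.
Qed.

(** The commutation of the two coactions in solved form: a left coaction taken after the right one
    is traded for a right coaction taken after the left one. *)
Lemma bicoact_coassoc (M : hmod_data k) (rho : M -> tensor H M)
    (sigma : M -> tensor M H) m :
  is_hmod M -> klinear rho -> klinear sigma -> bicomodule_compat rho sigma ->
  tmap rho id (sigma m)
  = slet a ⊗ y := tmap id sigma (rho m) in
    slet n ⊗ h := y in (autV a ⊗ n) ⊗ aut h.
Proof.
move=> hM lr ls /(_ m) e.
transitivity (slet a ⊗ y := (slet n ⊗ h := sigma m in
    slet a ⊗ p := rho n in aut a ⊗ (p ⊗ autV h)) in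
  slet n ⊗ h := y in (autV a ⊗ n) ⊗ aut h).
  foldl rho (sigma m); tind (tmap rho id (sigma m)) y h; tind y a n; tpure.
  by rewrite hautVK hautK.
by rewrite -e.
Qed.

End Coassociativity.

(** * Monoidal categories of structured modules *)

Section ConcreteMonoidal.
Variables (k : comPzRingType) (C : ccat k) (t : tensor_formulas C).
Local Notation valid := (@cvalid k C).
Local Notation mor := (@cmor k C).
Local Notation "A ⊠ B" := (tf_tens t A B) (at level 40).
Local Notation tf := (tf_tensf (t := t)).
Local Notation asc A B E := (@tf_assoc k C t A B E).
Local Notation lun A := (@tf_lun k C t A).
Local Notation run A := (@tf_run k C t A).

(** Holds in all the categories at hand, and allows invertibility of a morphism to be tested on its
    underlying function. *)
Definition reflects_iso : Prop := forall A B (f : ccar A -> ccar B) g,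
  valid A -> valid B -> mor f -> cancel f g -> cancel g f -> mor g.

(** The axioms of a monoidal category read on functions between valid structures, with bijectivity
    in place of invertibility. In this form the equations proved for modules can be reused once a
    coaction is added. *)
Record tensor_laws : Prop := TensorLaws {
  tl_tens : forall A B, valid A -> valid B -> valid (A ⊠ B);
  tl_tensf : forall A A' B B' (f : ccar A -> ccar A') (g : ccar B -> ccar B'),
    valid A -> valid A' -> valid B -> valid B' -> mor f -> mor g -> mor (tf f g);
  tl_unit : valid (tf_unit t);
  tl_assoc : forall A B E, valid A -> valid B -> valid E ->
    mor (asc A B E);
  tl_lun : forall A, valid A -> mor (lun A);
  tl_run : forall A, valid A -> mor (run A);
  tl_id : forall A B, valid A -> valid B ->
    tf (fun x : ccar A => x) (fun x : ccar B => x) =1 id;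
  tl_comp : forall A A' A'' B B' B'' (f' : ccar A' -> ccar A'') (f : ccar A -> ccar A')
      (g' : ccar B' -> ccar B'') (g : ccar B -> ccar B'),
    valid A -> valid A' -> valid A'' -> valid B -> valid B' -> valid B'' ->
    mor f' -> mor f -> mor g' -> mor g -> tf (f' \o f) (g' \o g) =1 tf f' g' \o tf f g;
  tl_assoc_nat : forall A A' B B' E E' (f : ccar A -> ccar A') (g : ccar B -> ccar B')
      (h : ccar E -> ccar E'),
    valid A -> valid A' -> valid B -> valid B' -> valid E -> valid E' ->
    mor f -> mor g -> mor h ->
    asc A' B' E' \o tf (tf f g) h =1 tf f (tf g h) \o asc A B E;
  tl_lun_nat : forall A A' (f : ccar A -> ccar A'), valid A -> valid A' -> mor f ->
    lun A' \o tf (fun x => x) f =1 f \o lun A;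
  tl_run_nat : forall A A' (f : ccar A -> ccar A'), valid A -> valid A' -> mor f ->
    run A' \o tf f (fun x => x) =1 f \o run A;
  tl_assoc_bij : forall A B E, valid A -> valid B -> valid E ->
    bijective (asc A B E);
  tl_lun_bij : forall A, valid A -> bijective (lun A);
  tl_run_bij : forall A, valid A -> bijective (run A);
  tl_pentagon : forall A B E D, valid A -> valid B -> valid E -> valid D ->
    tf (fun x : ccar A => x) (asc B E D)
      \o asc A (B ⊠ E) D
      \o tf (asc A B E) (fun x : ccar D => x)
    =1 asc A B (E ⊠ D)
      \o asc (A ⊠ B) E D;
  tl_triangle : forall A B, valid A -> valid B ->
    tf (fun x : ccar A => x) (lun B) \o asc A (tf_unit t) B
    =1 tf (run A) (fun x : ccar B => x)
}.

Lemma bij_iso (A B : C) (f : homc A B) :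
  reflects_iso -> bijective (fn f) -> is_iso f.
Proof.
move=> ri [g fg gf].
exists (@CHom k C B A g (ri _ _ _ _ (cobP A) (cobP B) (chomP f) fg gf)).
by split; exact: chom_eq.
Qed.

Hypotheses (ri : reflects_iso) (tl : tensor_laws).

(** Transparent, so that [is_given_by] holds by conversion for the resulting monoidal category. *)
Definition concrete_monoidal : monoidal C.
Proof.
refine (@Monoidal C
  (fun A B => @Cob k C (dat A ⊠ dat B) (tl_tens tl (cobP A) (cobP B)))
  (fun A A' B B' f g => @CHom k C
    (Cob (tl_tens tl (cobP A) (cobP B))) (Cob (tl_tens tl (cobP A') (cobP B')))
    (tf (fn f) (fn g))
    (tl_tensf tl (cobP A) (cobP A') (cobP B) (cobP B') (chomP f) (chomP g)))
  (@Cob k C (tf_unit t) (tl_unit tl))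
  (fun A B E => @CHom k C
    (Cob (tl_tens tl (tl_tens tl (cobP A) (cobP B)) (cobP E)))
    (Cob (tl_tens tl (cobP A) (tl_tens tl (cobP B) (cobP E))))
    (asc _ _ _) (tl_assoc tl (cobP A) (cobP B) (cobP E)))
  (fun A => @CHom k C (Cob (tl_tens tl (tl_unit tl) (cobP A))) A
    (lun _) (tl_lun tl (cobP A)))
  (fun A => @CHom k C (Cob (tl_tens tl (cobP A) (tl_unit tl))) A
    (run _) (tl_run tl (cobP A)))
  _ _ _ _ _ _ _ _ _ _).
- by move=> [A hA] [B hB]; apply: chom_eq; exact: tl_id.
- move=> [A hA] [A' hA'] [A'' hA''] [B hB] [B' hB'] [B'' hB''] [f' hf'] [f hf].
  by move=> [g' hg'] [g hg]; apply: chom_eq; exact: tl_comp.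
- move=> [A hA] [A' hA'] [B hB] [B' hB'] [E hE] [E' hE'] [f hf] [g hg] [h hh].
  by apply: chom_eq; exact: tl_assoc_nat.
- by move=> [A hA] [A' hA'] [f hf]; apply: chom_eq; exact: tl_lun_nat.
- by move=> [A hA] [A' hA'] [f hf]; apply: chom_eq; exact: tl_run_nat.
- by move=> [A hA] [B hB] [E hE]; apply: (bij_iso ri); exact: tl_assoc_bij.
- by move=> [A hA]; apply: (bij_iso ri); exact: tl_lun_bij.
- by move=> [A hA]; apply: (bij_iso ri); exact: tl_run_bij.
- by move=> [A hA] [B hB] [E hE] [D hD]; apply: chom_eq; exact: tl_pentagon.
- by move=> [A hA] [B hB]; apply: chom_eq; exact: tl_triangle.
Defined.

End ConcreteMonoidal.

(** * Tensor products of modules with an automorphism *)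

Section HMTensor.
Variable k : comPzRingType.
Implicit Types M N P : hmod_data k.

Lemma hm_tens_valid M N : is_hmod M -> is_hmod N -> is_hmod (hm_tens M N).
Proof.
move=> hM hN; split=> [|x|x].
- by apply: tmap_klin; lin.
- rewrite /=; tind x m n; tpure.
  by rewrite (hmod_autK hM) (hmod_autK hN).
- rewrite /=; tind x m n; tpure.
  by rewrite (hmod_autVK hM) (hmod_autVK hN).
Qed.

Lemma hm_unit_valid : is_hmod (hm_unit k).
Proof. by split. Qed.

Lemma hmor_autV M N (f : M -> N) m : is_hmod M -> is_hmod N -> is_hmor f ->
  f (autV m) = autV (f m).
Proof.
move=> hM hN [_ fa]; apply: (can_inj (hmod_autK hN)).
by rewrite -fa !(hmod_autVK hM, hmod_autVK hN).
Qed.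

Lemma hm_tensf_id M N (x : tensor M N) : tmap (fun m : M => m) (fun n : N => n) x = x.
Proof. exact: tmap_id. Qed.

Lemma hm_tensf_mor M M' N N' (f : M -> M') (g : N -> N') :
  is_hmod M -> is_hmod M' -> is_hmod N -> is_hmod N' -> is_hmor f -> is_hmor g ->
  @is_hmor k (hm_tens M N) (hm_tens M' N') (tmap f g).
Proof.
move=> hM hM' hN hN' [lf fa] [lg ga].
have lf' : klinear f := lf; have lg' : klinear g := lg.
split=> [|x] /=; first by apply: tmap_klin.
by tind x m n; tpure; rewrite fa ga.
Qed.

Lemma hm_assoc_mor M N P : is_hmod M -> is_hmod N -> is_hmod P ->
  @is_hmor k (hm_tens (hm_tens M N) P) (hm_tens M (hm_tens N P)) (@hm_assoc k M N P).
Proof.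
move=> hM hN hP; split=> [|x] /=; first by apply: tlift_klin; lin.
rewrite /hm_assoc; tind x y p; tind y m n; tpure.
by rewrite (hmod_autK hP) (hmod_autVK hP).
Qed.

Lemma hm_lun_mor M : is_hmod M -> @is_hmor k (hm_tens (hm_unit k) M) M (@hm_lun k M).
Proof.
move=> hM; split=> [|x] /=; first by apply: tlift_klin; lin.
by rewrite /hm_lun; tind x a m; tpure; rewrite (linZ (lin_aut hM)).
Qed.

Lemma hm_run_mor M : is_hmod M -> @is_hmor k (hm_tens M (hm_unit k)) M (@hm_run k M).
Proof.
move=> hM; split=> [|x] /=; first by apply: tlift_klin; lin.
by rewrite /hm_run; tind x a m; tpure; rewrite (linZ (lin_aut hM)).
Qed.

Lemma hm_assoc_nat M M' N N' P P' (f : M -> M') (g : N -> N') (h : P -> P') :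
  is_hmod M -> is_hmod M' -> is_hmod N -> is_hmod N' -> is_hmod P -> is_hmod P' ->
  is_hmor f -> is_hmor g -> is_hmor h ->
  @hm_assoc k M' N' P' \o tmap (tmap f g) h =1 tmap f (tmap g h) \o @hm_assoc k M N P.
Proof.
move=> hM hM' hN hN' hP hP' [lf fa] [lg ga] [lh ha] x /=; rewrite /hm_assoc.
have lf' : klinear f := lf; have lg' : klinear g := lg; have lh' : klinear h := lh.
tind x y p; tind y m n; tpure; rewrite fa; congr (_ ⊗ (_ ⊗ _)).
by rewrite (hmor_autV _ hP hP' (conj lh ha)).
Qed.

Lemma hm_lun_nat M M' (f : M -> M') : is_hmod M -> is_hmod M' -> is_hmor f ->
  @hm_lun k M' \o tmap (fun x => x) f =1 f \o @hm_lun k M.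
Proof.
move=> hM hM' [lf fa] x /=; have lf' : klinear f := lf; rewrite /hm_lun.
by tind x a m; tpure; rewrite (linZ lf) fa.
Qed.

Lemma hm_run_nat M M' (f : M -> M') : is_hmod M -> is_hmod M' -> is_hmor f ->
  @hm_run k M' \o tmap f (fun x => x) =1 f \o @hm_run k M.
Proof.
move=> hM hM' [lf fa] x /=; have lf' : klinear f := lf; rewrite /hm_run.
by tind x m a; tpure; rewrite (linZ lf) fa.
Qed.

Lemma hm_assoc_bij M N P : is_hmod M -> is_hmod N -> is_hmod P ->
  bijective (@hm_assoc k M N P).
Proof.
move=> hM hN hP; exists (fun x : tensor M (tensor N P) =>
  slet m ⊗ y := x in slet n ⊗ p := y in (autV m ⊗ n) ⊗ aut p) => x; rewrite /hm_assoc.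
  tind x y p; tind y m n; tpure.
  by rewrite (hmod_autK hM) (hmod_autVK hP).
tind x m y; tind y n p; tpure.
by rewrite (hmod_autVK hM) (hmod_autK hP).
Qed.

Lemma hm_lun_bij M : is_hmod M -> bijective (@hm_lun k M).
Proof.
move=> hM; exists (fun m => (1 : k^o) ⊗ autV m) => x; rewrite /hm_lun.
  tind x a m; tpure; rewrite (linZ (lin_autV hM)) (hmod_autK hM).
  rewrite pureZr -pureZl.
  by congr (_ ⊗ _); exact: mulr1.
by tpure; rewrite (hmod_autVK hM) scale1r.
Qed.

Lemma hm_run_bij M : is_hmod M -> bijective (@hm_run k M).
Proof.
move=> hM; exists (fun m => autV m ⊗ (1 : k^o)) => x; rewrite /hm_run.
  tind x m a; tpure; rewrite (linZ (lin_autV hM)) (hmod_autK hM).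
  rewrite pureZl -pureZr.
  by congr (_ ⊗ _); exact: mulr1.
by tpure; rewrite (hmod_autVK hM) scale1r.
Qed.

Lemma hm_pentagon M N P Q : is_hmod M -> is_hmod N -> is_hmod P -> is_hmod Q ->
  tmap (fun x : M => x) (@hm_assoc k N P Q) \o @hm_assoc k M (hm_tens N P) Q
    \o tmap (@hm_assoc k M N P) (fun x : Q => x)
  =1 @hm_assoc k M N (hm_tens P Q) \o @hm_assoc k (hm_tens M N) P Q.
Proof.
move=> hM hN hP hQ x /=.
have l1 := (hm_assoc_mor hM hN hP).1; have l2 := (hm_assoc_mor hN hP hQ).1.
have l1' : klinear (@hm_assoc k M N P) := l1.
have l2' : klinear (@hm_assoc k N P Q) := l2.
have l3 : klinear (@hm_assoc k M (hm_tens N P) Q).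
  exact: (hm_assoc_mor hM (hm_tens_valid hN hP) hQ).1.
have l4 : klinear (@hm_assoc k M N (hm_tens P Q)).
  exact: (hm_assoc_mor hM hN (hm_tens_valid hP hQ)).1.
have l5 : klinear (@hm_assoc k (hm_tens M N) P Q).
  exact: (hm_assoc_mor (hm_tens_valid hM hN) hP hQ).1.
tind x y q; tind y z p; tind z m n; tpure.
by rewrite /hm_assoc /=; tpure.
Qed.

Lemma hm_triangle M N : is_hmod M -> is_hmod N ->
  tmap (fun x : M => x) (@hm_lun k N) \o @hm_assoc k M (hm_unit k) N
  =1 tmap (@hm_run k M) (fun x : N => x).
Proof.
move=> hM hN x /=.
have l1 : klinear (@hm_lun k N) := (hm_lun_mor hN).1.
have l2 : klinear (@hm_run k M) := (hm_run_mor hM).1.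
have l3 : klinear (@hm_assoc k M (hm_unit k) N).
  exact: (hm_assoc_mor hM hm_unit_valid hN).1.
tind x y n; tind y m a; tpure.
rewrite /hm_assoc /hm_lun /hm_run /=; tpure; rewrite (hmod_autVK hN).
by rewrite pureZr pureZl.
Qed.

Lemma hm_mor_inv M N (f : M -> N) g : is_hmor f -> cancel f g -> cancel g f -> is_hmor g.
Proof.
move=> [lf fa] K VK; split=> [a x y|x]; apply: (can_inj K); rewrite VK.
  by rewrite lf !VK.
by rewrite fa VK.
Qed.

End HMTensor.
#[export] Hint Resolve hm_tens_valid hm_unit_valid : lin lin_conv.

(** * Tensor products of right Hom-modules *)

Section RModTensor.
Variables (k : comPzRingType) (H : monHomHopf k).
Implicit Types M N : rmod_data H.

Lemma autV_ract M m h : is_rmod M ->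
  autV (@rm_act k H M m h) = rm_act (autV m) (autV h).
Proof.
move=> [hM rM]; rewrite -[RHS](hmod_autK hM) (aut_ract rM).
by rewrite (hmod_autVK hM) hautVK.
Qed.

Lemma ractA' M m g h : is_rmod M ->
  rm_act (@rm_act k H M m g) h = rm_act (aut m) (g ⋅ autV h).
Proof. by move=> [hM rM]; rewrite -(ractA rM) hautVK. Qed.

Definition rmod_rules M (hM : is_rmod M) :=
  (aut_ract (rmod_rmodule hM), (fun m h => autV_ract m h hM),
   (fun m g h => ractA' m g h hM), ract1 (rmod_rmodule hM),
   hmod_autK (rmod_hmod hM), hmod_autVK (rmod_hmod hM)).

Lemma rmod_tens_valid M N : is_rmod M -> is_rmod N -> is_rmod (rmod_tens M N).
Proof.
move=> hM hN; split; first by apply: hm_tens_valid; exact: rmod_hmod.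
split.
- rewrite /=; lin.
- move=> x h /=; tind x m n; tpure; rewrite Delta_tmap; tind (Delta h) h1 h2; tpure.
  by rewrite (rmod_rules hM) (rmod_rules hN).
- move=> x g h /=; tind x m n; tpure.
  rewrite Delta_tmap Delta_hmul. tind (Delta h) h1 h2; tind (Delta g) g1 g2; tpure.
  by rewrite !(rmod_rules hM) !(rmod_rules hN) !hrules.
- move=> x /=; tind x m n; rewrite Delta_hone; tpure.
  by rewrite !(rmod_rules hM) !(rmod_rules hN).
Qed.

Lemma rmod_unit_valid : is_rmod (rmod_unit H).
Proof.
split; first exact: hm_unit_valid; split=> /=.
- apply: bilinP=> [x|h] a u v /=; last by rewrite mulrDr [eps h * _]mulrCA.
  have -> : eps (a *: u + v) = a * eps u + eps v by exact: eps_linear.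
  by rewrite mulrDl -mulrA.
- by move=> x h; rewrite eps_aut.
- by move=> x g h; rewrite eps_hmul eps_aut; exact: etrans (mulrCA _ _ _) (mulrA _ _ _).
- by move=> x; rewrite eps_hone mul1r.
Qed.

Lemma rmod_reflects_iso : reflects_iso (RMod H).
Proof.
move=> A B f g hA hB [hf lf] K VK; split; first exact: hm_mor_inv hf K VK.
by move=> m h; apply: (can_inj K); rewrite VK lf VK.
Qed.

Lemma rmod_tensf_mor M M' N N' (f : M -> M') (g : N -> N') :
  is_rmod M -> is_rmod M' -> is_rmod N -> is_rmod N' ->
  is_rmod_mor f -> is_rmod_mor g ->
  @is_rmod_mor k H (rmod_tens M N) (rmod_tens M' N') (tmap f g).
Proof.
move=> hM hM' hN hN' [hf rf] [hg rg].
have lf : klinear f := hf.1; have lg : klinear g := hg.1.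
split=> [|x h] /=; first by apply: hm_tensf_mor; do 1? exact: rmod_hmod.
by tind x m n; tpure; tind (Delta h) h1 h2; tpure; rewrite rf rg.
Qed.

(** The two diagonal actions differ by the bracketing of the iterated coproduct of [h]; the twists
    in [hm_assoc] are exactly those of Hom-coassociativity. *)
Lemma rmod_assoc_mor M N P : is_rmod M -> is_rmod N -> is_rmod P ->
  @is_rmod_mor k H (rmod_tens (rmod_tens M N) P) (rmod_tens M (rmod_tens N P))
    (@hm_assoc k M N P).
Proof.
move=> hM hN hP; split; first by apply: hm_assoc_mor; exact: rmod_hmod.
move=> x h /=; rewrite /hm_assoc; tind x y p; tind y m n; tpure.
foldl (@Delta k H) (Delta h); foldr (@Delta k H) (Delta h).
rewrite Delta_coassoc; tind (tmap id (@Delta k H) (Delta h)) a y; tind y b c; tpure.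
by rewrite !(rmod_rules hM, rmod_rules hP) !hrules.
Qed.

Lemma rmod_lun_mor M : is_rmod M ->
  @is_rmod_mor k H (rmod_tens (rmod_unit H) M) M (@hm_lun k M).
Proof.
move=> hM; split; first by apply: hm_lun_mor; exact: rmod_hmod.
move=> x h /=; rewrite /hm_lun; tind x a m; tpure.
(* [h] is written as [aut (autV h)] and [autV h] is expanded by the counit, to match the action of
   [h_1] on the unit object through [eps]. *)
rewrite (linZ (rmod_linl _ hM)) -{2}(hautVK h) -(aut_ract (rmod_rmodule hM)) -eps_counitl.
tind (Delta h) h1 h2; tpure.
by rewrite !(linZ (rmod_linr _ hM), linZ (lin_aut (rmod_hmod hM))) scalerA mulrC.
Qed.

Lemma rmod_run_mor M : is_rmod M ->
  @is_rmod_mor k H (rmod_tens M (rmod_unit H)) M (@hm_run k M).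
Proof.
move=> hM; split; first by apply: hm_run_mor; exact: rmod_hmod.
move=> x h /=; rewrite /hm_run; tind x m a; tpure.
rewrite (linZ (rmod_linl _ hM)) -{2}(hautVK h) -(aut_ract (rmod_rmodule hM)) -eps_counitr.
tind (Delta h) h1 h2; tpure.
by rewrite !(linZ (rmod_linr _ hM), linZ (lin_aut (rmod_hmod hM))) scalerA mulrC.
Qed.

Lemma rmod_tensor_laws : tensor_laws (RMod_tensor H).
Proof.
have hm : forall M, is_rmod M -> is_hmod M by move=> M; exact: rmod_hmod.
split=> /=.
- exact: rmod_tens_valid.
- by move=> A A' B B' f g *; exact: rmod_tensf_mor.
- exact: rmod_unit_valid.
- by move=> A B E *; exact: rmod_assoc_mor.
- exact: rmod_lun_mor.
- exact: rmod_run_mor.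
- by move=> A B _ _ x; exact: hm_tensf_id.
- move=> A A' A'' B B' B'' f' f g' g _ _ _ _ _ _ [[lf' _] _] [[lf _] _] [[lg' _] _].
  by move=> [[lg _] _] x; rewrite /= tmap_comp.
- move=> A A' B B' E E' f g h hA hA' hB hB' hE hE' [hf _] [hg _] [hh _].
  by apply: hm_assoc_nat => //; exact: hm.
- by move=> A A' f hA hA' [hf _]; apply: hm_lun_nat => //; exact: hm.
- by move=> A A' f hA hA' [hf _]; apply: hm_run_nat => //; exact: hm.
- by move=> A B E hA hB hE; apply: hm_assoc_bij; exact: hm.
- by move=> A hA; apply: hm_lun_bij; exact: hm.
- by move=> A hA; apply: hm_run_bij; exact: hm.
- by move=> A B E D hA hB hE hD; apply: hm_pentagon; exact: hm.
- by move=> A B hA hB; apply: hm_triangle; exact: hm.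
Qed.

End RModTensor.
#[export] Hint Resolve rmod_tens_valid rmod_unit_valid : lin lin_conv.

(** * Tensor products of Yetter-Drinfeld modules *)

Section YDTensor.
Variables (k : comPzRingType) (H : monHomHopf k).
Implicit Types M N : yd_data H.

Lemma yd_coact_aut M m : is_yd M ->
  @yd_coact k H M (aut m) = tmap aut aut (yd_coact m).
Proof. by move=> hM; exact: rcoact_aut (yd_rcomodule hM) m. Qed.

Lemma yd_coassoc M m : is_yd M ->
  tmap id (@Delta k H) (@yd_coact k H M m)
  = slet y ⊗ h := tmap (@yd_coact k H M) id (yd_coact m) in
    slet p ⊗ g := y in aut p ⊗ (g ⊗ autV h).
Proof.
by move=> hM; apply: rcoact_coassoc (yd_rcomodule hM); case: (yd_is_rmod hM).
Qed.

Lemma yd_tens_rcomodule M N : is_yd M -> is_yd N ->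
  is_rcomodule (@yd_coact k H (yd_tens M N)).
Proof.
move=> hM hN; have hM' := yd_is_rmod hM; have hN' := yd_is_rmod hN; split=> /=.
- by apply: tlift_klin; lin.
- move=> x; tind x m n; tpure; rewrite !yd_coact_aut //.
  by tind (yd_coact m) m0 m1; tind (yd_coact n) n0 n1; tpure; rewrite !hrules.
- move=> x; tind x m n; tpure.
  snl ltac:(rewrite ?Delta_hmul); snr ltac:(idtac).
  foldr (@Delta k H) (yd_coact m); foldl (@yd_coact k H M) (yd_coact m).
  rewrite yd_coassoc //; tind (tmap (@yd_coact k H M) id (yd_coact m)) y m2.
  tind y m0 m1; tpure.
  foldr (@Delta k H) (yd_coact n); foldl (@yd_coact k H N) (yd_coact n).
  rewrite yd_coassoc //; tind (tmap (@yd_coact k H N) id (yd_coact n)) y n2.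
  tind y n0 n1; tpure.
  by rewrite !(rmod_rules hM') !(rmod_rules hN') ?hrules.
- move=> x; tind x m n; tpure.
  rewrite -(rcoact_eps (yd_rcomodule hM)) -(rcoact_eps (yd_rcomodule hN)).
  tind (yd_coact m) m0 m1; tind (yd_coact n) n0 n1; tpure.
  by rewrite eps_hmul pureZl pureZr scalerA.
Qed.

(** The condition is applied to one factor at a time. Coassociativity regroups the three legs of [h]
    so that the condition of [N] applies on the last two, then so that the condition of [M] applies
    on the first two. *)
Lemma yd_tens_compat M N : is_yd M -> is_yd N ->
  yd_compat (@rm_act k H (yd_tens M N)) (@yd_coact k H (yd_tens M N)).
Proof.
move=> hM hN; have hM' := yd_is_rmod hM; have hN' := yd_is_rmod hN.
move=> x h /=; tind x m n; tpure.
transitivity (slet a ⊗ b := Delta h in slet m0 ⊗ m1 := yd_coact m in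
  slet r ⊗ s := (slet n0 ⊗ n1 := yd_coact n in slet h1 ⊗ h2 := Delta b in
    rm_act n0 (autV h1) ⊗ (n1 ⋅ autV h2)) in
  (rm_act m0 (autV (autV a)) ⊗ r) ⊗ (aut m1 ⋅ s)).
  tind (yd_coact m) m0 m1; tind (yd_coact n) n0 n1.
  snl ltac:(rewrite ?Delta_autV); snr ltac:(idtac).
  foldl (@Delta k H) (Delta h); foldr (@Delta k H) (Delta h).
  rewrite Delta_coassoc; tind (tmap id (@Delta k H) (Delta h)) a y; tind y b c; tpure.
  by rewrite !hrules.
transitivity (slet h1 ⊗ h2 := Delta h in
  slet r ⊗ s := (slet m0 ⊗ m1 := yd_coact m in slet a1 ⊗ a2 := Delta h1 in
    rm_act m0 (autV a1) ⊗ (m1 ⋅ autV a2)) in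
  slet q0 ⊗ q1 := yd_coact (rm_act n (autV h2)) in (r ⊗ q0) ⊗ (s ⋅ q1)).
  transitivity (slet a ⊗ b := Delta h in slet m0 ⊗ m1 := yd_coact m in
    slet r ⊗ s := (slet b1 ⊗ b2 := Delta b in
      slet q0 ⊗ q1 := yd_coact (rm_act n b2) in q0 ⊗ autV (b1 ⋅ q1)) in
    (rm_act m0 (autV (autV a)) ⊗ r) ⊗ (aut m1 ⋅ s)).
    apply: eq_tlift => a b; apply: eq_tlift => m0 m1; congr tlift.
    exact: yd_compatible hN n b.
  tind (yd_coact m) m0 m1; snl ltac:(idtac); snr ltac:(idtac).
  foldl (@Delta k H) (Delta h); foldr (@Delta k H) (Delta h).
  rewrite Delta_coassoc; tind (tmap id (@Delta k H) (Delta h)) a y; tind y b c; tpure.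
  rewrite !hrules. tind (yd_coact (rm_act n c)) q0 q1; tpure.
  by rewrite ?(rmod_rules hM') ?hrules.
transitivity (slet h1 ⊗ h2 := Delta h in
  slet r ⊗ s := (slet a1 ⊗ a2 := Delta h1 in
      slet q0 ⊗ q1 := yd_coact (rm_act m a2) in q0 ⊗ autV (a1 ⋅ q1)) in
  slet q0 ⊗ q1 := yd_coact (rm_act n (autV h2)) in (r ⊗ q0) ⊗ (s ⋅ q1)).
  apply: eq_tlift => a b; congr tlift; exact: yd_compatible hM m a.
snl ltac:(idtac); snr ltac:(idtac).
foldl (@Delta k H) (Delta h); foldr (@Delta k H) (Delta h).
rewrite Delta_coassoc; tind (tmap id (@Delta k H) (Delta h)) a y; tind y b c; tpure.
rewrite !hrules; tind (yd_coact (rm_act n c)) q0 q1; tpure.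
tind (yd_coact (rm_act m b)) p0 p1; tpure.
by rewrite !hrules.
Qed.

Lemma yd_tens_valid M N : is_yd M -> is_yd N -> is_yd (yd_tens M N).
Proof.
move=> hM hN; split; first by apply: rmod_tens_valid; exact: yd_is_rmod.
  exact: yd_tens_rcomodule.
exact: yd_tens_compat.
Qed.

Lemma yd_unit_valid : is_yd (yd_unit H).
Proof.
split; first exact: rmod_unit_valid.
  split=> /=.
  - exact: pure_linl.
  - by move=> m; tpure; rewrite aut_hone.
  - by move=> m; tpure; rewrite Delta_hone autV_hone.
  - by move=> m; tpure; rewrite eps_hone scale1r.
move=> n h /=; tpure.
transitivity (n ⊗ autV h).
  rewrite -eps_counitl; tind (Delta h) h1 h2; tpure.
  by rewrite !hrules pureZr -pureZl.
rewrite -eps_counitr; tind (Delta h) h1 h2; tpure.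
by rewrite !hrules pureZr -pureZl.
Qed.

Lemma yd_reflects_iso : reflects_iso (YD H).
Proof.
move=> A B f g hA hB [hf cf] K VK.
have hg : is_rmod_mor g := rmod_reflects_iso (yd_is_rmod hA) (yd_is_rmod hB) hf K VK.
have lf : klinear f := (rmod_hmor hf).1; have lg : klinear g := (rmod_hmor hg).1.
split=> // m; rewrite -{2}(VK m) cf -/(tmap f id _) -/(tmap g id _) tmap_comp //.
by rewrite (_ : g \o f = id) ?tmap_id //; apply/funext.
Qed.

Lemma yd_tensf_mor M M' N N' (f : M -> M') (g : N -> N') :
  is_yd M -> is_yd M' -> is_yd N -> is_yd N' -> is_yd_mor f -> is_yd_mor g ->
  @is_yd_mor k H (yd_tens M N) (yd_tens M' N') (tmap f g).
Proof.
move=> hM hM' hN hN' [hf cf] [hg cg].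
have lf : klinear f := (rmod_hmor hf).1; have lg : klinear g := (rmod_hmor hg).1.
split=> [|x]; first by apply: rmod_tensf_mor; do 1?exact: yd_is_rmod.
rewrite /=; tind x m n; tpure; rewrite cf cg.
by tind (yd_coact m) m0 m1; tind (yd_coact n) n0 n1; tpure.
Qed.

Lemma yd_assoc_mor M N P : is_yd M -> is_yd N -> is_yd P ->
  @is_yd_mor k H (yd_tens (yd_tens M N) P) (yd_tens M (yd_tens N P))
    (@hm_assoc k M N P).
Proof.
move=> hM hN hP; split; first by apply: rmod_assoc_mor; exact: yd_is_rmod.
have hP' := yd_is_rmod hP.
move=> x /=; rewrite /hm_assoc; tind x y p; tind y m n; tpure.
rewrite yd_coact_aut // -{2}[p](hmod_autVK (rmod_hmod hP')) yd_coact_aut //.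

tind (yd_coact m) m0 m1; tind (yd_coact n) n0 n1; tind (yd_coact (autV p)) p0 p1; tpure.
by rewrite !(rmod_rules hP') !hrules.
Qed.

Lemma yd_lun_mor M : is_yd M -> @is_yd_mor k H (yd_tens (yd_unit H) M) M (@hm_lun k M).
Proof.
move=> hM; split; first by apply: rmod_lun_mor; exact: yd_is_rmod.
move=> x /=; rewrite /hm_lun; tind x a m; tpure.
rewrite (linZ (yd_colin hM)) yd_coact_aut //.
by tind (yd_coact m) m0 m1; tpure; rewrite hmul1l pureZl.
Qed.

Lemma yd_run_mor M : is_yd M -> @is_yd_mor k H (yd_tens M (yd_unit H)) M (@hm_run k M).
Proof.
move=> hM; split; first by apply: rmod_run_mor; exact: yd_is_rmod.
move=> x /=; rewrite /hm_run; tind x m a; tpure.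
rewrite (linZ (yd_colin hM)) yd_coact_aut //.
by tind (yd_coact m) m0 m1; tpure; rewrite hmul1 pureZl.
Qed.

(** The functions are those of right Hom-modules, so the equations and bijections come from
    [rmod_tensor_laws]; only validity and colinearity of the maps are specific to coactions. *)
Lemma yd_tensor_laws : tensor_laws (YD_tensor H).
Proof.
have T := rmod_tensor_laws H.
have rm : forall M, is_yd M -> is_rmod M by move=> M; exact: yd_is_rmod.
split=> /=.
- exact: yd_tens_valid.
- by move=> A A' B B' f g *; exact: yd_tensf_mor.
- exact: yd_unit_valid.
- by move=> A B E *; exact: yd_assoc_mor.
- exact: yd_lun_mor.
- exact: yd_run_mor.
- by move=> A B /rm hA /rm hB; exact: (tl_id T).
- move=> A A' A'' B B' B'' f' f g' g /rm ? /rm ? /rm ? /rm ? /rm ? /rm ?.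
  by move=> [? _] [? _] [? _] [? _]; exact: (tl_comp T).
- move=> A A' B B' E E' f g h /rm ? /rm ? /rm ? /rm ? /rm ? /rm ?.
  by move=> [? _] [? _] [? _]; exact: (tl_assoc_nat T).
- by move=> A A' f /rm ? /rm ? [? _]; exact: (tl_lun_nat T).
- by move=> A A' f /rm ? /rm ? [? _]; exact: (tl_run_nat T).
- by move=> A B E /rm ? /rm ? /rm ?; exact: (tl_assoc_bij T).
- by move=> A /rm ?; exact: (tl_lun_bij T).
- by move=> A /rm ?; exact: (tl_run_bij T).
- by move=> A B E D /rm ? /rm ? /rm ? /rm ?; exact: (tl_pentagon T).
- by move=> A B /rm ? /rm ?; exact: (tl_triangle T).
Qed.

End YDTensor.
#[export] Hint Resolve yd_tens_valid yd_unit_valid : lin lin_conv.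

(** * Hopf modules and coinvariants *)

Section Antipode.
Variables (k : comPzRingType) (H : monHomHopf k).
Implicit Types (h : H) (P : lmodType k).

(** This and the next three lemmas put the antipode and counit axioms under a linear map [f], so
    that two legs can be collapsed inside a larger expression. *)
Lemma sum_antipl P (f : H -> P) h : klinear f ->
  (slet a ⊗ b := Delta h in f (antip a ⋅ b)) = eps h *: f (hone H).
Proof. by move=> lf; rewrite -(lin_pull _ _ lf) antipl (linZ lf). Qed.

Lemma sum_antipr P (f : H -> P) h : klinear f ->
  (slet a ⊗ b := Delta h in f (a ⋅ antip b)) = eps h *: f (hone H).
Proof. by move=> lf; rewrite -(lin_pull _ _ lf) antipr (linZ lf). Qed.

Lemma sum_counitl P (f : H -> P) h : klinear f ->
  (slet a ⊗ b := Delta h in eps a *: f b) = f (autV h).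
Proof.
move=> lf; rewrite -eps_counitl (lin_pull _ _ lf); apply: eq_tlift => a b.
by rewrite (linZ lf).
Qed.

Lemma sum_counitr P (f : H -> P) h : klinear f ->
  (slet a ⊗ b := Delta h in eps b *: f a) = f (autV h).
Proof.
move=> lf; rewrite -eps_counitr (lin_pull _ _ lf); apply: eq_tlift => a b.
by rewrite (linZ lf).
Qed.

Lemma antip_hone : antip (hone H) = hone H.
Proof.
have := antipl (hone H); rewrite Delta_hone; tpure.
rewrite eps_hone scale1r hmul1 => e.
by apply: (can_inj (@hautK k H)); rewrite aut_hone.
Qed.

Let tmul (x y : tensor H H) : tensor H H :=
  slet a ⊗ b := x in slet c ⊗ d := y in (a ⋅ c) ⊗ (b ⋅ d).

Let flipS (x : tensor H H) : tensor H H := slet a ⊗ b := x in antip b ⊗ antip a.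

(** In the product of S(h_12) ⊗ S(h_11) by h_21 ⊗ h_22, coassociativity makes the two middle legs a
    coproduct, which [antipl] collapses; the counit then leaves two legs, collapsed by [antipl]
    again. *)
Let flipS_Delta h : (slet p ⊗ q := Delta h in tmul (flipS (Delta p)) (Delta q))
  = eps h *: (hone H ⊗ hone H).
Proof.
transitivity (slet a ⊗ r := Delta h in
  slet r1 ⊗ r2 := Delta r in slet u ⊗ v := Delta r1 in
    aut (antip u ⋅ v) ⊗ (antip (autV a) ⋅ r2)).
  transitivity (slet a ⊗ r := Delta h in slet b ⊗ c := Delta r in
    slet c1 ⊗ c2 := Delta c in (antip b ⋅ aut c1) ⊗ (antip (autV a) ⋅ aut c2)).
    rewrite /tmul /flipS; foldl (@Delta k H) (Delta h); foldr (@Delta k H) (Delta h).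
    rewrite Delta_coassoc; tind (tmap id (@Delta k H) (Delta h)) a y.
    tind y b c; tpure; rewrite Delta_tmap.
    by tind (Delta c) c1 c2; tpure.
  apply: eq_tlift => a r.
  foldr (@Delta k H) (Delta r); foldl (@Delta k H) (Delta r).
  rewrite Delta_coassoc; tind (tmap id (@Delta k H) (Delta r)) b y.
  by tind y c d; tpure; rewrite !hrules.
transitivity (slet a ⊗ r := Delta h in hone H ⊗ (antip (autV a) ⋅ autV r)).
  apply: eq_tlift => a r.
  rewrite -(@sum_counitl _ (fun r => hone H ⊗ (antip (autV a) ⋅ r))); last by lin.
  apply: eq_tlift => r1 r2.
  rewrite (@sum_antipl _ (fun u => aut u ⊗ (antip (autV a) ⋅ r2))); last by lin.
  by rewrite aut_hone.
have e a r : antip (autV a) ⋅ autV r = autV (antip a ⋅ r) by rewrite !hrules.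
transitivity (slet a ⊗ r := Delta h in hone H ⊗ autV (antip a ⋅ r)).
  by apply: eq_tlift => a r; rewrite e.
by rewrite (@sum_antipl _ (fun u => hone H ⊗ autV u)) ?autV_hone //; lin.
Qed.

(* Both sides are convolution inverses of Delta, on the right and on the left. *)
Lemma antip_Delta h : Delta (antip h) = slet a ⊗ b := Delta h in antip b ⊗ antip a.
Proof.
have ltl x : klinear (tmul x) by rewrite /tmul; lin.
have ltr y : klinear (fun x => tmul x y) by rewrite /tmul; lin.
have lfS : klinear flipS by rewrite /flipS; apply: tlift_klin; lin.
(* [Q] is the triple convolution product of [flipS ∘ Delta], [Delta] and [Delta ∘ antip]. Collapsing
   its first two factors gives [Delta (antip h)], collapsing the last two gives the flipped
   expression. *)
pose Q := slet a ⊗ y := tmap id (@Delta k H) (Delta h) in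
  slet b ⊗ c := y in tmul (flipS (Delta a)) (tmul (Delta b) (Delta (antip c))).
have tmul1 x : tmul (hone H ⊗ hone H) x = tmap aut aut x.
  by rewrite /tmul; tind x a b; tpure; rewrite !hmul1l.
have tmul1r x : tmul x (hone H ⊗ hone H) = tmap aut aut x.
  by rewrite /tmul; tind x a b; tpure; rewrite !hmul1.
transitivity Q; symmetry.
  transitivity (slet p ⊗ c := Delta h in
    tmul (slet a ⊗ b := Delta p in tmul (flipS (Delta a)) (Delta b)) (Delta (antip c))).
    rewrite /Q; foldl (@Delta k H) (Delta h).
    rewrite Delta_coassoc; tind (tmap id (@Delta k H) (Delta h)) a y; tind y b c; tpure.
    rewrite antip_aut Delta_tmap Delta_autV.
    tind (Delta a) a1 a2; tind (Delta b) b1 b2; tind (Delta (antip c)) c1 c2.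
    by rewrite /tmul /flipS; tpure; rewrite !hrules.
  transitivity (slet p ⊗ c := Delta h in eps p *: tmap aut aut (Delta (antip c))).
    by apply: eq_tlift => p c; rewrite flipS_Delta (linZ (ltr _)) tmul1.
  rewrite (@sum_counitl _ (fun c => tmap aut aut (Delta (antip c)))); last by lin.
  by rewrite -Delta_tmap -antip_aut hautVK.
transitivity (slet a ⊗ d := Delta h in
  tmul (flipS (Delta a)) (slet b ⊗ c := Delta d in Delta (b ⋅ antip c))); last first.
  rewrite /Q; foldr (@Delta k H) (Delta h).
  tind (tmap id (@Delta k H) (Delta h)) a y; tind y b c; tpure.
  by rewrite Delta_hmul.
transitivity (slet a ⊗ d := Delta h in eps d *: tmap aut aut (flipS (Delta a))); last first.
  apply: eq_tlift => a d; rewrite (@sum_antipr _ (@Delta k H)); last by lin.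
  by rewrite Delta_hone (linZ (ltl _)) tmul1r.
rewrite (@sum_counitr _ (fun a => tmap aut aut (flipS (Delta a)))); last by lin.
rewrite -/(flipS (Delta h)) -{1}(hautVK h) Delta_tmap.
by tind (Delta (autV h)) a b; rewrite /flipS; tpure; rewrite !hrules.
Qed.

End Antipode.

(** * The projection P_L of a Hopf module onto its coinvariants *)

Section HopfModules.
Variables (k : comPzRingType) (H : monHomHopf k) (M : hopf_data H) (hM : is_hopf M).
Implicit Types (m v : M) (h g : H).

Let hM0 := hopf_hmod hM.

Lemma autV_lact h m : autV (hp_act h m) = hp_act (autV h) (autV m).
Proof.
apply: (can_inj (hmod_autK hM0)).
by rewrite (aut_lact (hopf_lmodule hM)) !(hmod_autVK hM0) hautVK.
Qed.

Lemma lactA' g h m : hp_act (g ⋅ h) m = hp_act (aut g) (hp_act h (autV m)).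
Proof. by rewrite (lactA (hopf_lmodule hM)) (hmod_autVK hM0). Qed.

Definition hopf_rules :=
  (aut_lact (hopf_lmodule hM), autV_lact, lactA', lact1 (hopf_lmodule hM),
   hmod_autK hM0, hmod_autVK hM0).

Lemma coact_aut m : hp_coact (aut m) = tmap aut aut (hp_coact m).
Proof. exact: lcoact_aut (hopf_lcomodule hM) m. Qed.

Lemma coact_autV m : hp_coact (autV m) = tmap autV autV (hp_coact m).
Proof.
rewrite -{2}(hmod_autVK hM0 m) coact_aut.
tind (hp_coact (autV m)) a n; tpure.
by rewrite hautK (hmod_autK hM0).
Qed.

Lemma coact_coassoc m : tmap (@Delta k H) id (hp_coact m)
  = slet a ⊗ y := tmap id (@hp_coact k H M) (hp_coact m) in
    slet b ⊗ n := y in (autV a ⊗ b) ⊗ aut n.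
Proof. exact: lcoact_coassoc (hopf_lcomodule hM). Qed.

Lemma sum_coact_eps (P : lmodType k) (f : M -> P) m : klinear f ->
  (slet a ⊗ n := hp_coact m in eps a *: f n) = f (autV m).
Proof.
move=> lf; rewrite -(lcoact_eps (hopf_lcomodule hM)) (lin_pull _ _ lf).
by apply: eq_tlift => a b; rewrite (linZ lf).
Qed.

Lemma PL_klin : klinear (@PL k H M).
Proof. by rewrite /PL; lin. Qed.

Lemma PL_aut m : PL (aut m) = aut (PL m).
Proof.
rewrite /PL coact_aut; tind (hp_coact m) a n; tpure.
by rewrite antip_aut hopf_rules.
Qed.

(** Since the antipode reverses Delta, the coaction of S(a) n is S(a_2) n_(-1) ⊗ S(a_1) n_(0).
    Coassociativity makes a_2 and n_(-1) the two legs of one coproduct, and the antipode axiom turns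
    their product into the unit. *)
Lemma PL_coinv m : coinvariant (PL m).
Proof.
rewrite /coinvariant /PL.
transitivity (slet a ⊗ r := hp_coact m in slet c ⊗ n := hp_coact r in
  slet c1 ⊗ c2 := Delta c in
    aut (antip c1 ⋅ c2) ⊗ hp_act (antip (autV a)) n).
  transitivity (slet a ⊗ r := hp_coact m in slet b ⊗ n := hp_coact r in
    slet c ⊗ p := hp_coact n in
      (antip b ⋅ aut c) ⊗ hp_act (antip (autV a)) (aut p)).
    snl ltac:(rewrite ?(hopf_compatible hM) ?antip_Delta).
    foldl (@Delta k H) (hp_coact m); foldr (@hp_coact k H M) (hp_coact m).
    rewrite coact_coassoc.
    tind (tmap id (@hp_coact k H M) (hp_coact m)) a y; tind y b n; tpure.
    by rewrite coact_aut; tind (hp_coact n) c p; tpure.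
  apply: eq_tlift => a r.
  foldr (@hp_coact k H M) (hp_coact r); foldl (@Delta k H) (hp_coact r).
  rewrite coact_coassoc.
  tind (tmap id (@hp_coact k H M) (hp_coact r)) b y; tind y c p; tpure.
  by rewrite !hrules.
transitivity (slet a ⊗ r := hp_coact m in
  hone H ⊗ hp_act (antip (autV a)) (autV r)).
  apply: eq_tlift => a r.
  rewrite -(@sum_coact_eps _ (fun r => hone H ⊗ hp_act (antip (autV a)) r)); last by lin.
  apply: eq_tlift => c n.
  rewrite (@sum_antipl _ _ _ (fun u => aut u ⊗ hp_act (antip (autV a)) n)); last by lin.
  by rewrite aut_hone.
tind (hp_coact m) a r; tpure.
by rewrite autV_lact antip_autV.
Qed.

Lemma PL_fix v : coinvariant v -> PL v = v.
Proof.
move=> cv; rewrite /PL cv; tpure.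
by rewrite antip_hone !hopf_rules.
Qed.

(** As [v] has trivial coaction, P_L(h v) is S(h_1) h_2 acting on [v], up to twists. *)
Lemma PL_act_coinv h v : coinvariant v -> PL (hp_act h v) = eps h *: aut v.
Proof.
move=> cv; rewrite /PL (hopf_compatible hM) cv.
rewrite -[in RHS](lact1 (hopf_lmodule hM)).
rewrite -(@sum_antipl _ _ _ (fun u => hp_act u v)); last by lin.
tind (Delta h) h1 h2; tpure.
by rewrite !hrules !hopf_rules.
Qed.

(** Unfolding P_L leaves m_(-1) next to S(m_(0)(-1)); coassociativity makes them the two legs of one
    coproduct, to which [antipr] applies. *)
Lemma coact_PL m : (slet a ⊗ n := hp_coact m in hp_act a (PL n)) = m.
Proof.
transitivity (slet c ⊗ n := hp_coact m in slet a ⊗ b := Delta c in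
  hp_act (a ⋅ antip b) n).
  rewrite /PL; foldr (@hp_coact k H M) (hp_coact m); foldl (@Delta k H) (hp_coact m).
  rewrite coact_coassoc.
  tind (tmap id (@hp_coact k H M) (hp_coact m)) a y; tind y b n; tpure.
  by rewrite !hopf_rules !hrules.
transitivity (slet c ⊗ n := hp_coact m in eps c *: aut n).
  apply: eq_tlift => c n.
  rewrite (@sum_antipr _ _ _ (fun u => hp_act u n)); last by lin.
  by rewrite hopf_rules.
rewrite (@sum_coact_eps _ aut); last by lin.
by rewrite (hmod_autVK hM0).
Qed.

Lemma coinv_aut v : coinvariant v -> coinvariant (aut v).
Proof.
rewrite /coinvariant => cv; rewrite coact_aut cv; tpure.
by rewrite !hopf_rules aut_hone.
Qed.

Lemma coinv_autV v : coinvariant v -> coinvariant (autV v).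
Proof.
rewrite /coinvariant => cv; rewrite coact_autV cv; tpure.
by rewrite autV_hone.
Qed.

(** Decomposing [m] as the sum of the [a (P_L n)] reduces the statement to the coinvariant case
    [PL_act_coinv]. *)
Lemma PL_act h m : PL (hp_act h m) = eps h *: aut (PL m).
Proof.
rewrite -{1}(coact_PL m).
rewrite (@lin_pull _ _ _ _ _ (fun x => PL (hp_act h x))); last first.
  by apply: (@comp_klin _ _ _ _ (@PL k H M)); [exact: PL_klin|lin].
transitivity (slet a ⊗ n := hp_coact m in eps a *: (eps h *: aut (aut (PL n)))).
  apply: eq_tlift => a n; rewrite -{1}(hautVK h) (lactA (hopf_lmodule hM)).
  rewrite PL_act_coinv; last exact/coinv_aut/PL_coinv.
  by rewrite eps_hmul eps_autV scalerA mulrC.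
have l := PL_klin.
rewrite (@sum_coact_eps _ (fun n => eps h *: aut (aut (PL n)))); last by lin.
by rewrite -PL_aut (hmod_autVK hM0).
Qed.

End HopfModules.

(** * Free Hopf modules *)

Section FreeHopfModule.
Variables (k : comPzRingType) (H : monHomHopf k) (V : hmod_data k).

(** Conversions recorded as rewrite rules, so that one structure map is unfolded at a time while the
    others keep a form to which the module lemmas apply. *)
Lemma F_hopf_autE x : @aut k (F_hopf H V) x = tmap aut aut x.
Proof. by []. Qed.

Lemma F_hopf_actE h x :
  @hp_act k H (F_hopf H V) h x = slet g ⊗ v := x in (autV h ⋅ g) ⊗ aut v.
Proof. by []. Qed.

Lemma F_hopf_coactE x : @hp_coact k H (F_hopf H V) x
  = slet h ⊗ v := x in slet h1 ⊗ h2 := Delta h in aut h1 ⊗ (h2 ⊗ autV v).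
Proof. by []. Qed.

Lemma F_hopf_valid : is_hmod V -> is_hopf (F_hopf H V).
Proof.
move=> hV; have K := hmod_autK hV; have VK := hmod_autVK hV; split.
- by apply: hm_tens_valid => //; exact: hb_hmod.
- split=> /=.
  + by lin.
  + by move=> h x; tind x g v; tpure; rewrite !hrules.
  + by move=> g h x; tind x a v; tpure; rewrite !hrules.
  + by move=> x; tind x a v; tpure; rewrite !hrules.
- split=> /=.
  + by apply: tlift_klin; lin.
  + move=> x; tind x h v; tpure; rewrite Delta_tmap.
    by tind (Delta h) h1 h2; tpure; rewrite K VK.
  + move=> x; tind x h v; tpure.
    snl ltac:(rewrite ?Delta_tmap); snr ltac:(idtac).
    foldl (@Delta k H) (Delta h); foldr (@Delta k H) (Delta h).
    rewrite Delta_coassoc.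
    by tind (tmap id (@Delta k H) (Delta h)) a y; tind y b c; tpure; rewrite !hrules.
  + move=> x; tind x h v; tpure.
    rewrite -(@sum_counitl _ _ _ (fun h => h ⊗ autV v)); last by lin.
    by tind (Delta h) h1 h2; tpure; rewrite eps_aut.
- move=> h x /=; tind x g v; tpure; rewrite Delta_hmul Delta_autV.
  by tind (Delta h) h1 h2; tind (Delta g) g1 g2; tpure; rewrite !hrules K VK.
Qed.

End FreeHopfModule.
#[export] Hint Resolve F_hopf_valid PL_klin : lin lin_conv.

Section Coinvariants.
Variables (k : comPzRingType) (H : monHomHopf k).

Lemma submod_valP (V : lmodType k) (W : V -> Prop) (hW : is_submod W) (x : submod hW) :
  W (val x).
Proof. by have := valP x; move/asboolP. Qed.

Lemma val_to_coH (M : hopf_data H) (hM : is_submod (@coinvariant k H M)) m :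
  coinvariant m -> val (to_coH hM m) = m.
Proof. by move=> cm; rewrite /to_coH insubdK //; apply/asboolP. Qed.

Lemma to_coH_val (M : hopf_data H) (hM : is_submod (@coinvariant k H M)) v :
  to_coH hM (val v) = v.
Proof. by apply: val_inj; rewrite val_to_coH //; exact: submod_valP. Qed.

(** [to_coH] sends every element that is not coinvariant to 0, so linearity is claimed only after a
    map [f] with coinvariant values. *)
Lemma to_coH_klin (M : hopf_data H) (hM : is_submod (@coinvariant k H M))
    (U : lmodType k) (f : U -> M) :
  (forall u, coinvariant (f u)) -> klinear f -> klinear (fun u => to_coH hM (f u)).
Proof.
move=> cf lf a x y; apply: val_inj; rewrite val_klin !val_to_coH //; exact: lf.
Qed.

Lemma hopf_reflects_iso : reflects_iso (HopfMod H).
Proof.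
move=> A B f g hA hB [hf lf cf] K VK.
have hg : is_hmor g := hm_mor_inv hf K VK.
have lf' : klinear f := hf.1; have lg : klinear g := hg.1.
split=> // [h m|m]; first by apply: (can_inj K); rewrite VK lf VK.
rewrite -{2}(VK m) cf -/(tmap id f _) -/(tmap id g _) tmap_comp //.
by rewrite (_ : g \o f = id) ?tmap_id //; apply/funext.
Qed.

Lemma hm_reflects_iso : reflects_iso (HM k).
Proof. by move=> A B f g hA hB hf K VK; exact: hm_mor_inv hf K VK. Qed.

Lemma hopf_mor_coinv (M N : hopf_data H) (f : M -> N) m : is_hopf M -> is_hopf N ->
  is_hopf_mor f -> coinvariant m -> coinvariant (f m).
Proof.
move=> hM hN [hf _ cf] cm; have lf : klinear f := hf.1.
rewrite /coinvariant cf cm; tpure.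
by rewrite (hmor_autV _ (hopf_hmod hM) (hopf_hmod hN) hf).
Qed.

End Coinvariants.

(** * The isomorphism from H ⊗ coH(M) to M *)

Section CoinvariantModule.
Variables (k : comPzRingType) (H : monHomHopf k).
Variables (M : hopf_data H) (hM : is_hopf M) (W : is_submod (@coinvariant k H M)).

Lemma coH_valid : is_hmod (coH W).
Proof.
have K := hmod_autK (hopf_hmod hM); have VK := hmod_autVK (hopf_hmod hM).
have cV v : coinvariant (val (v : submod W)) := submod_valP v.
have vA v : val (to_coH W (aut (val (v : submod W)))) = aut (val v).
  by rewrite val_to_coH //; exact: coinv_aut (cV v).
have vV v : val (to_coH W (autV (val (v : submod W)))) = autV (val v).
  by rewrite val_to_coH //; exact: coinv_autV (cV v).
split=> /= [|v|v]; last 2 first.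
- by apply: val_inj; rewrite vV vA K.
- by apply: val_inj; rewrite vA vV VK.
apply: to_coH_klin => [v|]; first exact: coinv_aut (cV v).
by lin.
Qed.

Lemma coact_val (v : submod W) : hp_coact (val v) = hone H ⊗ autV (val v).
Proof. exact: submod_valP v. Qed.

Lemma val_aut_coH (v : coH W) : val (aut v : submod W) = aut (val (v : submod W)).
Proof. by rewrite val_to_coH //; apply: coinv_aut => //; exact: submod_valP. Qed.

Lemma val_autV_coH (v : coH W) : val (autV v : submod W) = autV (val (v : submod W)).
Proof. by rewrite val_to_coH //; apply: coinv_autV => //; exact: submod_valP. Qed.

Definition PLc (m : M) : submod W := to_coH W (PL m).

Lemma val_PLc m : val (PLc m) = PL m.
Proof. by rewrite val_to_coH //; exact: PL_coinv. Qed.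

Lemma PLc_klin : klinear PLc.
Proof. by apply: to_coH_klin (PL_coinv hM) _; exact: PL_klin. Qed.

Definition hopf_counit (x : tensor H (submod W)) : M :=
  slet h ⊗ v := x in hp_act h (val v).

Lemma hopf_counit_mor : is_hopf_mor (M := F_hopf H (coH W)) hopf_counit.
Proof.
have hW := coH_valid; split; first split.
- by apply: tlift_klin; lin.
- move=> x; rewrite F_hopf_autE /hopf_counit; tind x h v; tpure.
  by rewrite (aut_lact (hopf_lmodule hM)) val_aut_coH.
- move=> h x; rewrite F_hopf_actE /hopf_counit; tind x g v; tpure.
  by rewrite val_aut_coH (hopf_rules hM) (hmod_autK (hopf_hmod hM)) hautVK.
- move=> x; rewrite F_hopf_coactE /hopf_counit; tind x h v; tpure.
  rewrite (hopf_compatible hM) coact_val.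
  tind (Delta h) h1 h2; tpure.
  by rewrite hmul1 val_autV_coH.
Qed.

Lemma hopf_counit_bij : bijective hopf_counit.
Proof.
have lP := PLc_klin.
exists (fun m => slet a ⊗ n := hp_coact m in a ⊗ PLc n) => m.
  rewrite /hopf_counit; tind m h v; tpure.
  rewrite (hopf_compatible hM) coact_val.
  (* [PL_act_coinv] turns the leg h_2 v into a scalar multiple of [v], and the counit then gives
     back [h]. *)
  transitivity (slet h1 ⊗ h2 := Delta h in eps h2 *: (aut h1 ⊗ v)); last first.
    by rewrite (@sum_counitr _ _ _ (fun h => aut h ⊗ v)) ?hautVK //; lin.
  snl ltac:(idtac); apply: eq_tlift => a b.
  rewrite hmul1 -pureZr; congr (_ ⊗ _); apply: val_inj.
  rewrite val_PLc PL_act_coinv //; last first.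
    by apply: coinv_autV => //; exact: submod_valP.
  by rewrite (hmod_autVK (hopf_hmod hM)) (linZ (@val_klin _ _ _ W)).
rewrite /hopf_counit -[RHS](coact_PL hM).
tind (hp_coact m) a n; tpure.
by rewrite val_PLc.
Qed.

End CoinvariantModule.
#[export] Hint Resolve coH_valid PLc_klin : lin lin_conv.

(** * The isomorphism from V to the coinvariants of H ⊗ V *)

Section HopfUnit.
Variables (k : comPzRingType) (H : monHomHopf k) (V : hmod_data k) (hV : is_hmod V).
Variable W : is_submod (@coinvariant k H (F_hopf H V)).

Definition hopf_unit (v : V) : submod W := to_coH W (hone H ⊗ autV v).

Lemma hopf_unit_coinv (v : V) : @coinvariant k H (F_hopf H V) (hone H ⊗ autV v).
Proof.
rewrite /coinvariant /=; tpure; rewrite Delta_hone; tpure.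
by rewrite aut_hone autV_hone.
Qed.

Lemma val_hopf_unit v : val (hopf_unit v) = hone H ⊗ autV v.
Proof. by rewrite val_to_coH //; exact: hopf_unit_coinv. Qed.

Lemma hopf_unit_mor : is_hmor (N := coH W) hopf_unit.
Proof.
split.
  apply: to_coH_klin; first exact: hopf_unit_coinv.
  by lin.
move=> v; apply: val_inj; rewrite val_aut_coH; last exact: F_hopf_valid.
rewrite !val_hopf_unit /=; tpure.
by rewrite aut_hone (hmod_autK hV) (hmod_autVK hV).
Qed.

Lemma hopf_unit_bij : bijective hopf_unit.
Proof.
exists (fun x => slet h ⊗ v := (val x : tensor H V) in eps h *: aut v) => x.
  by rewrite val_hopf_unit; tpure; rewrite eps_hone scale1r (hmod_autVK hV).
apply: val_inj; rewrite val_hopf_unit.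
have := submod_valP x; rewrite /coinvariant /=.
move: (val x) => {}x e.
(* The map sending a ⊗ (b ⊗ v) to eps(b) (a ⊗ aut v) is applied to both sides of the coinvariance
   equation [e]: on the trivial side it gives the proposed preimage under the unit, on the coaction
   side it gives back [x] by the counit axiom. *)
transitivity (slet a ⊗ y := (hone H ⊗ tmap autV autV x : tensor H (tensor H V)) in
  slet b ⊗ v := y in eps b *: (a ⊗ aut v)).
  tind x h v; tpure.
  by rewrite eps_autV (hmod_autVK hV) (linZ (lin_autV hV)) pureZr (hmod_autK hV).
rewrite -e; tind x h v; tpure.
transitivity (slet h1 ⊗ h2 := Delta h in eps h2 *: (aut h1 ⊗ v)).
  by tind (Delta h) h1 h2; tpure; rewrite (hmod_autVK hV).
by rewrite (@sum_counitr _ _ _ (fun h => aut h ⊗ v)) ?hautVK //; lin.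
Qed.

End HopfUnit.

(** * The equivalence between modules and Hopf modules *)

Section Equivalence.
Variables (k : comPzRingType) (H : monHomHopf k).

Lemma F_hopf_mor (V W : hmod_data k) (f : V -> W) : is_hmod V -> is_hmod W ->
  is_hmor f -> is_hopf_mor (M := F_hopf H V) (N := F_hopf H W) (tmap (fun h : H => h) f).
Proof.
move=> hV hW hf; have lf : klinear f := hf.1.
have fV v := hmor_autV v hV hW hf; case: hf => _ fa.
split; first split; rewrite /=.
- by apply: tmap_klin; lin.
- by move=> x; tind x h v; tpure; rewrite fa.
- by move=> h x; tind x g v; tpure; rewrite fa.
- by move=> x; tind x h v; tpure; tind (Delta h) h1 h2; tpure; rewrite fV.
Qed.

(** [WM] and [WN] are arbitrary proofs that the coinvariants form a submodule, so that this lemma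
    and the following ones also serve covariant bimodules, where the proofs come from another
    structure. *)
Lemma coH_mor (M N : hopf_data H) (f : M -> N) (WM : is_submod (@coinvariant k H M))
    (WN : is_submod (@coinvariant k H N)) : is_hopf M -> is_hopf N -> is_hopf_mor f ->
  is_hmor (M := coH WM) (N := coH WN) (fun v => to_coH WN (f (val (v : submod WM)))).
Proof.
move=> hM hN hf; have lf : klinear f := (hopf_hmor hf).1.
have cf v : coinvariant (f (val (v : submod WM))).
  by apply: hopf_mor_coinv => //; exact: submod_valP.
split; first by apply: to_coH_klin => //; lin.
move=> v; apply: val_inj.
rewrite (val_aut_coH hN) (val_to_coH _ (cf v)) (val_to_coH _ (cf (aut v))).
by rewrite (val_aut_coH hM) (hopf_hmor hf).2.
Qed.

Lemma hopf_unit_nat (V V' : hmod_data k) (f : V -> V')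
    (W : is_submod (@coinvariant k H (F_hopf H V)))
    (W' : is_submod (@coinvariant k H (F_hopf H V'))) v :
  is_hmod V -> is_hmod V' -> is_hmor f ->
  hopf_unit W' (f v) = to_coH W' (tmap (fun h : H => h) f (val (hopf_unit W v))).
Proof.
move=> hV hV' hf; have lf : klinear f := hf.1.
have e := val_hopf_unit hV W v.
apply: val_inj; rewrite val_hopf_unit // val_to_coH; last first.
  rewrite e; apply: hopf_mor_coinv (F_hopf_valid H hV) (F_hopf_valid H hV') _ _.
    exact: F_hopf_mor.
  exact: hopf_unit_coinv.
by rewrite e; tpure; rewrite (hmor_autV _ hV hV' hf).
Qed.

Lemma hopf_counit_nat (M N : hopf_data H) (f : M -> N)
    (WM : is_submod (@coinvariant k H M)) (WN : is_submod (@coinvariant k H N)) x :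
  is_hopf M -> is_hopf N -> is_hopf_mor f ->
  @hopf_counit k H N WN (tmap (fun h : H => h)
    (fun v => to_coH WN (f (val (v : submod WM)))) x) = f (@hopf_counit k H M WM x).
Proof.
move=> hM hN hf; have lf : klinear f := (hopf_hmor hf).1.
pose g (v : submod WM) : submod WN := to_coH WN (f (val v)).
have lg : klinear g := (coH_mor WM WN hM hN hf).1.
rewrite -/g /hopf_counit; tind x h v; tpure.
rewrite val_to_coH ?(hopf_llinear hf) //.
by apply: hopf_mor_coinv => //; exact: submod_valP.
Qed.

Lemma hopf_zig (V : hmod_data k) (W : is_submod (@coinvariant k H (F_hopf H V))) x :
  is_hmod V -> @hopf_counit k H (F_hopf H V) W (tmap (fun h : H => h) (hopf_unit W) x) = x.
Proof.
move=> hV; have hF := F_hopf_valid H hV.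
have lu : klinear (hopf_unit W) := (hopf_unit_mor hV W).1.
have lc : klinear (@hopf_counit k H (F_hopf H V) W) := (hopf_hmor (hopf_counit_mor hF W)).1.
tind x h v; tpure; rewrite /hopf_counit; tpure.
rewrite val_hopf_unit // F_hopf_actE; tpure.
by rewrite !hrules (hmod_autVK hV).
Qed.

Lemma hopf_zag (M : hopf_data H) (W : is_submod (@coinvariant k H M))
    (W' : is_submod (@coinvariant k H (F_hopf H (coH W)))) v : is_hopf M ->
  to_coH W (@hopf_counit k H M W (val (hopf_unit W' v))) = v.
Proof.
move=> hM; have hW := coH_valid hM W.
rewrite val_hopf_unit // /hopf_counit; tpure.
rewrite (lact1 (hopf_lmodule hM)) (val_autV_coH hM) (hmod_autVK (hopf_hmod hM)).
exact: to_coH_val.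
Qed.

Definition Free_ob (V : HM k) : HopfMod H :=
  @Cob k (HopfMod H) (F_hopf H (dat V)) (F_hopf_valid H (cobP V)).

Definition Free : functor (HM k) (HopfMod H).
Proof.
refine (@Functor (HM k) (HopfMod H) Free_ob (fun V W f =>
  @CHom k (HopfMod H) (Free_ob V) (Free_ob W) (tmap (fun h : H => h) (fn f))
    (F_hopf_mor (cobP V) (cobP W) (chomP f))) _ _).
- by move=> V; apply: chom_eq => x; exact: tmap_id.
- move=> V W X g f; apply: chom_eq => x /=.
  by rewrite tmap_comp //; [exact: (chomP f).1|exact: (chomP g).1].
Defined.

Definition coinv_sub (M : HopfMod H) : is_submod (@coinvariant k H (dat M)) :=
  coinvariant_submod (hopf_hmod (cobP M)) (hopf_lcomodule (cobP M)).

Definition Coinv_ob (M : HopfMod H) : HM k :=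
  @Cob k (HM k) (G_hopf M) (coH_valid (cobP M) (coinv_sub M)).

Definition Coinv : functor (HopfMod H) (HM k).
Proof.
refine (@Functor (HopfMod H) (HM k) Coinv_ob (fun M N f =>
  @CHom k (HM k) (Coinv_ob M) (Coinv_ob N) (G_mor f)
    (coH_mor (coinv_sub M) (coinv_sub N) (cobP M) (cobP N) (chomP f))) _ _).
- by move=> M; apply: chom_eq => x; exact: to_coH_val.
- move=> M N P g f; apply: chom_eq => x /=.
  rewrite /G_mor /= val_to_coH //; apply: (hopf_mor_coinv (cobP M) (cobP N) (chomP f)).
  exact: submod_valP.
Defined.

Definition Free_unit (V : HM k) : homc V (Coinv (Free V)) :=
  @CHom k (HM k) V (Coinv_ob (Free_ob V)) (hopf_unit (coinv_sub (Free_ob V)))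
    (hopf_unit_mor (cobP V) _).

Definition Free_counit (M : HopfMod H) : homc (Free (Coinv M)) M :=
  @CHom k (HopfMod H) (Free_ob (Coinv_ob M)) M (@hopf_counit k H _ (coinv_sub M))
    (hopf_counit_mor (cobP M) _).

Definition Free_equiv : equivalence Free Coinv.
Proof.
refine (@Equivalence _ _ Free Coinv Free_unit Free_counit _ _ _ _).
- by move=> V W f; apply: chom_eq => v; exact: hopf_unit_nat (cobP V) (cobP W) (chomP f).
- by move=> M N f; apply: chom_eq => x; exact: hopf_counit_nat (cobP M) (cobP N) (chomP f).
- move=> V; apply: bij_iso; [exact: hm_reflects_iso|exact: hopf_unit_bij (cobP V) _].
- move=> M; apply: bij_iso; first exact: hopf_reflects_iso.
  exact: hopf_counit_bij (cobP M) _.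
Defined.

End Equivalence.

(** * Tensor products over H *)

Section LCovRules.
Variables (k : comPzRingType) (H : monHomHopf k) (M : lcov_data H) (hM : is_lcov M).
Implicit Types (m : M) (h g : H).

Let hH := is_lcov_hopf hM.
Let hM0 := lcov_hmod hM.

Lemma autV_lract m h : autV (lc_act m h) = lc_act (autV m) (autV h).
Proof.
apply: (can_inj (hmod_autK hM0)).
by rewrite (aut_ract (lcov_rmodule hM)) !(hmod_autVK hM0) hautVK.
Qed.

Lemma lractA' m g h : lc_act (lc_act m g) h = lc_act (aut m) (g ⋅ autV h).
Proof. by rewrite -(ractA (lcov_rmodule hM)) hautVK. Qed.

Lemma bimodA' g m h : lc_act (hp_act g m) h = hp_act (aut g) (lc_act m (autV h)).
Proof. by rewrite -(lcov_bimodule hM) hautVK. Qed.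

Definition lcov_rules :=
  (@hrules k H, hopf_rules hH, aut_ract (lcov_rmodule hM), autV_lract, lractA', bimodA',
   ract1 (lcov_rmodule hM)).

(** Covariance with unit left factor, taken at [autV m] and [autV h]: the unit acts by [aut], which
    restores [m] and [h]. *)
Lemma coact_ract m h : hp_coact (lc_act m h)
  = slet a ⊗ n := hp_coact m in slet g1 ⊗ g2 := Delta h in (a ⋅ g1) ⊗ lc_act n g2.
Proof.
have := lcov_covariant hM (hone H) (autV m) (autV h).
rewrite (lact1 (lcov_lmodule hM)) (hmod_autVK hM0) hautVK => ->.
rewrite aut_hone Delta_hone (coact_autV hH) Delta_autV; tpure.
tind (hp_coact m) a n; tind (Delta h) g1 g2; tpure.
by rewrite !lcov_rules.
Qed.

End LCovRules.

Section Covariance.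
Variables (k : comPzRingType) (H : monHomHopf k).

(** Covariance for both actions at once splits into covariance for each of them, by
    Hom-associativity and the bimodule compatibility. The free modules and the tensor products are
    verified in this form. *)
Lemma lcovariantP (M : lcov_data H) : is_hopf M -> is_rmodule (@lc_act k H M) ->
  bimodule_compat (@hp_act k H M) (@lc_act k H M) ->
  (forall (m : M) h, hp_coact (lc_act m h)
    = slet a ⊗ n := hp_coact m in slet g1 ⊗ g2 := Delta h in (a ⋅ g1) ⊗ lc_act n g2) ->
  lcovariant (@hp_act k H M) (@lc_act k H M) (@hp_coact k H M).
Proof.
move=> hM hr hb e h m g.
have ll g' : klinear (fun m : M => lc_act m g') by exact: (ract_bilin hr).2.
have lr m' : klinear (@lc_act k H M m') by exact: (ract_bilin hr).1.
rewrite e (hopf_compatible hM) !Delta_tmap.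
tind (hp_coact m) a n; tind (Delta h) h1 h2; tind (Delta g) g1 g2; tpure.
by rewrite hmulA hb.
Qed.

Lemma rcovariantP (M : bicov_data H) : is_lcov M -> is_rcomodule (@bc_coact k H M) ->
  (forall (m : M) h, bc_coact (lc_act m h)
    = slet n ⊗ a := bc_coact m in slet g1 ⊗ g2 := Delta h in lc_act n g1 ⊗ (a ⋅ g2)) ->
  (forall (m : M) h, bc_coact (hp_act h m)
    = slet h1 ⊗ h2 := Delta h in slet n ⊗ a := bc_coact m in hp_act h1 n ⊗ (h2 ⋅ a)) ->
  rcovariant (@hp_act k H M) (@lc_act k H M) (@bc_coact k H M).
Proof.
move=> hM hs er el h m g.
have ls : klinear (@bc_coact k H M) by exact: rcoact_linear hs.
rewrite er el !Delta_tmap.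
tind (bc_coact m) n a; tind (Delta h) h1 h2; tind (Delta g) g1 g2; tpure.
by rewrite hmulA (lcov_bimodule hM).
Qed.

End Covariance.

Section BicovRules.
Variables (k : comPzRingType) (H : monHomHopf k) (M : bicov_data H) (hM : is_bicov M).
Implicit Types (m : M) (h g : H).

Let hL := bicov_is_lcov hM.
Let hM0 := lcov_hmod hL.

Lemma rcoact_autE m : bc_coact (aut m) = tmap aut aut (bc_coact m).
Proof. exact: rcoact_aut (bicov_rcomodule hM) m. Qed.

Lemma rcoact_autV m : bc_coact (autV m) = tmap autV autV (bc_coact m).
Proof.
rewrite -{2}(hmod_autVK hM0 m) rcoact_autE.
tind (bc_coact (autV m)) n a; tpure.
by rewrite hautK (hmod_autK hM0).
Qed.

Lemma rcoact_ract m h : bc_coact (lc_act m h)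
  = slet n ⊗ a := bc_coact m in slet g1 ⊗ g2 := Delta h in lc_act n g1 ⊗ (a ⋅ g2).
Proof.
have := bicov_covariant hM (hone H) (autV m) (autV h).
rewrite (lact1 (lcov_lmodule hL)) (hmod_autVK hM0) hautVK => ->.
rewrite aut_hone Delta_hone rcoact_autV Delta_autV; tpure.
tind (bc_coact m) n a; tind (Delta h) g1 g2; tpure.
by rewrite !(lcov_rules hL).
Qed.

Lemma rcoact_lact m h : bc_coact (hp_act h m)
  = slet h1 ⊗ h2 := Delta h in slet n ⊗ a := bc_coact m in hp_act h1 n ⊗ (h2 ⋅ a).
Proof.
have := bicov_covariant hM (autV h) (autV m) (hone H).
rewrite aut_hone (ract1 (lcov_rmodule hL)) (aut_lact (lcov_lmodule hL)).
rewrite (hmod_autVK hM0) hautVK => ->.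
rewrite Delta_hone rcoact_autV; tpure.
tind (bc_coact m) n a; tind (Delta h) g1 g2; tpure.
by rewrite !(lcov_rules hL).
Qed.

End BicovRules.

(** * The covariant bimodule structure of a tensor product over H *)

Section TensorH.
Variables (k : comPzRingType) (H : monHomHopf k).
Variables (M N : lcov_data H) (hM : is_lcov M) (hN : is_lcov N).
Local Notation "m ⊗H n" := (@pureH k H _ _ m n) (at level 45, no associativity).
Local Notation MN := (lcov_tens M N).
Implicit Types (m : M) (n : N) (h : H).

Let hMH := is_lcov_hopf hM.
Let hNH := is_lcov_hopf hN.
Let hM0 := lcov_hmod hM.
Let hN0 := lcov_hmod hN.

Lemma bal_aut : balanced (fun m n => aut m ⊗H aut n).
Proof.
split=> [|m h n]; first by lin.
by rewrite (aut_ract (lcov_rmodule hM)) pureH_bal (aut_lact (lcov_lmodule hN))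
  (hmod_autK hN0) (hmod_autVK hN0).
Qed.

Lemma bal_autV : balanced (fun m n => autV m ⊗H autV n).
Proof.
split=> [|m h n]; first by lin.
by rewrite (autV_lract hM) pureH_bal (hmod_autVK hM0) (hmod_autK hM0) (autV_lact hNH).
Qed.

Lemma bal_lact h : balanced (fun m n => hp_act (autV h) m ⊗H aut n).
Proof.
split=> [|m g n]; first by lin.
rewrite -[autV h]hautVK -(lcov_bimodule hM) pureH_bal.
by rewrite !(lcov_rules hM, lcov_rules hN).
Qed.

Lemma bal_ract h : balanced (fun m n => aut m ⊗H lc_act n (autV h)).
Proof.
split=> [|m g n]; first by lin.
rewrite (aut_ract (lcov_rmodule hM)) pureH_bal.
by rewrite !(lcov_rules hN).
Qed.

(** The coproduct of [g] splits on both sides: g_1 passes between the coefficients in [H] by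
    Hom-associativity, g_2 passes across [⊗H] by the defining relation. *)
Lemma bal_coact : balanced (fun m n => slet a ⊗ m0 := hp_coact m in
  slet b ⊗ n0 := hp_coact n in (a ⋅ b) ⊗ (m0 ⊗H n0)).
Proof.
split=> [|m g n]; first by lin.
rewrite (coact_ract hM) (hopf_compatible hNH) (coact_aut hMH) (coact_autV hNH).
tind (hp_coact m) a m0; tind (hp_coact n) b n0; tind (Delta g) g1 g2; tpure.
by rewrite pureH_bal !hrules.
Qed.

Hint Resolve bal_aut bal_autV bal_lact bal_ract bal_coact : lin lin_conv.

Lemma tensH_autE m n : @aut k MN (m ⊗H n) = aut m ⊗H aut n.
Proof. exact: tliftH_pure bal_aut. Qed.
Lemma tensH_autVE m n : @autV k MN (m ⊗H n) = autV m ⊗H autV n.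
Proof. exact: tliftH_pure bal_autV. Qed.
Lemma tensH_lactE h m n : @hp_act k H MN h (m ⊗H n) = hp_act (autV h) m ⊗H aut n.
Proof. exact: tliftH_pure (bal_lact h). Qed.
Lemma tensH_ractE h m n : @lc_act k H MN (m ⊗H n) h = aut m ⊗H lc_act n (autV h).
Proof. exact: tliftH_pure (bal_ract h). Qed.
Lemma tensH_coactE m n : @hp_coact k H MN (m ⊗H n)
  = slet a ⊗ m0 := hp_coact m in slet b ⊗ n0 := hp_coact n in (a ⋅ b) ⊗ (m0 ⊗H n0).
Proof. exact: tliftH_pure bal_coact. Qed.

Definition tensH_rules := (tensH_autE, tensH_autVE, tensH_lactE, tensH_ractE).

Let laut : klinear (@aut k MN). Proof. exact: tliftH_klin bal_aut. Qed.
Let lautV : klinear (@autV k MN). Proof. exact: tliftH_klin bal_autV. Qed.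
Let llactr h : klinear (@hp_act k H MN h). Proof. exact: tliftH_klin (bal_lact h). Qed.
Let llactl x : klinear (fun h => @hp_act k H MN h x).
Proof. by rewrite /=; lin. Qed.
Let lractl h : klinear (fun x => @lc_act k H MN x h).
Proof. exact: tliftH_klin (bal_ract h). Qed.
Let lractr x : klinear (@lc_act k H MN x).
Proof. by rewrite /=; lin. Qed.
Let lcoact : klinear (@hp_coact k H MN). Proof. exact: tliftH_klin bal_coact. Qed.

Lemma tensH_hmod : is_hmod MN.
Proof.
split; first exact: laut.
  by move=> x; tindH x m n; rewrite !tensH_rules !(hmod_autK hM0, hmod_autK hN0).
by move=> x; tindH x m n; rewrite !tensH_rules !(hmod_autVK hM0, hmod_autVK hN0).
Qed.

Lemma tensH_hopf : is_hopf MN.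
Proof.
split; first exact: tensH_hmod.
- split; first exact: bilinP.
  + move=> h x; tindH x m n; rewrite !tensH_rules.
    by rewrite !(lcov_rules hM).
  + move=> g h x; tindH x m n; rewrite !tensH_rules.
    by rewrite !(lcov_rules hM).
  + move=> x; tindH x m n; rewrite !tensH_rules.
    by rewrite !(lcov_rules hM).
- split; first exact: lcoact.
  + move=> x; tindH x m n; rewrite !tensH_rules !tensH_coactE.
    rewrite (coact_aut hMH) (coact_aut hNH).
    tind (hp_coact m) a m0; tind (hp_coact n) b n0; tpure.
    by rewrite !hrules !tensH_rules.
  + move=> x; tindH x m n; rewrite !tensH_coactE.
    snl ltac:(rewrite ?Delta_hmul ?tensH_rules); snr ltac:(rewrite ?tensH_coactE).
    foldl (@Delta k H) (hp_coact m); foldr (@hp_coact k H M) (hp_coact m).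
    rewrite (coact_coassoc hMH).
    tind (tmap id (@hp_coact k H M) (hp_coact m)) a y; tind y b m0; tpure.
    foldl (@Delta k H) (hp_coact n); foldr (@hp_coact k H N) (hp_coact n).
    rewrite (coact_coassoc hNH).
    tind (tmap id (@hp_coact k H N) (hp_coact n)) c y; tind y d n0; tpure.
    by rewrite !hrules (hmod_autK hM0) (hmod_autK hN0).
  + move=> x; tindH x m n; rewrite !tensH_rules !tensH_coactE.
    rewrite -(lcoact_eps (lcov_lcomodule hM)) -(lcoact_eps (lcov_lcomodule hN)).
    tind (hp_coact m) a m0; tind (hp_coact n) b n0; tpure.
    rewrite eps_hmul -scalerA (linZ (pureH_linl _)) (linZ (pureH_linr _)).
    by [].
- move=> h x; tindH x m n; rewrite !tensH_rules !tensH_coactE.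
  rewrite (hopf_compatible hMH) (coact_aut hNH) Delta_autV.
  tind (hp_coact m) a m0; tind (hp_coact n) b n0; tind (Delta h) h1 h2; tpure.
  by rewrite !tensH_rules !hrules.
Qed.

Lemma tensH_valid : is_lcov MN.
Proof.
have hT := tensH_hopf; have hT0 := hopf_hmod hT.
have rm : is_rmodule (@lc_act k H MN).
  split; first exact: bilinP.
  - by move=> x h; tindH x m n; rewrite !tensH_rules !(lcov_rules hM, lcov_rules hN).
  - by move=> x g h; tindH x m n; rewrite !tensH_rules !(lcov_rules hM, lcov_rules hN).
  - by move=> x; tindH x m n; rewrite !tensH_rules !(lcov_rules hM, lcov_rules hN).
have bm : bimodule_compat (@hp_act k H MN) (@lc_act k H MN).
  by move=> g x h; tindH x m n; rewrite !tensH_rules !(lcov_rules hM, lcov_rules hN).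
split=> //; [exact: hopf_lmodule|exact: hopf_lcomodule|].
apply: lcovariantP => // x h; tindH x m n; rewrite !tensH_rules !tensH_coactE.
rewrite (coact_aut hMH) (coact_ract hN) Delta_autV.
tind (hp_coact m) a m0; tind (hp_coact n) b n0; tind (Delta h) h1 h2; tpure.
by rewrite !tensH_rules !hrules.
Qed.

End TensorH.

#[export] Hint Resolve bal_aut bal_autV bal_lact bal_ract bal_coact tensH_valid : lin lin_conv.

Section TensorHMaps.
Variables (k : comPzRingType) (H : monHomHopf k).
Implicit Types M N P : lcov_data H.
Local Notation "m ⊗H n" := (@pureH k H _ _ m n) (at level 45, no associativity).

Lemma lcov_reflects_iso : reflects_iso (LCov H).
Proof.
move=> A B f g hA hB [hf lf] K VK; split.
  exact: hopf_reflects_iso (is_lcov_hopf hA) (is_lcov_hopf hB) hf K VK.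
by move=> m h; apply: (can_inj K); rewrite VK lf VK.
Qed.

Lemma lcov_mor_klin M N (f : M -> N) : is_lcov_mor f -> klinear f.
Proof. by move=> [[[lf _] _ _] _]; exact: lf. Qed.

Lemma lcov_mor_aut M N (f : M -> N) m : is_lcov_mor f -> f (aut m) = aut (f m).
Proof. by move=> [[[_ fa] _ _] _]; exact: fa. Qed.

Lemma lcov_mor_autV M N (f : M -> N) m : is_lcov M -> is_lcov N ->
  is_lcov_mor f -> f (autV m) = autV (f m).
Proof. by move=> hM hN [[hf _ _] _]; exact: hmor_autV (lcov_hmod hM) (lcov_hmod hN) hf. Qed.

Lemma lcov_mor_coact M N (f : M -> N) m : is_lcov_mor f ->
  hp_coact (f m) = tmap id f (hp_coact m).
Proof. by move=> [[_ _ cf] _]; exact: cf. Qed.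

Lemma bal_map M M' N N' (f : M -> M') (g : N -> N') :
  is_lcov M -> is_lcov M' -> is_lcov N -> is_lcov N' -> is_lcov_mor f -> is_lcov_mor g ->
  balanced (fun m n => f m ⊗H g n).
Proof.
move=> hM hM' hN hN' hf hg.
have lf := lcov_mor_klin hf; have lg := lcov_mor_klin hg.
split=> [|m h n]; first by lin.
rewrite (lcov_rlinear hf) pureH_bal (lcov_mor_aut _ hf).
by rewrite (hopf_llinear (lcov_hopf_mor hg)) (lcov_mor_autV _ hN hN' hg).
Qed.

Lemma tensorH_mapE M M' N N' (f : M -> M') (g : N -> N') m n :
  is_lcov M -> is_lcov M' -> is_lcov N -> is_lcov N' -> is_lcov_mor f -> is_lcov_mor g ->
  tensorH_map f g (m ⊗H n) = f m ⊗H g n.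
Proof. by move=> *; apply: (@tliftH_pure _ _ _ _ _ (fun m n => f m ⊗H g n)); exact: bal_map. Qed.

Lemma tensorH_map_klin M M' N N' (f : M -> M') (g : N -> N') :
  is_lcov M -> is_lcov M' -> is_lcov N -> is_lcov N' -> is_lcov_mor f -> is_lcov_mor g ->
  @klinear k (tensorH M N) (tensorH M' N') (tensorH_map f g).
Proof. by move=> *; apply: tliftH_klin; exact: bal_map. Qed.

Lemma tensorH_map_mor M M' N N' (f : M -> M') (g : N -> N') :
  is_lcov M -> is_lcov M' -> is_lcov N -> is_lcov N' -> is_lcov_mor f -> is_lcov_mor g ->
  @is_lcov_mor k H (lcov_tens M N) (lcov_tens M' N') (tensorH_map f g).
Proof.
move=> hM hM' hN hN' hf hg.
have l : klinear (tensorH_map f g : tensorH M N -> tensorH M' N').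
  exact: tensorH_map_klin.
have lf := lcov_mor_klin hf; have lg := lcov_mor_klin hg.
have hT := tensH_valid hM hN; have hT' := tensH_valid hM' hN'.
have E m n : tensorH_map f g (m ⊗H n) = f m ⊗H g n by exact: tensorH_mapE.
split; first split; first split; first exact: l.
- move=> x; tindH x m n.
  by rewrite tensH_autE // !E tensH_autE // !lcov_mor_aut.
- move=> h x; tindH x m n.
  rewrite tensH_lactE // !E tensH_lactE // (hopf_llinear (lcov_hopf_mor hf)).
  by rewrite lcov_mor_aut.
- move=> x; tindH x m n.
  rewrite E !tensH_coactE // !lcov_mor_coact //.
  tind (hp_coact m) a m0; tind (hp_coact n) b n0; tpure.
  by rewrite E.
- move=> x h; tindH x m n.
  by rewrite tensH_ractE // !E tensH_ractE // lcov_mor_aut // (lcov_rlinear hg).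
Qed.

Section Assoc.
Variables M N P : lcov_data H.
Hypotheses (hM : is_lcov M) (hN : is_lcov N) (hP : is_lcov P).
Local Notation NP := (lcov_tens N P).
Local Notation MN := (lcov_tens M N).

Let hMN : is_lcov MN. Proof. exact: tensH_valid. Qed.
Let hNP : is_lcov NP. Proof. exact: tensH_valid. Qed.

(** The associator descends in two stages, over [m ⊗H n] with [p] fixed and then over pairs. In the
    first stage [h] crosses to the left action on [n ⊗H autV p], which up to twists acts on [n]
    alone. *)
Lemma bal_assoc_in (p : P) :
  balanced (fun (m : M) (n : N) => @pureH k H M NP (aut m) (n ⊗H autV p)).
Proof.
split=> [|m h n].
  apply: bilinP => x; last by lin.
  apply: (@lin_app _ _ _ _ (@pureH k H M NP (aut x)) (fun n => n ⊗H autV p)).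
    exact: pureH_linr.
  by lin.
rewrite (aut_ract (lcov_rmodule hM)) pureH_bal.
by rewrite tensH_autVE // tensH_lactE // hautK (hmod_autVK (lcov_hmod hP)).
Qed.

Definition assoc_in (x : MN) (p : P) : tensorH M NP :=
  @tliftH k H M N _ (fun m n => @pureH k H M NP (aut m) (n ⊗H autV p)) x.

Lemma assoc_inE m n p :
  assoc_in (m ⊗H n) p = @pureH k H M NP (aut m) (n ⊗H autV p).
Proof. exact: tliftH_pure (bal_assoc_in p). Qed.

Lemma bal_assoc : balanced assoc_in.
Proof.
have l1 p : klinear (fun x : MN => assoc_in x p) by exact: tliftH_klin (bal_assoc_in p).
split=> [|x h p].
  apply: bilinP => // x; apply: lin_tliftH_fun => m n.
  apply: (@lin_app _ _ _ _ (@pureH k H M NP (aut m)) (fun p => n ⊗H autV p)).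
    exact: pureH_linr.
  by lin.
have l2 := lin_aut (lcov_hmod hMN); have l3 g := lcov_linl g hMN.
tindH x m n; rewrite tensH_ractE // tensH_autE // !assoc_inE pureH_bal.
by rewrite (autV_lact (is_lcov_hopf hP)).
Qed.

Lemma tensorH_assocE m n p :
  tensorH_assoc (@pureH k H MN P (m ⊗H n) p) = @pureH k H M NP (aut m) (n ⊗H autV p).
Proof. by rewrite -assoc_inE; exact: tliftH_pure bal_assoc. Qed.

Lemma tensorH_assoc_klin :
  @klinear k (tensorH MN P) (tensorH M NP) (@tensorH_assoc k H M N P).
Proof. exact: tliftH_klin bal_assoc. Qed.

Lemma tensorH_assoc_mor :
  @is_lcov_mor k H (lcov_tens MN P) (lcov_tens M NP) (@tensorH_assoc k H M N P).
Proof.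
have l := tensorH_assoc_klin.
have hT := tensH_valid hMN hP; have hT' := tensH_valid hM hNP.
split; first split; first split; first exact: l.
- move=> x; tindH x y p; tindH y m n.
  rewrite tensH_autE // tensH_autE // !tensorH_assocE tensH_autE // tensH_autE //.
  by rewrite (hmod_autK (lcov_hmod hP)) (hmod_autVK (lcov_hmod hP)).
- move=> h x; tindH x y p; tindH y m n.
  rewrite tensH_lactE // tensH_lactE // !tensorH_assocE tensH_lactE // tensH_autE //.
  by rewrite !(lcov_rules hM, lcov_rules hP).
- move=> x; tindH x y p; tindH y m n.
  rewrite tensorH_assocE !tensH_coactE //.
  rewrite (coact_aut (is_lcov_hopf hM)) (coact_autV (is_lcov_hopf hP)).
  tind (hp_coact m) a m0; tind (hp_coact n) b n0; tind (hp_coact p) c p0; tpure.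
  by rewrite tensorH_assocE !hrules.
- move=> x h; tindH x y p; tindH y m n.
  rewrite tensH_ractE // tensH_autE // !tensorH_assocE tensH_ractE // tensH_ractE //.
  by rewrite !(lcov_rules hP).
Qed.

Lemma bal_assocV_in (m : M) :
  balanced (fun (n : N) (p : P) => @pureH k H MN P (autV m ⊗H n) (aut p)).
Proof.
split=> [|n h p].
  apply: bilinP => x; first by lin.
  apply: (@lin_app _ _ _ _ (fun y => @pureH k H MN P y (aut x)) (fun n => autV m ⊗H n)).
    exact: pureH_linl.
  by lin.
(* The inner tensor is recognised as a right action on the whole of [MN], so that the relation of
   the outer tensor product can move [h] to [p]. *)
have -> : autV m ⊗H lc_act n h = @lc_act k H MN (autV (autV m) ⊗H n) (aut h).
  by rewrite tensH_ractE // hautK (hmod_autVK (lcov_hmod hM)).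
rewrite (@pureH_bal k H MN P) tensH_autE // (hmod_autVK (lcov_hmod hM)).
by rewrite !(lcov_rules hP).
Qed.

Definition assocV_in (m : M) (y : NP) : tensorH MN P :=
  @tliftH k H N P _ (fun n p => @pureH k H MN P (autV m ⊗H n) (aut p)) y.

Lemma assocV_inE m n p :
  assocV_in m (n ⊗H p) = @pureH k H MN P (autV m ⊗H n) (aut p).
Proof. exact: tliftH_pure (bal_assocV_in m). Qed.

Lemma bal_assocV : balanced assocV_in.
Proof.
have l1 m : klinear (assocV_in m) by exact: tliftH_klin (bal_assocV_in m).
split=> [|m h y].
  apply: bilinP => // y; apply: lin_tliftH_fun => n p.
  apply: (@lin_app _ _ _ _ (fun z => @pureH k H MN P z (aut p)) (fun m => autV m ⊗H n)).
    exact: pureH_linl.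
  by lin.
have l2 := lin_autV (lcov_hmod hNP); have l3 g := hopf_linr g (is_lcov_hopf hNP).
tindH y n p; rewrite tensH_autVE // tensH_lactE // !assocV_inE.
rewrite (autV_lract hM) pureH_bal !(lcov_rules hM, lcov_rules hN, lcov_rules hP).
by [].
Qed.

Lemma tensorH_assoc_bij : bijective (@tensorH_assoc k H M N P).
Proof.
have l := tensorH_assoc_klin; have b := bal_assocV.
have E m n p : tliftH assocV_in (@pureH k H M NP m (n ⊗H p))
    = @pureH k H MN P (autV m ⊗H n) (aut p).
  by rewrite -assocV_inE; exact: tliftH_pure bal_assocV.
exists (tliftH assocV_in : tensorH M NP -> tensorH MN P) => x.
  tindH x y p; tindH y m n; rewrite tensorH_assocE E.
  by rewrite (hmod_autK (lcov_hmod hM)) (hmod_autVK (lcov_hmod hP)).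
tindH x m y; tindH y n p; rewrite E tensorH_assocE.
by rewrite (hmod_autVK (lcov_hmod hM)) (hmod_autK (lcov_hmod hP)).
Qed.

End Assoc.

End TensorHMaps.

(** * The unit constraints of the tensor product over H *)

Section TensorHUnit.
Variables (k : comPzRingType) (H : monHomHopf k).
Implicit Types M N P : lcov_data H.
Local Notation "m ⊗H n" := (@pureH k H _ _ m n) (at level 45, no associativity).

Lemma lcov_unit_valid : is_lcov (lcov_unit H).
Proof.
have hu : is_hmod (lcov_unit H) := hb_hmod H.
have co (c : H) : (slet h ⊗ n := Delta c in Delta h ⊗ autV n)
    = (slet h ⊗ n := Delta c in slet g ⊗ p := Delta n in (autV h ⊗ g) ⊗ p).
  foldl (@Delta k H) (Delta c); foldr (@Delta k H) (Delta c).
  rewrite Delta_coassoc.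
  by tind (tmap id (@Delta k H) (Delta c)) a y; tind y b d; tpure; rewrite !hrules.
have lc : @is_lcomodule k H (lcov_unit H) (@Delta k H).
  by split; [exact: Delta_klin|exact: Delta_tmap|exact: co|exact: eps_counitl].
have lm : @is_lmodule k H (lcov_unit H) (fun h g => h ⋅ g).
  by split; [exact: hmul_bilin|exact: aut_hmul|exact: hmulA|exact: hmul1l].
have rm : @is_rmodule k H (lcov_unit H) (fun g h => g ⋅ h).
  by split; [exact: hmul_bilin|exact: aut_hmul|move=> *; rewrite -hmulA|exact: hmul1].
have hh : is_hopf (lcov_unit H) by split=> // h m; exact: Delta_hmul.
have bm : @bimodule_compat k H (lcov_unit H) (fun h g => h ⋅ g) (fun g h => g ⋅ h).
  by move=> g m h; rewrite -hmulA.
by split=> //; apply: lcovariantP => // m h; exact: Delta_hmul.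
Qed.

Variables (M : lcov_data H).
Hypothesis hM : is_lcov M.
Let hu := lcov_unit_valid.

Lemma bal_lun : balanced (fun (h : lcov_unit H) (m : M) => hp_act (h : H) m).
Proof.
split=> [|a h m]; first by exact: lact_bilin (lcov_lmodule hM).
by rewrite /= !(lcov_rules hM).
Qed.

Lemma bal_run : balanced (fun (m : M) (h : lcov_unit H) => lc_act m (h : H)).
Proof.
split=> [|m a h]; first by exact: ract_bilin (lcov_rmodule hM).
by rewrite /= !(lcov_rules hM).
Qed.

Lemma tensorH_lunE (h : lcov_unit H) (m : M) : tensorH_lun (h ⊗H m) = hp_act (h : H) m.
Proof. exact: tliftH_pure bal_lun. Qed.

Lemma tensorH_runE (m : M) (h : lcov_unit H) : tensorH_run (m ⊗H h) = lc_act m (h : H).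
Proof. exact: tliftH_pure bal_run. Qed.

Lemma tensorH_lun_klin : @klinear k (tensorH (lcov_unit H) M) M (@tensorH_lun k H M).
Proof. exact: tliftH_klin bal_lun. Qed.

Lemma tensorH_run_klin : @klinear k (tensorH M (lcov_unit H)) M (@tensorH_run k H M).
Proof. exact: tliftH_klin bal_run. Qed.

Lemma tensorH_lun_mor :
  @is_lcov_mor k H (lcov_tens (lcov_unit H) M) M (@tensorH_lun k H M).
Proof.
have l := tensorH_lun_klin; have hT := tensH_valid hu hM.
split; first split; first split; first exact: l.
- by move=> x; tindH x h m; rewrite tensH_autE // !tensorH_lunE (aut_lact (lcov_lmodule hM)).
- move=> g x; tindH x h m; rewrite tensH_lactE // !tensorH_lunE /=.
  by rewrite !(lcov_rules hM).
- move=> x; tindH x h m; rewrite tensorH_lunE tensH_coactE //.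
  rewrite (hopf_compatible (is_lcov_hopf hM)) [@hp_coact _ _ (lcov_unit H) h]/=.
  tind (Delta (h : H)) h1 h2; tind (hp_coact m) a m0; tpure.
  by rewrite tensorH_lunE.
- move=> x g; tindH x h m; rewrite tensH_ractE // !tensorH_lunE.
  by rewrite !(lcov_rules hM).
Qed.

Lemma tensorH_run_mor :
  @is_lcov_mor k H (lcov_tens M (lcov_unit H)) M (@tensorH_run k H M).
Proof.
have l := tensorH_run_klin; have hT := tensH_valid hM hu.
split; first split; first split; first exact: l.
- by move=> x; tindH x m h; rewrite tensH_autE // !tensorH_runE (aut_ract (lcov_rmodule hM)).
- move=> g x; tindH x m h; rewrite tensH_lactE // !tensorH_runE /=.
  by rewrite !(lcov_rules hM).
- move=> x; tindH x m h; rewrite tensorH_runE tensH_coactE //.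
  rewrite (coact_ract hM) [@hp_coact _ _ (lcov_unit H) h]/=.
  tind (Delta (h : H)) h1 h2; tind (hp_coact m) a m0; tpure.
  by rewrite tensorH_runE.
- move=> x g; tindH x m h; rewrite tensH_ractE // !tensorH_runE /=.
  by rewrite !(lcov_rules hM).
Qed.

Lemma tensorH_lun_bij : bijective (@tensorH_lun k H M).
Proof.
have l := tensorH_lun_klin.
exists (fun m => (hone H : lcov_unit H) ⊗H autV m) => x; last first.
  by rewrite tensorH_lunE !(lcov_rules hM).
tindH x h m; rewrite tensorH_lunE !(lcov_rules hM).
(* [h] is the product of [hone H] and [autV h], so the relation moves it entirely to the second
   factor. *)
have := @pureH_bal k H (lcov_unit H) M (hone H) (autV h) m.
by rewrite /= !hrules => <-.
Qed.

Lemma tensorH_run_bij : bijective (@tensorH_run k H M).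
Proof.
have l := tensorH_run_klin.
exists (fun m => autV m ⊗H (hone H : lcov_unit H)) => x; last first.
  by rewrite tensorH_runE !(lcov_rules hM).
tindH x m h; rewrite tensorH_runE (autV_lract hM).
by rewrite (@pureH_bal k H M (lcov_unit H)) /= !(lcov_rules hM).
Qed.

End TensorHUnit.

#[export] Hint Resolve lcov_unit_valid : lin lin_conv.

Section LCovLaws.
Variables (k : comPzRingType) (H : monHomHopf k).
Implicit Types M N P : lcov_data H.
Local Notation "m ⊗H n" := (@pureH k H _ _ m n) (at level 45, no associativity).

Lemma lcov_tensor_laws : tensor_laws (LCov_tensor H).
Proof.
have idm M := is_lcov_mor_id M.
split=> /=.
- by move=> M N hM hN; exact: tensH_valid.
- by move=> M M' N N' f g *; exact: tensorH_map_mor.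
- exact: lcov_unit_valid.
- by move=> M N P *; exact: tensorH_assoc_mor.
- by move=> M hM; exact: tensorH_lun_mor.
- by move=> M hM; exact: tensorH_run_mor.
- move=> M N hM hN x.
  have l := tensorH_map_klin hM hM hN hN (idm M) (idm N).
  by tindH (x : tensorH M N) m n; rewrite tensorH_mapE.
- move=> M M' M'' N N' N'' f' f g' g hM hM' hM'' hN hN' hN'' hf' hf hg' hg x /=.
  have hff := is_lcov_mor_comp hf' hf; have hgg := is_lcov_mor_comp hg' hg.
  have l1 := tensorH_map_klin hM hM'' hN hN'' hff hgg.
  have l2 := tensorH_map_klin hM hM' hN hN' hf hg.
  have l3 := tensorH_map_klin hM' hM'' hN' hN'' hf' hg'.
  by tindH (x : tensorH M N) m n; rewrite !tensorH_mapE.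
- move=> M M' N N' P P' f g h hM hM' hN hN' hP hP' hf hg hh x /=.
  have hfg := tensorH_map_mor hM hM' hN hN' hf hg.
  have hgh := tensorH_map_mor hN hN' hP hP' hg hh.
  have hMN := tensH_valid hM hN; have hMN' := tensH_valid hM' hN'.
  have hNP := tensH_valid hN hP; have hNP' := tensH_valid hN' hP'.
  have l1 := tensorH_map_klin hMN hMN' hP hP' hfg hh.
  have l2 := tensorH_map_klin hM hM' hNP hNP' hf hgh.
  have l3 := tensorH_assoc_klin hM hN hP; have l4 := tensorH_assoc_klin hM' hN' hP'.
  have l5 := tensorH_map_klin hM hM' hN hN' hf hg.
  tindH (x : tensorH (lcov_tens M N) P) y p; tindH y m n.
  rewrite !tensorH_mapE // !tensorH_assocE // !tensorH_mapE //.
  by rewrite (lcov_mor_aut _ hf) (lcov_mor_autV _ hP hP' hh).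
- move=> M M' f hM hM' hf x /=; have hu := lcov_unit_valid H.
  have l1 := tensorH_map_klin hu hu hM hM' (idm _) hf; have l2 := lcov_mor_klin hf.
  have l3 := tensorH_lun_klin hM; have l4 := tensorH_lun_klin hM'.
  tindH (x : tensorH (lcov_unit H) M) h m; rewrite tensorH_mapE // !tensorH_lunE //.
  by rewrite (hopf_llinear (lcov_hopf_mor hf)).
- move=> M M' f hM hM' hf x /=; have hu := lcov_unit_valid H.
  have l1 := tensorH_map_klin hM hM' hu hu hf (idm _); have l2 := lcov_mor_klin hf.
  have l3 := tensorH_run_klin hM; have l4 := tensorH_run_klin hM'.
  tindH (x : tensorH M (lcov_unit H)) m h; rewrite tensorH_mapE // !tensorH_runE //.
  by rewrite (lcov_rlinear hf).
- by move=> M N P *; exact: tensorH_assoc_bij.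
- by move=> M hM; exact: tensorH_lun_bij.
- by move=> M hM; exact: tensorH_run_bij.
- move=> M N P Q hM hN hP hQ x /=.
  have hMN := tensH_valid hM hN; have hNP := tensH_valid hN hP.
  have hPQ := tensH_valid hP hQ.
  have hMNP := tensH_valid hMN hP; have hMNP' := tensH_valid hM hNP.
  have hNPQ := tensH_valid hNP hQ; have hNPQ' := tensH_valid hN hPQ.
  have a1 := tensorH_assoc_mor hM hN hP; have a2 := tensorH_assoc_mor hN hP hQ.
  have l1 := tensorH_map_klin hMNP hMNP' hQ hQ a1 (idm Q).
  have l2 := tensorH_assoc_klin hM hNP hQ.
  have l3 := tensorH_map_klin hM hM hNPQ hNPQ' (idm M) a2.
  have l4 := tensorH_assoc_klin hMN hP hQ.
  have l5 := tensorH_assoc_klin hM hN hPQ.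
  tindH (x : tensorH (lcov_tens (lcov_tens M N) P) Q) y q; tindH y z p; tindH z m n.
  rewrite tensorH_mapE // !tensorH_assocE // tensorH_mapE // tensorH_assocE //.
  by rewrite tensH_autE // tensorH_assocE // tensH_autVE.
- move=> M N hM hN x /=; have hu := lcov_unit_valid H.
  have hMu := tensH_valid hM hu; have huN := tensH_valid hu hN.
  have r1 := tensorH_run_mor hM; have r2 := tensorH_lun_mor hN.
  have l1 := tensorH_map_klin hMu hM hN hN r1 (idm N).
  have l2 := tensorH_map_klin hM hM huN hN (idm M) r2.
  have l3 := tensorH_assoc_klin hM hu hN.
  tindH (x : tensorH (lcov_tens M (lcov_unit H)) N) y n; tindH y m h.
  rewrite tensorH_assocE // !tensorH_mapE // tensorH_lunE // tensorH_runE //.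
  (* On pure tensors the triangle is the defining relation of [⊗H]. *)
  by rewrite -pureH_bal.
Qed.

End LCovLaws.

(** * Tensor products of bicovariant bimodules *)

Section BicovTensor.
Variables (k : comPzRingType) (H : monHomHopf k).
Implicit Types M N P : bicov_data H.
Local Notation "m ⊗H n" := (@pureH k H _ _ m n) (at level 45, no associativity).

Lemma rcoact_coassoc' M (m : M) : is_bicov M ->
  tmap id (@Delta k H) (bc_coact m)
  = slet y ⊗ h := tmap (@bc_coact k H M) id (bc_coact m) in
    slet p ⊗ g := y in aut p ⊗ (g ⊗ autV h).
Proof.
by move=> hM; apply: rcoact_coassoc (bicov_rcomodule hM); case: (bicov_is_lcov hM).
Qed.

Lemma bicov_coassoc M (m : M) : is_bicov M ->
  tmap (@hp_coact k H M) id (bc_coact m)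
  = slet a ⊗ y := tmap id (@bc_coact k H M) (hp_coact m) in
    slet n ⊗ h := y in (autV a ⊗ n) ⊗ aut h.
Proof.
move=> hM; have hL := bicov_is_lcov hM.
apply: bicoact_coassoc (lcov_hmod hL) _ _ (bicov_bicomodule hM).
  exact: hopf_colin (is_lcov_hopf hL).
exact: bicov_colin.
Qed.

Section Pair.
Variables M N : bicov_data H.
Hypotheses (hM : is_bicov M) (hN : is_bicov N).
Local Notation MN := (bicov_tens M N).

Let hLM := bicov_is_lcov hM.
Let hLN := bicov_is_lcov hN.

Lemma bal_rcoact : balanced (fun (m : M) (n : N) =>
  slet m0 ⊗ m1 := bc_coact m in slet n0 ⊗ n1 := bc_coact n in
    (m0 ⊗H n0) ⊗ (m1 ⋅ n1)).
Proof.
split=> [|m g n]; first by lin.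
rewrite (rcoact_ract hM) (rcoact_lact hN) (rcoact_autE hM) (rcoact_autV hN).
tind (bc_coact m) m0 m1; tind (bc_coact n) n0 n1; tind (Delta g) g1 g2; tpure.
by rewrite pureH_bal !hrules.
Qed.

Lemma tensH_rcoactE (m : M) (n : N) : @bc_coact k H MN (m ⊗H n)
  = slet m0 ⊗ m1 := bc_coact m in slet n0 ⊗ n1 := bc_coact n in
    (m0 ⊗H n0) ⊗ (m1 ⋅ n1).
Proof. exact: tliftH_pure bal_rcoact. Qed.

Let hT : is_lcov (lcov_tens M N) := tensH_valid hLM hLN.

Let lr : klinear (@bc_coact k H MN). Proof. exact: tliftH_klin bal_rcoact. Qed.

Let TE := tensH_rules hLM hLN.

Lemma bicov_tens_rcomodule : is_rcomodule (@bc_coact k H MN).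
Proof.
have hT0 := lcov_hmod hT.
split; first exact: lr.
- move=> x; tindH (x : tensorH M N) m n; rewrite !TE !tensH_rcoactE.
  rewrite (rcoact_autE hM) (rcoact_autE hN).
  tind (bc_coact m) m0 m1; tind (bc_coact n) n0 n1; tpure.
  by rewrite !hrules !TE.
- move=> x; tindH (x : tensorH M N) m n; rewrite !tensH_rcoactE.
  snl ltac:(rewrite ?Delta_hmul ?TE); snr ltac:(rewrite ?tensH_rcoactE).
  foldr (@Delta k H) (bc_coact m); foldl (@bc_coact k H M) (bc_coact m).
  rewrite rcoact_coassoc' //.
  tind (tmap (@bc_coact k H M) id (bc_coact m)) y m2; tind y m0 m1; tpure.
  foldr (@Delta k H) (bc_coact n); foldl (@bc_coact k H N) (bc_coact n).
  rewrite rcoact_coassoc' //.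
  tind (tmap (@bc_coact k H N) id (bc_coact n)) y n2; tind y n0 n1; tpure.
  by rewrite !hrules (hmod_autK (lcov_hmod hLM)) (hmod_autK (lcov_hmod hLN)).
- move=> x; tindH (x : tensorH M N) m n; rewrite !TE !tensH_rcoactE.
  rewrite -(rcoact_eps (bicov_rcomodule hM)) -(rcoact_eps (bicov_rcomodule hN)).
  tind (bc_coact m) m0 m1; tind (bc_coact n) n0 n1; tpure.
  by rewrite eps_hmul -scalerA (linZ (pureH_linl _)) (linZ (pureH_linr _)).
Qed.

Lemma bicov_tens_valid : is_bicov MN.
Proof.
have hT' : is_lcov MN := hT.
split; [exact: hT|exact: bicov_tens_rcomodule| |].
- apply: rcovariantP => [||x h|x h]; [exact: hT|exact: bicov_tens_rcomodule| |].
  + tindH x m n; rewrite !TE !tensH_rcoactE.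
    rewrite (rcoact_autE hM) (rcoact_ract hN) Delta_autV.
    tind (bc_coact m) m0 m1; tind (bc_coact n) n0 n1; tind (Delta h) h1 h2; tpure.
    by rewrite !TE !hrules.
  + tindH x m n; rewrite !TE !tensH_rcoactE.
    rewrite (rcoact_lact hM) (rcoact_autE hN) Delta_autV.
    tind (bc_coact m) m0 m1; tind (bc_coact n) n0 n1; tind (Delta h) h1 h2; tpure.
    by rewrite !TE !hrules.
- move=> x; have lc := hopf_colin (is_lcov_hopf hT).
  tindH x m n; rewrite (tensH_coactE hLM hLN) tensH_rcoactE.
  (* Both sides become sums over one iterated coaction per factor; [bicov_coassoc] then exchanges
     the left and right coactions in [M] and in [N] separately. *)
  snl ltac:(rewrite ?tensH_rcoactE); snr ltac:(rewrite ?(tensH_coactE hLM hLN)).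
  foldr (@bc_coact k H M) (hp_coact m); foldl (@hp_coact k H M) (bc_coact m).
  rewrite bicov_coassoc //.
  tind (tmap id (@bc_coact k H M) (hp_coact m)) a y; tind y m0 m1; tpure.
  foldr (@bc_coact k H N) (hp_coact n); foldl (@hp_coact k H N) (bc_coact n).
  rewrite bicov_coassoc //.
  tind (tmap id (@bc_coact k H N) (hp_coact n)) b y; tind y n0 n1; tpure.
  by rewrite !hrules.
Qed.

End Pair.

Lemma bicov_unit_valid : is_bicov (bicov_unit H).
Proof.
have hu := lcov_unit_valid H.
have hs : @is_rcomodule k H (lcov_unit H) (@Delta k H).
  have co (c : H) : (slet n ⊗ h := Delta c in autV n ⊗ Delta h)
    = (slet n ⊗ h := Delta c in slet p ⊗ g := Delta n in p ⊗ (g ⊗ autV h)).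
    foldr (@Delta k H) (Delta c); foldl (@Delta k H) (Delta c).
    rewrite Delta_coassoc.
    by tind (tmap id (@Delta k H) (Delta c)) a y; tind y b d; tpure; rewrite !hrules.
  by split; [exact: Delta_klin|exact: Delta_tmap|exact: co|exact: eps_counitr].
have bc : @bicomodule_compat k H (lcov_unit H) (@Delta k H) (@Delta k H).
  have co (c : H) : (slet a ⊗ n := Delta c in a ⊗ Delta n)
    = (slet n ⊗ h := Delta c in slet a ⊗ p := Delta n in aut a ⊗ (p ⊗ autV h)).
    foldl (@Delta k H) (Delta c); foldr (@Delta k H) (Delta c).
    rewrite Delta_coassoc.
    by tind (tmap id (@Delta k H) (Delta c)) a y; tind y b d; tpure; rewrite !hrules.
  exact: co.
split=> //; apply: rcovariantP => // m h; exact: Delta_hmul.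
Qed.

Lemma bicov_reflects_iso : reflects_iso (Bicov H).
Proof.
move=> A B f g hA hB [hf cf] K VK.
have hg := lcov_reflects_iso (bicov_is_lcov hA) (bicov_is_lcov hB) hf K VK.
have lf := lcov_mor_klin hf; have lg := lcov_mor_klin hg.
split=> // m; rewrite -{2}(VK m) cf -/(tmap f id _) -/(tmap g id _) tmap_comp //.
by rewrite (_ : g \o f = id) ?tmap_id //; apply/funext.
Qed.

Lemma bicov_map_mor M M' N N' (f : M -> M') (g : N -> N') :
  is_bicov M -> is_bicov M' -> is_bicov N -> is_bicov N' ->
  is_bicov_mor f -> is_bicov_mor g ->
  @is_bicov_mor k H (bicov_tens M N) (bicov_tens M' N') (tensorH_map f g).
Proof.
move=> hM hM' hN hN' [hf cf] [hg cg].
have hLM := bicov_is_lcov hM; have hLM' := bicov_is_lcov hM'.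
have hLN := bicov_is_lcov hN; have hLN' := bicov_is_lcov hN'.
have lf := lcov_mor_klin hf; have lg := lcov_mor_klin hg.
have l := tensorH_map_klin hLM hLM' hLN hLN' hf hg.
have hT := bicov_tens_valid hM hN; have hT' := bicov_tens_valid hM' hN'.
split=> [|x]; first exact: tensorH_map_mor.
tindH x m n.
rewrite tensorH_mapE // !tensH_rcoactE // cf cg.
tind (bc_coact m) m0 m1; tind (bc_coact n) n0 n1; tpure.
by rewrite tensorH_mapE.
Qed.

Lemma bicov_assoc_mor M N P : is_bicov M -> is_bicov N -> is_bicov P ->
  @is_bicov_mor k H (bicov_tens (bicov_tens M N) P) (bicov_tens M (bicov_tens N P))
    (@tensorH_assoc k H M N P).
Proof.
move=> hM hN hP.
have hLM := bicov_is_lcov hM; have hLN := bicov_is_lcov hN.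
have hLP := bicov_is_lcov hP.
have hMN := bicov_tens_valid hM hN; have hNP := bicov_tens_valid hN hP.
have hT := bicov_tens_valid hMN hP; have hT' := bicov_tens_valid hM hNP.
have l := tensorH_assoc_klin hLM hLN hLP.
split=> [|x]; first exact: tensorH_assoc_mor.
tindH x y p; tindH y m n.
rewrite tensorH_assocE //.
rewrite (@tensH_rcoactE M (bicov_tens N P)) // tensH_rcoactE //.
rewrite (@tensH_rcoactE (bicov_tens M N) P) // tensH_rcoactE //.
rewrite (rcoact_autE hM) (rcoact_autV hP).
tind (bc_coact m) m0 m1; tind (bc_coact n) n0 n1; tind (bc_coact p) p0 p1; tpure.
by rewrite tensorH_assocE // !hrules.
Qed.

Lemma bicov_lun_mor M : is_bicov M ->
  @is_bicov_mor k H (bicov_tens (bicov_unit H) M) M (@tensorH_lun k H M).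
Proof.
move=> hM; have hL := bicov_is_lcov hM; have hu := bicov_unit_valid.
have hT := bicov_tens_valid hu hM; have l := tensorH_lun_klin hL.
split=> [|x]; first exact: tensorH_lun_mor.
tindH x h m; rewrite tensorH_lunE //.
rewrite (@tensH_rcoactE (bicov_unit H) M) // (rcoact_lact hM).
rewrite [@bc_coact _ _ (bicov_unit H) h]/=.
tind (Delta (h : H)) h1 h2; tind (bc_coact m) m0 m1; tpure.
by rewrite tensorH_lunE.
Qed.

Lemma bicov_run_mor M : is_bicov M ->
  @is_bicov_mor k H (bicov_tens M (bicov_unit H)) M (@tensorH_run k H M).
Proof.
move=> hM; have hL := bicov_is_lcov hM; have hu := bicov_unit_valid.
have hT := bicov_tens_valid hM hu; have l := tensorH_run_klin hL.
split=> [|x]; first exact: tensorH_run_mor.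
tindH x m h; rewrite tensorH_runE //.
rewrite (@tensH_rcoactE M (bicov_unit H)) // (rcoact_ract hM).
rewrite [@bc_coact _ _ (bicov_unit H) h]/=.
tind (Delta (h : H)) h1 h2; tind (bc_coact m) m0 m1; tpure.
by rewrite tensorH_runE.
Qed.

(** As for Yetter-Drinfeld modules, the equations and bijections are inherited, here from
    [lcov_tensor_laws]. *)
Lemma bicov_tensor_laws : tensor_laws (Bicov_tensor H).
Proof.
have T := lcov_tensor_laws H.
have rm : forall M, is_bicov M -> is_lcov M by move=> M; exact: bicov_is_lcov.
split=> /=.
- by move=> M N hM hN; exact: bicov_tens_valid.
- by move=> A A' B B' f g *; exact: bicov_map_mor.
- exact: bicov_unit_valid.
- by move=> A B E *; exact: bicov_assoc_mor.
- by move=> A hA; exact: bicov_lun_mor.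
- by move=> A hA; exact: bicov_run_mor.
- by move=> A B /rm hA /rm hB; exact: (tl_id T).
- move=> A A' A'' B B' B'' f' f g' g /rm ? /rm ? /rm ? /rm ? /rm ? /rm ?.
  by move=> [? _] [? _] [? _] [? _]; exact: (tl_comp T).
- move=> A A' B B' E E' f g h /rm ? /rm ? /rm ? /rm ? /rm ? /rm ?.
  by move=> [? _] [? _] [? _]; exact: (tl_assoc_nat T).
- by move=> A A' f /rm ? /rm ? [? _]; exact: (tl_lun_nat T).
- by move=> A A' f /rm ? /rm ? [? _]; exact: (tl_run_nat T).
- by move=> A B E /rm ? /rm ? /rm ?; exact: (tl_assoc_bij T).
- by move=> A /rm ?; exact: (tl_lun_bij T).
- by move=> A /rm ?; exact: (tl_run_bij T).
- by move=> A B E D /rm ? /rm ? /rm ? /rm ?; exact: (tl_pentagon T).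
- by move=> A B /rm ? /rm ?; exact: (tl_triangle T).
Qed.

End BicovTensor.
#[export] Hint Resolve bicov_tens_valid bicov_unit_valid : lin lin_conv.

(** * Free covariant bimodules *)

Section FreeBimodule.
Variables (k : comPzRingType) (H : monHomHopf k) (V : rmod_data H) (hV : is_rmod V).

Let hV0 := rmod_hmod hV.
Let hF := F_hopf_valid H hV0.

Lemma F_lcov_ractE x g : @lc_act k H (F_lcov V) x g
  = slet h ⊗ v := x in slet g1 ⊗ g2 := Delta g in (h ⋅ g1) ⊗ rm_act v g2.
Proof. by []. Qed.

Let lF : bilin (@lc_act k H (F_lcov V)).
Proof. by rewrite /=; lin. Qed.

Lemma F_lcov_valid : is_lcov (F_lcov V).
Proof.
have rm : is_rmodule (@lc_act k H (F_lcov V)).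
  split=> //.
  - move=> x g; rewrite !F_lcov_ractE !F_hopf_autE; tind x h v; tpure.
    rewrite Delta_tmap; tind (Delta g) g1 g2; tpure.
    by rewrite !(rmod_rules hV) !hrules.
  - move=> x g g'; rewrite !F_lcov_ractE !F_hopf_autE; tind x h v; tpure.
    rewrite Delta_tmap Delta_hmul; tind (Delta g) g1 g2; tind (Delta g') h1 h2; tpure.
    by rewrite !(rmod_rules hV) !hrules.
  - move=> x; rewrite F_lcov_ractE !F_hopf_autE Delta_hone; tind x h v; tpure.
    by rewrite !(rmod_rules hV) !hrules.
have bm : bimodule_compat (@hp_act k H (F_lcov V)) (@lc_act k H (F_lcov V)).
  move=> g x h; rewrite !F_lcov_ractE !F_hopf_actE; tind x a v; tpure.
  rewrite Delta_tmap; tind (Delta h) h1 h2; tpure.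
  by rewrite !(rmod_rules hV) !hrules.
split=> //; [exact: hopf_hmod hF|exact: hopf_lmodule hF|exact: hopf_lcomodule hF|].
have l1 g' : klinear (fun x => @lc_act k H (F_lcov V) x g') by exact: (ract_bilin rm).2.
have l2 x : klinear (@lc_act k H (F_lcov V) x) by exact: (ract_bilin rm).1.
apply: lcovariantP => // x g; have l := hopf_colin hF.
rewrite F_lcov_ractE !F_hopf_coactE.
tind x h v; tpure; snl ltac:(rewrite ?Delta_hmul); snr ltac:(rewrite ?F_lcov_ractE).
tind (Delta h) h1 h2; tpure; foldl (@Delta k H) (Delta g); foldr (@Delta k H) (Delta g).
rewrite Delta_coassoc; tind (tmap id (@Delta k H) (Delta g)) a y; tind y b c; tpure.
by rewrite !(rmod_rules hV) !hrules.
Qed.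

(** On a free module P_L projects onto 1 ⊗ V along the counit; this identifies the structures
    induced on the coinvariants of H ⊗ V with those of V. *)
Lemma PL_free h (v : V) : @PL k H (F_lcov V) (h ⊗ v) = eps h *: (hone H ⊗ v).
Proof.
rewrite /PL F_hopf_coactE; tpure.
rewrite -(@sum_antipl _ _ _ (fun u => u ⊗ v)); last by lin.
snl ltac:(rewrite ?F_hopf_actE); apply: eq_tlift => a b.
by rewrite !hrules (rmod_rules hV).
Qed.

End FreeBimodule.
#[export] Hint Resolve F_lcov_valid : lin lin_conv.

(** * The right action on the coinvariants *)

Section CoinvariantRModule.
Variables (k : comPzRingType) (H : monHomHopf k) (M : lcov_data H) (hM : is_lcov M).
Local Notation W := (lcov_coinv hM).
Implicit Types (m : M) (v : submod W) (h g : H).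

Let hH := is_lcov_hopf hM.
Let hM0 := lcov_hmod hM.

Lemma coH_ractE v h : @rm_act k H (coH_rmod hM) v h = PLc W (lc_act (val v) h).
Proof. by []. Qed.

Lemma PL_autV m : PL (autV m) = autV (PL m).
Proof.
by apply: (can_inj (hmod_autK hM0)); rewrite -(PL_aut hH) !(hmod_autVK hM0).
Qed.

(** Writing [m] as the sum of the [a (P_L n)], the factor [a] leaves m h on the left by the bimodule
    compatibility and P_L replaces it by eps(a). This gives the associativity of the induced
    action. *)
Lemma PL_ract m h : PL (lc_act (PL m) h) = PL (lc_act m h).
Proof.
have lP := PL_klin hH.
rewrite -[in RHS](coact_PL hH m).
rewrite (@lin_pull _ _ _ _ _ (fun x => PL (lc_act x h))); last first.
  by apply: (@comp_klin _ _ _ _ (@PL k H M)) => //; lin.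
transitivity (slet a ⊗ n := hp_coact m in eps a *: PL (lc_act (aut (PL n)) h)).
  rewrite (@sum_coact_eps _ _ _ hH _ (fun n => PL (lc_act (aut (PL n)) h))).
    by rewrite -(PL_aut hH) (hmod_autVK hM0).
  apply: (@comp_klin _ _ _ _ (@PL k H M)) => //.
  by lin.
apply: eq_tlift => a n; rewrite (bimodA' hM) (PL_act hH) -[in RHS](PL_aut hH) eps_aut.
by rewrite (aut_ract (lcov_rmodule hM)) hautVK.
Qed.

(** This is [coact_PL] applied to v h, whose coaction has legs [aut g1] and [autV v] times [g2]
    because [v] is coinvariant. It expresses the right action through the left one, which makes the
    counit right linear. *)
Lemma coinv_ract v h : lc_act (val v) h
  = slet g1 ⊗ g2 := Delta h in hp_act (aut g1) (PL (lc_act (autV (val v)) g2)).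
Proof.
have lP := PL_klin hH.
rewrite -{1}(coact_PL hH (lc_act (val v) h)) (coact_ract hM) coact_val //.
tpure; snl ltac:(idtac); apply: eq_tlift => a b.
by rewrite hmul1l.
Qed.

Lemma coH_rmod_valid : is_rmod (coH_rmod hM).
Proof.
have lP := PLc_klin hH W; have hW := coH_valid hH W.
split; first exact: hW.
split.
- apply: bilinP => x; [apply: (@lin_app _ _ _ _ (PLc W) (lc_act (val x)))|
    apply: (@lin_app _ _ _ _ (PLc W) (fun v => lc_act (val v) x))] => //; lin.
- move=> v h; apply: val_inj; rewrite (val_aut_coH hH) !coH_ractE !(val_PLc hH).
  by rewrite (val_aut_coH hH) -(PL_aut hH) (aut_ract (lcov_rmodule hM)).
- move=> v g h; apply: val_inj; rewrite !coH_ractE !(val_PLc hH) PL_ract.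
  by rewrite (val_aut_coH hH) (ractA (lcov_rmodule hM)).
- move=> v; apply: val_inj; rewrite coH_ractE (val_PLc hH) (val_aut_coH hH).
  rewrite (ract1 (lcov_rmodule hM)) PL_fix //.
  by apply: coinv_aut => //; exact: submod_valP.
Qed.

Lemma counit_rlinear x h :
  @hopf_counit k H M W (@lc_act k H (F_lcov (coH_rmod hM)) x h)
  = lc_act (hopf_counit x) h.
Proof.
have lP := PLc_klin hH W; have lP' := PL_klin hH.
have hr := coH_rmod_valid.
rewrite F_lcov_ractE /hopf_counit.
tind x a v; tpure.
rewrite (bimodA' hM) coinv_ract Delta_autV.
tind (Delta h) h1 h2; tpure.
rewrite coH_ractE (val_PLc hH).
by rewrite (lactA' hH) -PL_autV (autV_lract hM) hautVK.
Qed.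

End CoinvariantRModule.

Section FreeBimoduleUnit.
Variables (k : comPzRingType) (H : monHomHopf k) (V : rmod_data H) (hV : is_rmod V).
Variable hF : is_lcov (F_lcov V).

Lemma unit_rlinear (v : V) h :
  hopf_unit (lcov_coinv hF) (rm_act v h)
  = @rm_act k H (coH_rmod hF) (hopf_unit (lcov_coinv hF) v) h.
Proof.
have hV0 := rmod_hmod hV; have hH := is_lcov_hopf hF; have lP := PL_klin hH.
apply: val_inj; rewrite coH_ractE (val_PLc hH) !val_hopf_unit // F_lcov_ractE; tpure.
rewrite (lin_pull _ _ lP).
transitivity (slet g1 ⊗ g2 := Delta h in eps g1 *: (hone H ⊗ rm_act (autV v) g2)).
  rewrite (@sum_counitl _ _ _ (fun g => hone H ⊗ rm_act (autV v) g)); last by lin.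
  by rewrite (autV_ract _ _ hV).
apply: eq_tlift => a b; rewrite (PL_free hV) hmul1l.
by rewrite eps_aut.
Qed.

End FreeBimoduleUnit.

(** * The equivalence for left-covariant bimodules *)

Section BimoduleEquivalence.
Variables (k : comPzRingType) (H : monHomHopf k).

Lemma PL_nat (M N : hopf_data H) (f : M -> N) m : is_hopf M -> is_hopf N ->
  is_hopf_mor f -> f (PL m) = PL (f m).
Proof.
move=> hM hN [[lf _] lf' cf]; have lf0 : klinear f := lf.
by rewrite /PL cf; tind (hp_coact m) a n; tpure.
Qed.

Lemma F_lcov_mor (V W : rmod_data H) (f : V -> W) : is_rmod V -> is_rmod W ->
  is_rmod_mor f -> is_lcov_mor (M := F_lcov V) (N := F_lcov W) (tmap (fun h : H => h) f).
Proof.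
move=> hV hW [hf rf]; split; first exact: F_hopf_mor (rmod_hmod hV) (rmod_hmod hW) hf.
have lf : klinear f := hf.1.
move=> x g; rewrite !F_lcov_ractE; tind x h v; tpure; tind (Delta g) g1 g2; tpure.
by rewrite rf.
Qed.

Lemma coH_rmod_mor (M N : lcov_data H) (hM : is_lcov M) (hN : is_lcov N) (f : M -> N) :
  is_lcov_mor f ->
  is_rmod_mor (M := coH_rmod hM) (N := coH_rmod hN)
    (fun v => to_coH (lcov_coinv hN) (f (val (v : submod (lcov_coinv hM))))).
Proof.
move=> [hf rf]; have hMH := is_lcov_hopf hM; have hNH := is_lcov_hopf hN.
split; first exact: coH_mor.
move=> v h; apply: val_inj; rewrite [in RHS]coH_ractE (val_PLc hNH).
have cf u : coinvariant (f (val (u : submod (lcov_coinv hM)))).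
  by apply: hopf_mor_coinv => //; exact: submod_valP.
by rewrite (val_to_coH _ (cf v)) (val_to_coH _ (cf (rm_act v h))) coH_ractE (val_PLc hMH)
  (PL_nat _ hMH hNH) // rf.
Qed.

Definition FreeL_ob (V : RMod H) : LCov H :=
  @Cob k (LCov H) (F_lcov (dat V)) (F_lcov_valid (cobP V)).

Definition FreeL : functor (RMod H) (LCov H).
Proof.
refine (@Functor (RMod H) (LCov H) FreeL_ob (fun V W f =>
  @CHom k (LCov H) (FreeL_ob V) (FreeL_ob W) (tmap (fun h : H => h) (fn f))
    (F_lcov_mor (cobP V) (cobP W) (chomP f))) _ _).
- by move=> V; apply: chom_eq => x; exact: tmap_id.
- move=> V W X g f; apply: chom_eq => x /=; rewrite tmap_comp //.
    exact: (rmod_hmor (chomP f)).1.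
  exact: (rmod_hmor (chomP g)).1.
Defined.

Definition CoinvL_ob (M : LCov H) : RMod H :=
  @Cob k (RMod H) (G_lcov M) (coH_rmod_valid (cobP M)).

Definition CoinvL : functor (LCov H) (RMod H).
Proof.
refine (@Functor (LCov H) (RMod H) CoinvL_ob (fun M N f =>
  @CHom k (RMod H) (CoinvL_ob M) (CoinvL_ob N)
    (fun v => to_coH (lcov_coinv (cobP N)) (fn f (val (v : submod (lcov_coinv (cobP M))))))
    (coH_rmod_mor (cobP M) (cobP N) (chomP f))) _ _).
- by move=> M; apply: chom_eq => x; exact: to_coH_val.
- move=> M N P g f; apply: chom_eq => x.
  apply: (f_equal (fun y => to_coH _ (fn g y))); symmetry; apply: val_to_coH.
  apply: hopf_mor_coinv (submod_valP _); [exact: is_lcov_hopf (cobP M)|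
    exact: is_lcov_hopf (cobP N)|exact: lcov_hopf_mor (chomP f)].
Defined.

Lemma hopf_unit_rmod_mor (V : rmod_data H) (hV : is_rmod V) (hF : is_lcov (F_lcov V)) :
  is_rmod_mor (N := coH_rmod hF) (hopf_unit (lcov_coinv hF)).
Proof.
split; first exact: hopf_unit_mor (rmod_hmod hV) _.
by move=> v h; exact: unit_rlinear.
Qed.

Lemma hopf_counit_lcov_mor (M : lcov_data H) (hM : is_lcov M) :
  is_lcov_mor (M := F_lcov (coH_rmod hM)) (@hopf_counit k H M (lcov_coinv hM)).
Proof.
split; first exact: hopf_counit_mor (is_lcov_hopf hM) _.
by move=> x h; exact: counit_rlinear.
Qed.

Definition FreeL_unit (V : RMod H) : homc V (CoinvL (FreeL V)) :=
  @CHom k (RMod H) V (CoinvL_ob (FreeL_ob V)) (hopf_unit _)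
    (hopf_unit_rmod_mor (cobP V) (cobP (FreeL_ob V))).

Definition FreeL_counit (M : LCov H) : homc (FreeL (CoinvL M)) M :=
  @CHom k (LCov H) (FreeL_ob (CoinvL_ob M)) M (@hopf_counit k H _ _)
    (hopf_counit_lcov_mor (cobP M)).

Definition FreeL_equiv : equivalence FreeL CoinvL.
Proof.
refine (@Equivalence _ _ FreeL CoinvL FreeL_unit FreeL_counit _ _ _ _).
- move=> V W f; apply: chom_eq => v.
  exact: hopf_unit_nat (rmod_hmod (cobP V)) (rmod_hmod (cobP W)) (rmod_hmor (chomP f)).
- move=> M N f; apply: chom_eq => x.
  exact: hopf_counit_nat (is_lcov_hopf (cobP M)) (is_lcov_hopf (cobP N))
    (lcov_hopf_mor (chomP f)).
- move=> V; apply: bij_iso; first exact: rmod_reflects_iso.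
  exact: hopf_unit_bij (rmod_hmod (cobP V)) _.
- move=> M; apply: bij_iso; first exact: lcov_reflects_iso.
  exact: hopf_counit_bij (is_lcov_hopf (cobP M)) _.
Defined.

Lemma FreeL_zig (V : RMod H) :
  eq_counit FreeL_equiv (FreeL V) ∘ fmap FreeL (eq_unit FreeL_equiv V) = idc (FreeL V).
Proof. by apply: chom_eq => x; exact: hopf_zig (rmod_hmod (cobP V)). Qed.

Lemma FreeL_zag (M : LCov H) :
  fmap CoinvL (eq_counit FreeL_equiv M) ∘ eq_unit FreeL_equiv (CoinvL M) = idc (CoinvL M).
Proof. by apply: chom_eq => v; exact: hopf_zag (is_lcov_hopf (cobP M)). Qed.

End BimoduleEquivalence.

(** * Free bicovariant bimodules *)

Section FreeBicovariant.
Variables (k : comPzRingType) (H : monHomHopf k) (V : yd_data H) (hV : is_yd V).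

Let hR := yd_is_rmod hV.
Let hV0 := rmod_hmod hR.
Let hF : is_lcov (F_lcov V) := F_lcov_valid hR.

Lemma F_hopf_autVE (U : hmod_data k) x : @autV k (F_hopf H U) x = tmap autV autV x.
Proof. by []. Qed.

Lemma F_bicov_coactE x : @bc_coact k H (F_bicov V) x
  = slet h ⊗ v := x in slet h1 ⊗ h2 := Delta h in slet v0 ⊗ v1 := yd_coact v in
      (h1 ⊗ v0) ⊗ (h2 ⋅ v1).
Proof. by []. Qed.

Let ls : klinear (@bc_coact k H (F_bicov V)).
Proof. by apply: tlift_klin; lin. Qed.

Lemma yd_coact_autV (v : V) : yd_coact (autV v) = tmap autV autV (yd_coact v).
Proof.
rewrite -{2}(hmod_autVK hV0 v) yd_coact_aut //.
tind (yd_coact (autV v)) n a; tpure.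
by rewrite hautK (hmod_autK hV0).
Qed.

Lemma F_bicov_rcomodule : is_rcomodule (@bc_coact k H (F_bicov V)).
Proof.
have eV := yd_coact_autV; have hF' : is_lcov (F_bicov V) := hF.
split; first exact: ls.
- move=> x; rewrite !F_bicov_coactE !F_hopf_autE; tind x h v; tpure.
  rewrite Delta_tmap yd_coact_aut //.
  tind (Delta h) h1 h2; tind (yd_coact v) v0 v1; tpure; rewrite F_hopf_autE; tpure.
  by rewrite !hrules.
- move=> x; rewrite !F_bicov_coactE; tind x h v; tpure.
  snl ltac:(rewrite ?Delta_hmul); snr ltac:(rewrite ?F_bicov_coactE).
  foldr (@Delta k H) (Delta h); foldl (@Delta k H) (Delta h).
  rewrite Delta_coassoc; tind (tmap id (@Delta k H) (Delta h)) a y; tind y b c; tpure.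
  foldr (@Delta k H) (yd_coact v); foldl (@yd_coact k H V) (yd_coact v).
  rewrite yd_coassoc //; tind (tmap (@yd_coact k H V) id (yd_coact v)) y v2.
  tind y v0 v1; tpure.
  by rewrite F_hopf_autVE; tpure; rewrite !hrules (hmod_autK hV0).
- move=> x; rewrite !F_bicov_coactE F_hopf_autVE; tind x h v; tpure.
  rewrite -(rcoact_eps (yd_rcomodule hV)) -eps_counitr.
  tind (Delta h) h1 h2; tind (yd_coact v) v0 v1; tpure.
  by rewrite eps_hmul -scalerA pureZl pureZr.
Qed.

(** The Yetter-Drinfeld condition of [V] is what covariance of the right action amounts to; the left
    action and the commutation of coactions rest on the multiplicativity and the coassociativity of
    Delta. *)
Lemma F_bicov_valid : is_bicov (F_bicov V).
Proof.
have eV := yd_coact_autV; have hF' : is_lcov (F_bicov V) := hF.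
split; [exact: hF|exact: F_bicov_rcomodule| |].
- apply: rcovariantP => [||x g|x g]; [exact: hF|exact: F_bicov_rcomodule| |].
  + rewrite F_lcov_ractE !F_bicov_coactE; tind x h v; tpure.
    (* Coassociativity isolates an inner sum which is one side of the Yetter-Drinfeld condition at
       [v] and [aut b]; the next step replaces it by the other side. *)
    transitivity (slet h1 ⊗ h2 := Delta h in slet a ⊗ b := Delta g in
      slet r ⊗ s := (slet c1 ⊗ c2 := Delta (aut b) in
        slet p0 ⊗ p1 := yd_coact (rm_act v c2) in p0 ⊗ autV (c1 ⋅ p1)) in
      ((h1 ⋅ autV a) ⊗ r) ⊗ (aut h2 ⋅ s)).
      snl ltac:(rewrite ?Delta_hmul); snr ltac:(rewrite ?Delta_tmap).
      tind (Delta h) h1 h2; tpure.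
      foldl (@Delta k H) (Delta g); foldr (@Delta k H) (Delta g).
      rewrite Delta_coassoc; tind (tmap id (@Delta k H) (Delta g)) a y.
      tind y b c; tpure.
      by tind (yd_coact (rm_act v (aut c))) p0 p1; tpure; rewrite !hrules.
    transitivity (slet h1 ⊗ h2 := Delta h in slet a ⊗ b := Delta g in
      slet r ⊗ s := (slet n0 ⊗ n1 := yd_coact v in slet c1 ⊗ c2 := Delta (aut b) in
        rm_act n0 (autV c1) ⊗ (n1 ⋅ autV c2)) in
      ((h1 ⋅ autV a) ⊗ r) ⊗ (aut h2 ⋅ s)).
      apply: eq_tlift => h1 h2; apply: eq_tlift => a b; congr tlift.
      by symmetry; exact: yd_compatible hV v (aut b).
    snl ltac:(rewrite ?Delta_tmap); snr ltac:(rewrite ?F_lcov_ractE).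
    tind (Delta h) h1 h2; tind (yd_coact v) v0 v1; tpure.
    foldl (@Delta k H) (Delta g); foldr (@Delta k H) (Delta g).
    rewrite Delta_coassoc; tind (tmap id (@Delta k H) (Delta g)) a y.
    by tind y b c; tpure; rewrite !hrules.
  + rewrite !F_hopf_actE !F_bicov_coactE; tind x h v; tpure.
    rewrite Delta_hmul Delta_autV yd_coact_aut //.
    tind (Delta g) g1 g2; tind (Delta h) h1 h2; tind (yd_coact v) v0 v1; tpure.
    by rewrite !F_hopf_actE; tpure; rewrite !hrules.
- move=> x; have lc := hopf_colin (is_lcov_hopf hF).
  rewrite F_hopf_coactE F_bicov_coactE; tind x h v; tpure.
  snl ltac:(rewrite ?F_bicov_coactE ?eV); snr ltac:(rewrite ?F_hopf_coactE).
  foldl (@Delta k H) (Delta h); foldr (@Delta k H) (Delta h).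
  rewrite Delta_coassoc; tind (tmap id (@Delta k H) (Delta h)) a y.
  tind y b c; tind (yd_coact v) v0 v1; tpure.
  by rewrite !hrules.
Qed.

End FreeBicovariant.
#[export] Hint Resolve F_bicov_valid : lin lin_conv.

(** * The Yetter-Drinfeld structure on the coinvariants *)

Section CoinvariantYD.
Variables (k : comPzRingType) (H : monHomHopf k) (M : bicov_data H) (hM : is_bicov M).

Let hL := bicov_is_lcov hM.
Let hH := is_lcov_hopf hL.
Let hM0 := lcov_hmod hL.
Local Notation W := (lcov_coinv hL).
Implicit Types (m : M) (v : submod W) (h g : H).

(** The left coaction of [v] is trivial and the two coactions commute, so the first leg of the right
    coaction of [v] is coinvariant too, hence fixed by P_L. *)
Lemma rcoact_coinv v : tmap (@PL k H M) id (bc_coact (val v)) = bc_coact (val v).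
Proof.
have lP := PL_klin hH.
have e := bicov_bicomodule hM (val v); rewrite coact_val in e.
(* The map sending a ⊗ (p ⊗ h) to S(α^{-1}(a)) p ⊗ α(h) is applied to both sides of [e]: one side
   gives P_L on the first leg, the other the coaction itself. *)
transitivity (slet a ⊗ y := (slet n ⊗ h := bc_coact (val v) in
    slet a ⊗ p := hp_coact n in aut a ⊗ (p ⊗ autV h)) in
  slet p ⊗ h := y in hp_act (antip (autV a)) p ⊗ aut h).
  rewrite /PL; tind (bc_coact (val v)) n h; tpure; rewrite /PL.
  by tind (hp_coact n) a p; tpure; rewrite !hrules.
rewrite -e; tpure; rewrite (rcoact_autV hM).
tind (bc_coact (val v)) n h; tpure.
by rewrite autV_hone antip_hone !(lcov_rules hL).
Qed.

(** The restricted coaction made explicit: P_L corestricts the first leg, on which it acts as the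
    identity by [rcoact_coinv]. *)
Definition coH_coact v : tensor (submod W) H := tmap (PLc W) id (bc_coact (val v)).

(** Convertible to [G_bicov], but available for any structure with a proof of [is_bicov]. *)
Definition coH_yd : yd_data H :=
  @YDData k H (coH_rmod hL) (fun v =>
    xget 0 [set y | tmap (fun n : submod W => val n) id y = bc_coact (val v)]%classic).

Let lP := PL_klin hH.
Let lPc := PLc_klin hH W.
Let lval : klinear (fun n : submod W => val n) := @val_klin k M _ W.

(* Since [submod W] is a direct factor of [M], through P_L, the inclusion stays
   injective after tensoring, so that the restricted coaction is well defined. *)
Lemma tmap_val_inj (N : lmodType k) :
  injective (tmap (fun n : submod W => val n) id : tensor (submod W) N -> tensor M N).
Proof.
apply: (can_inj (g := tmap (PLc W) id)) => x.
tind x v n; tpure; congr (_ ⊗ _); apply: val_inj.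
by rewrite (val_PLc hH) PL_fix //; exact: submod_valP.
Qed.

(** The set in [xget] has exactly one element, by [rcoact_coinv] for existence and [tmap_val_inj]
    for uniqueness, so the default value 0 is not what is returned. *)
Lemma coH_coactE v : @yd_coact k H coH_yd v = coH_coact v.
Proof.
have e : tmap (fun n : submod W => val n) id (coH_coact v) = bc_coact (val v).
  rewrite -[RHS]rcoact_coinv /coH_coact.
  by tind (bc_coact (val v)) n h; tpure; rewrite (val_PLc hH).
by apply: xget_unique => //= y ey; apply: tmap_val_inj; rewrite ey e.
Qed.

Lemma coH_yd_valid : is_yd coH_yd.
Proof.
have hR := coH_rmod_valid hL; have hW := rmod_hmod hR.
have cV v : PLc W (val v) = v.
  by apply: val_inj; rewrite (val_PLc hH) PL_fix //; exact: submod_valP.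
have cE : @yd_coact k H coH_yd = coH_coact by apply/funext; exact: coH_coactE.
have lc : klinear coH_coact by rewrite /coH_coact; lin.
have PA m : PLc W (aut m) = (aut (PLc W m : coH W) : submod W).
  by apply: val_inj; rewrite (val_aut_coH hH) !(val_PLc hH) (PL_aut hH).
have PV m : PLc W (autV m) = (autV (PLc W m : coH W) : submod W).
  by apply: val_inj; rewrite (val_autV_coH hH) !(val_PLc hH) (PL_autV hL).
have P2 m : coH_coact (PLc W m) = tmap (PLc W) id (bc_coact (PL m)).
  by rewrite /coH_coact (val_PLc hH).
split; [exact: hR| |]; rewrite cE.
- split.
  + exact: lc.
  + move=> v; rewrite /coH_coact (val_aut_coH hH) (rcoact_autE hM).
    by tind (bc_coact (val (v : submod W))) n h; tpure; rewrite PA.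
  + move=> v.
    transitivity (slet y ⊗ z :=
        (slet n ⊗ h := bc_coact (val (v : submod W)) in autV n ⊗ Delta h) in
      PLc W y ⊗ z).
      rewrite /coH_coact; tind (bc_coact (val (v : submod W))) n h; tpure.
      by rewrite PV.
    rewrite (rcoactA (bicov_rcomodule hM)) -rcoact_coinv /coH_coact.
    tind (bc_coact (val (v : submod W))) n h; tpure; rewrite (val_PLc hH).
    by tind (bc_coact (PL n)) p g; tpure.
  + move=> v.
    transitivity (PLc W (autV (val (v : submod W)))); last by rewrite PV cV.
    rewrite -(rcoact_eps (bicov_rcomodule hM)) /coH_coact.
    by tind (bc_coact (val (v : submod W))) n h; tpure; rewrite (linZ lPc).
- move=> v h.
  (* Both sides of the Yetter-Drinfeld condition are P_L on the first leg of the right coaction of v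
     α^{-1}(h): one by covariance for the right action, the other after rewriting this element
     through [coinv_ract] and using covariance for the left action. *)
  transitivity (tmap (PLc W) id (bc_coact (lc_act (val (v : submod W)) (autV h)))).
    rewrite (rcoact_ract hM) Delta_autV -rcoact_coinv /coH_coact.
    tind (bc_coact (val (v : submod W))) n a; tpure; tind (Delta h) h1 h2; tpure.
    by rewrite coH_ractE (val_PLc hH).
  rewrite coinv_ract Delta_autV.
  transitivity (slet h1 ⊗ h2 := Delta h in
    slet p ⊗ b := bc_coact (PL (lc_act (val (v : submod W)) h2)) in PLc W p ⊗ autV (h1 ⋅ b)).
    (* By [PL_act] the left factor h_11 only survives through its counit, which then contracts the
       coproduct of [c]. *)
    transitivity (slet c ⊗ h2 := Delta h in
      slet h11 ⊗ h12 := Delta c in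
      slet p ⊗ b := bc_coact (PL (lc_act (val (v : submod W)) h2)) in
        eps h11 *: (PLc W p ⊗ (h12 ⋅ autV b))).
      snl ltac:(rewrite ?(rcoact_lact hM)).
      apply: eq_tlift => h1 h2; rewrite !hrules.
      rewrite -(autV_lract hL) (PL_autV hL) (rcoact_autV hM).
      tind (bc_coact (PL (lc_act (val (v : submod W)) h2))) p b; tpure.
      tind (Delta h1) h11 h12; tpure; rewrite -pureZl; congr (_ ⊗ _).
      apply: val_inj; rewrite (val_PLc hH) (PL_act hH) (linZ lval) (val_PLc hH).
      by rewrite -(PL_aut hH) (hmod_autVK hM0).
    apply: eq_tlift => h1 h2.
    tind (bc_coact (PL (lc_act (val (v : submod W)) h2))) p b; tpure.
    snl ltac:(idtac); rewrite autV_hmul.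
    by rewrite (@sum_counitl _ _ _ (fun h => PLc W p ⊗ (h ⋅ autV b))) //; lin.
  apply: eq_tlift => h1 h2; rewrite coH_ractE P2.
  by tind (bc_coact (PL (lc_act (val (v : submod W)) h2))) p b; tpure.
Qed.

Lemma counit_rcolinear x :
  bc_coact (@hopf_counit k H M W x)
  = slet y ⊗ h := @bc_coact k H (F_bicov coH_yd) x in @hopf_counit k H M W y ⊗ h.
Proof.
have lu : klinear (@hopf_counit k H M W) := (hopf_hmor (hopf_counit_mor hH W)).1.
have hY := coH_yd_valid.
rewrite F_bicov_coactE; tind x h v; tpure; rewrite /hopf_counit; tpure.
rewrite (rcoact_lact hM) coH_coactE /coH_coact -[in LHS]rcoact_coinv.
tind (bc_coact (val (v : submod W))) n a; tind (Delta h) h1 h2; tpure.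
by rewrite (val_PLc hH).
Qed.

End CoinvariantYD.
#[export] Hint Resolve coH_yd_valid : lin lin_conv.

(** * The equivalence for bicovariant bimodules *)

Section BicovariantEquivalence.
Variables (k : comPzRingType) (H : monHomHopf k).

Lemma F_bicov_mor (V W : yd_data H) (f : V -> W) : is_yd V -> is_yd W -> is_yd_mor f ->
  is_bicov_mor (M := F_bicov V) (N := F_bicov W) (tmap (fun h : H => h) f).
Proof.
move=> hV hW [hf cf].
split; first exact: F_lcov_mor (yd_is_rmod hV) (yd_is_rmod hW) hf.
have lf : klinear f := (rmod_hmor hf).1.
move=> x; rewrite !F_bicov_coactE; tind x h v; tpure; rewrite cf.
by tind (Delta h) h1 h2; tind (yd_coact v) v0 v1; tpure.
Qed.

Lemma coH_yd_mor (M N : bicov_data H) (hM : is_bicov M) (hN : is_bicov N) (f : M -> N) :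
  is_bicov_mor f ->
  is_yd_mor (M := coH_yd hM) (N := coH_yd hN)
    (fun v => to_coH (lcov_coinv (bicov_is_lcov hN))
      (f (val (v : submod (lcov_coinv (bicov_is_lcov hM)))))).
Proof.
move=> [hf cf]; have hLM := bicov_is_lcov hM; have hLN := bicov_is_lcov hN.
have hMH := is_lcov_hopf hLM; have hNH := is_lcov_hopf hLN.
have lf : klinear f := lcov_mor_klin hf.
have hr := coH_rmod_mor (bicov_is_lcov hM) (bicov_is_lcov hN) hf.
split; first exact: hr.
pose WM := lcov_coinv (bicov_is_lcov hM); pose WN := lcov_coinv (bicov_is_lcov hN).
pose g (v : submod WM) : submod WN := to_coH WN (f (val v)).
have gE u : val (g u) = f (val u).
  by rewrite val_to_coH //; exact: hopf_mor_coinv hMH hNH (lcov_hopf_mor hf) (submod_valP _).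
have lg : klinear g := (rmod_hmor hr).1.
have lM := PLc_klin hMH WM; have lN := PLc_klin hNH WN.
move=> v; rewrite !coH_coactE; transitivity (tmap g id (@coH_coact k H M hM v)); last by [].
rewrite /coH_coact -/WM -/WN -[to_coH _ _]/(g v) gE cf.
tind (bc_coact (val (v : submod WM))) n h; tpure.
congr (_ ⊗ _); apply: val_inj; rewrite gE (val_PLc hNH) (val_PLc hMH).
by rewrite (PL_nat _ hMH hNH) //; exact: lcov_hopf_mor.
Qed.

Lemma hopf_unit_yd_mor (V : yd_data H) (hV : is_yd V) (hF : is_bicov (F_bicov V)) :
  is_yd_mor (N := coH_yd hF) (hopf_unit (lcov_coinv (bicov_is_lcov hF))).
Proof.
have hR := yd_is_rmod hV; have hV0 := rmod_hmod hR.
have hu := hopf_unit_rmod_mor hR (bicov_is_lcov hF).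
split; first exact: hu.
have hH := is_lcov_hopf (bicov_is_lcov hF).
have lu : klinear (hopf_unit (lcov_coinv (bicov_is_lcov hF))) := (rmod_hmor hu).1.
have lP := PLc_klin hH (lcov_coinv (bicov_is_lcov hF)).
move=> v; rewrite coH_coactE /coH_coact val_hopf_unit // F_bicov_coactE; tpure.
rewrite Delta_hone (yd_coact_autV hV); tpure.
tind (yd_coact v) v0 v1; tpure.
rewrite hmul1l hautVK; congr (_ ⊗ _); apply: val_inj; rewrite (val_PLc hH) val_hopf_unit //.
by rewrite (PL_free hR) eps_hone scale1r.
Qed.

Lemma hopf_counit_bicov_mor (M : bicov_data H) (hM : is_bicov M) :
  is_bicov_mor (M := F_bicov (coH_yd hM))
    (@hopf_counit k H M (lcov_coinv (bicov_is_lcov hM))).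
Proof.
split; first exact: hopf_counit_lcov_mor.
exact: counit_rcolinear.
Qed.

Definition FreeB_ob (V : YD H) : Bicov H :=
  @Cob k (Bicov H) (F_bicov (dat V)) (F_bicov_valid (cobP V)).

Definition FreeB : functor (YD H) (Bicov H).
Proof.
refine (@Functor (YD H) (Bicov H) FreeB_ob (fun V W f =>
  @CHom k (Bicov H) (FreeB_ob V) (FreeB_ob W) (tmap (fun h : H => h) (fn f))
    (F_bicov_mor (cobP V) (cobP W) (chomP f))) _ _).
- by move=> V; apply: chom_eq => x; exact: tmap_id.
- move=> V W X g f; apply: chom_eq => x /=; rewrite tmap_comp //.
    exact: (rmod_hmor (yd_rmod_mor (chomP f))).1.
  exact: (rmod_hmor (yd_rmod_mor (chomP g))).1.
Defined.

Definition CoinvB_ob (M : Bicov H) : YD H :=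
  @Cob k (YD H) (G_bicov M) (coH_yd_valid (cobP M)).

Definition CoinvB : functor (Bicov H) (YD H).
Proof.
refine (@Functor (Bicov H) (YD H) CoinvB_ob (fun M N f =>
  @CHom k (YD H) (CoinvB_ob M) (CoinvB_ob N)
    (fun v => to_coH (lcov_coinv (bicov_is_lcov (cobP N)))
      (fn f (val (v : submod (lcov_coinv (bicov_is_lcov (cobP M)))))))
    (coH_yd_mor (cobP M) (cobP N) (chomP f))) _ _).
- by move=> M; apply: chom_eq => x; exact: to_coH_val.
- move=> M N P g f; apply: chom_eq => x.
  apply: (f_equal (fun y => to_coH _ (fn g y))); symmetry; apply: val_to_coH.
  apply: hopf_mor_coinv (submod_valP _); [exact: is_lcov_hopf (bicov_is_lcov (cobP M))|
    exact: is_lcov_hopf (bicov_is_lcov (cobP N))|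
    exact: lcov_hopf_mor (bicov_lcov_mor (chomP f))].
Defined.

Definition FreeB_unit (V : YD H) : homc V (CoinvB (FreeB V)) :=
  @CHom k (YD H) V (CoinvB_ob (FreeB_ob V)) (hopf_unit _)
    (hopf_unit_yd_mor (cobP V) (cobP (FreeB_ob V))).

Definition FreeB_counit (M : Bicov H) : homc (FreeB (CoinvB M)) M :=
  @CHom k (Bicov H) (FreeB_ob (CoinvB_ob M)) M (@hopf_counit k H _ _)
    (hopf_counit_bicov_mor (cobP M)).

Definition FreeB_equiv : equivalence FreeB CoinvB.
Proof.
refine (@Equivalence _ _ FreeB CoinvB FreeB_unit FreeB_counit _ _ _ _).
- move=> V W f; apply: chom_eq => v.
  exact: hopf_unit_nat (rmod_hmod (yd_is_rmod (cobP V))) (rmod_hmod (yd_is_rmod (cobP W)))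
    (rmod_hmor (yd_rmod_mor (chomP f))).
- move=> M N f; apply: chom_eq => x.
  exact: hopf_counit_nat (is_lcov_hopf (bicov_is_lcov (cobP M)))
    (is_lcov_hopf (bicov_is_lcov (cobP N))) (lcov_hopf_mor (bicov_lcov_mor (chomP f))).
- move=> V; apply: bij_iso; first exact: yd_reflects_iso.
  exact: hopf_unit_bij (rmod_hmod (yd_is_rmod (cobP V))) _.
- move=> M; apply: bij_iso; first exact: bicov_reflects_iso.
  exact: hopf_counit_bij (is_lcov_hopf (bicov_is_lcov (cobP M))) _.
Defined.

Lemma FreeB_zig (V : YD H) :
  eq_counit FreeB_equiv (FreeB V) ∘ fmap FreeB (eq_unit FreeB_equiv V) = idc (FreeB V).
Proof. by apply: chom_eq => x; exact: hopf_zig (rmod_hmod (yd_is_rmod (cobP V))). Qed.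

Lemma FreeB_zag (M : Bicov H) :
  fmap CoinvB (eq_counit FreeB_equiv M) ∘ eq_unit FreeB_equiv (CoinvB M) = idc (CoinvB M).
Proof. by apply: chom_eq => v; exact: hopf_zag (is_lcov_hopf (bicov_is_lcov (cobP M))). Qed.

End BicovariantEquivalence.

(** * The monoidal structure of the free functor *)

Section FreeTensor.
Variables (k : comPzRingType) (H : monHomHopf k).
Local Notation "m ⊗H n" := (@pureH k H _ _ m n) (at level 45, no associativity).

Section Pair.
Variables (V W : rmod_data H) (hV : is_rmod V) (hW : is_rmod W).
Local Notation FV := (F_lcov V).
Local Notation FW := (F_lcov W).
Local Notation FVW := (F_lcov (rmod_tens V W)).

Let hFV := F_lcov_valid hV.
Let hFW := F_lcov_valid hW.
Let hVW := rmod_tens_valid hV hW.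
Let hFVW := F_lcov_valid hVW.

Let lV := lin_aut (rmod_hmod hV).
Let lW := lin_aut (rmod_hmod hW).
Let lV' := lin_autV (rmod_hmod hV).
Let lW' := lin_autV (rmod_hmod hW).

Lemma rmod_tens_autE (v : V) (w : W) : @aut k (rmod_tens V W) (v ⊗ w) = aut v ⊗ aut w.
Proof. exact: tmap_pure. Qed.

Lemma rmod_tens_autVE (v : V) (w : W) : @autV k (rmod_tens V W) (v ⊗ w) = autV v ⊗ autV w.
Proof. exact: tmap_pure. Qed.

Lemma rmod_tens_actE (v : V) (w : W) h : @rm_act k H (rmod_tens V W) (v ⊗ w) h
  = slet h1 ⊗ h2 := Delta h in rm_act v h1 ⊗ rm_act w h2.
Proof. by rewrite /=; tpure. Qed.

(** The formula is forced by the relation: g ⊗ w is [g] acting on 1 ⊗ ν^{-1}(w), so (h ⊗ v) ⊗_H (g ⊗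
    w) equals (α^{-1}(h) ⊗ ν^{-1}(v)) g ⊗_H (1 ⊗ w), with ν the automorphism at hand, and a pair
    whose second entry is 1 ⊗ w is read as a single element of H ⊗ (V ⊗ W) after twisting the [H]
    leg. *)
Definition free_tens_fun (x : FV) (y : FW) : FVW :=
  slet h ⊗ v := (x : tensor H V) in slet g ⊗ w := (y : tensor H W) in
    slet g1 ⊗ g2 := Delta g in (h ⋅ aut g1) ⊗ (rm_act (autV v) g2 ⊗ w).

Lemma free_tens_bilin : bilin free_tens_fun.
Proof. by rewrite /free_tens_fun; lin. Qed.

(** Multiplicativity of Delta reduces the relation to Hom-associativity of the product on the first
    leg and of the right action of [V] on the second. *)
Lemma free_tens_bal : balanced free_tens_fun.
Proof.
split=> [|x a y]; first exact: free_tens_bilin.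
rewrite F_lcov_ractE F_hopf_actE F_hopf_autE F_hopf_autVE /free_tens_fun.
tind x h v; tind y g w; snl ltac:(idtac); snr ltac:(rewrite ?Delta_hmul ?Delta_autV).
tind (Delta a) a1 a2; tind (Delta g) g1 g2; tpure.
by rewrite !(rmod_rules hV) !(rmod_rules hW) !hrules.
Qed.

Definition free_tens (x : tensorH FV FW) : FVW := tliftH free_tens_fun x.

Lemma free_tensE x y : free_tens (x ⊗H y) = free_tens_fun x y.
Proof. exact: tliftH_pure free_tens_bal. Qed.

Lemma free_tens_klin : @klinear k (tensorH FV FW) FVW free_tens.
Proof. exact: tliftH_klin free_tens_bal. Qed.

Lemma free_tens_mor : is_lcov_mor (M := lcov_tens FV FW) (N := FVW) free_tens.
Proof.
have l := free_tens_klin; have hT := tensH_valid hFV hFW.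
have lb := free_tens_bilin.
have l1 x : klinear (free_tens_fun x) by exact: lb.1.
have l2 y : klinear (fun x => free_tens_fun x y) by exact: lb.2.
split; first split; first split; first exact: l.
- move=> z; tindH z x y; rewrite tensH_autE // !free_tensE !F_hopf_autE /free_tens_fun.
  tind x h v; tind y g w; tpure; rewrite Delta_tmap.
  tind (Delta g) g1 g2; tpure; rewrite rmod_tens_autE.
  by rewrite !(rmod_rules hV) !hrules.
- move=> a z; tindH z x y; rewrite tensH_lactE // !free_tensE !F_hopf_actE /free_tens_fun.
  rewrite F_hopf_autE; tind x h v; tind y g w; tpure; rewrite Delta_tmap.
  tind (Delta g) g1 g2; tpure; rewrite rmod_tens_autE.
  by rewrite !(rmod_rules hV) !hrules.
- move=> z; tindH z x y; rewrite tensH_coactE // !free_tensE !F_hopf_coactE.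
  rewrite /free_tens_fun; tind x h v; tind y g w.
  snl ltac:(rewrite ?Delta_hmul ?Delta_tmap).
  snr ltac:(rewrite ?free_tensE /free_tens_fun ?rmod_tens_autVE).
  tind (Delta h) h1 h2; tpure.
  foldl (@Delta k H) (Delta g); foldr (@Delta k H) (Delta g).
  rewrite Delta_coassoc; tind (tmap id (@Delta k H) (Delta g)) a y.
  tind y b c; tpure.
  by rewrite rmod_tens_autVE !(rmod_rules hV) !hrules.
- move=> z a; tindH z x y; rewrite tensH_ractE // !free_tensE !F_lcov_ractE /free_tens_fun.
  rewrite F_hopf_autE; tind x h v; tind y g w.
  snl ltac:(rewrite ?Delta_hmul ?Delta_autV).
  snr ltac:(rewrite ?rmod_tens_actE).
  tind (Delta g) g1 g2; tpure.
  foldl (@Delta k H) (Delta a); foldr (@Delta k H) (Delta a).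
  rewrite Delta_coassoc; tind (tmap id (@Delta k H) (Delta a)) b y.
  tind y c d; tpure.
  by rewrite !(rmod_rules hV) !hrules.
Qed.

Lemma free_tens_bij : bijective free_tens.
Proof.
have l := free_tens_klin.
exists (fun x : tensor H (tensor V W) => slet h ⊗ u := x in slet v ⊗ w := u in
  ((autV h ⊗ v : FV) ⊗H (hone H ⊗ w : FW))) => z.
  tindH z x y; rewrite free_tensE /free_tens_fun; tind x h v; tind y g w.
  (* The coproduct of [g] is recognised as a right action, which the relation moves back to the
     second factor. *)
  transitivity ((@lc_act k H FV (autV h ⊗ autV v) g) ⊗H (hone H ⊗ w : FW)).
    rewrite F_lcov_ractE; tpure; snl ltac:(idtac); snr ltac:(idtac).
    by tind (Delta g) g1 g2; tpure; rewrite !hrules.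
  rewrite pureH_bal F_hopf_actE F_hopf_autE F_hopf_autVE; tpure.
  by rewrite !hrules (hmod_autVK (rmod_hmod hV)) (hmod_autVK (rmod_hmod hW)).
tind z h u; tind u v w; tpure.
rewrite free_tensE /free_tens_fun; tpure; rewrite Delta_hone; tpure.
by rewrite !(rmod_rules hV) !hrules.
Qed.

End Pair.
End FreeTensor.

(** * Coherence of the comparison maps *)

Section FreeTensorCoherence.
Variables (k : comPzRingType) (H : monHomHopf k).
Local Notation "m ⊗H n" := (@pureH k H _ _ m n) (at level 45, no associativity).
Implicit Types V W X : rmod_data H.

Lemma free_tens_nat V V' W W' (f : V -> V') (g : W -> W') x :
  is_rmod V -> is_rmod V' -> is_rmod W -> is_rmod W' -> is_rmod_mor f -> is_rmod_mor g ->
  free_tens (tensorH_map (M := F_lcov V) (N := F_lcov W) (M' := F_lcov V') (N' := F_lcov W')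
    (tmap (fun h : H => h) f) (tmap (fun h : H => h) g) x)
  = tmap (fun h : H => h) (tmap f g) (free_tens x).
Proof.
move=> hV hV' hW hW' hf hg.
have hFV := F_lcov_valid hV; have hFV' := F_lcov_valid hV'.
have hFW := F_lcov_valid hW; have hFW' := F_lcov_valid hW'.
have mf := F_lcov_mor hV hV' hf; have mg := F_lcov_mor hW hW' hg.
have l1 := tensorH_map_klin hFV hFV' hFW hFW' mf mg.
have l2 := free_tens_klin hV hW; have l3 := free_tens_klin hV' hW'.
have lf : klinear f := (rmod_hmor hf).1; have lg : klinear g := (rmod_hmor hg).1.
tindH x y z; rewrite tensorH_mapE // !free_tensE // /free_tens_fun.
tind y h v; tind z a w; tpure; tind (Delta a) a1 a2; tpure.
by rewrite (rmod_rlinear hf) (hmor_autV _ (rmod_hmod hV) (rmod_hmod hV') (rmod_hmor hf)).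
Qed.

(** With [l] the coefficient of the third factor, one side splits l_2 through the diagonal action on
    V ⊗ W, the other splits l_1 through the coproduct of a product; coassociativity compares
    them. *)
Lemma free_tens_assoc V W X x : is_rmod V -> is_rmod W -> is_rmod X ->
  tmap (fun h : H => h) (@hm_assoc k V W X)
    (@free_tens k H (rmod_tens V W) X (tensorH_map
      (M := lcov_tens (F_lcov V) (F_lcov W)) (N := F_lcov X) (M' := F_lcov (rmod_tens V W))
      (N' := F_lcov X) (@free_tens k H V W) (fun z => z) x))
  = @free_tens k H V (rmod_tens W X) (tensorH_map
      (M := F_lcov V) (N := lcov_tens (F_lcov W) (F_lcov X)) (M' := F_lcov V)
      (N' := F_lcov (rmod_tens W X)) (fun z => z) (@free_tens k H W X) (tensorH_assoc x)).
Proof.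
move=> hV hW hX; have hVW := rmod_tens_valid hV hW; have hWX := rmod_tens_valid hW hX.
have hFV := F_lcov_valid hV; have hFW := F_lcov_valid hW; have hFX := F_lcov_valid hX.
have hFVW := F_lcov_valid hVW; have hFWX := F_lcov_valid hWX.
have hTVW := tensH_valid hFV hFW; have hTWX := tensH_valid hFW hFX.
have idm := @is_lcov_mor_id k H.
have m1 := free_tens_mor hV hW; have m2 := free_tens_mor hW hX.
have l1 := tensorH_map_klin hTVW hFVW hFX hFX m1 (idm _).
have l2 := tensorH_map_klin hFV hFV hTWX hFWX (idm _) m2.
have l3 := free_tens_klin hVW hX; have l4 := free_tens_klin hV hWX.
have l5 := tensorH_assoc_klin hFV hFW hFX.
have l6 := free_tens_klin hV hW; have l7 := free_tens_klin hW hX.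
have la : klinear (@hm_assoc k V W X) by rewrite /hm_assoc; lin.
tindH x y z; tindH y x y; rewrite tensorH_assocE // !tensorH_mapE // !free_tensE //.
rewrite /free_tens_fun F_hopf_autVE F_hopf_autE.
move: la; clear -hV hW hX hVW hWX; move=> la.
tind x h v; tind y g w; tind z l u.
snr ltac:(rewrite ?Delta_autV ?Delta_hmul ?Delta_tmap).
tpure; tind (Delta g) g1 g2; tpure; rewrite (rmod_tens_autVE hV hW).
rewrite (lin_pull _ _ (tmap_klin (@lin_id _ _) la)).
snl ltac:(rewrite ?(rmod_tens_actE hV hW)).
foldl (@Delta k H) (Delta l); foldr (@Delta k H) (Delta l).
rewrite Delta_coassoc; tind (tmap id (@Delta k H) (Delta l)) a y.
tind y b c; tpure.
rewrite /hm_assoc; tpure.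
by rewrite !(rmod_rules hV) !hrules.
Qed.

(** The inverse of the right unit constraint [hm_run] at [H]; the twist [autV] is what makes it
    compatible with the actions. *)
Definition free_unit (h : lcov_unit H) : F_lcov (rmod_unit H) := autV (h : H) ⊗ (1 : k^o).

Lemma free_unit_mor : is_lcov_mor free_unit.
Proof.
have hu := rmod_unit_valid H.
have lu : klinear free_unit by rewrite /free_unit; lin.
split; first split; first split; first exact: lu.
- by move=> h; rewrite F_hopf_autE /free_unit; tpure; rewrite hautK hautVK.
- by move=> a h; rewrite F_hopf_actE /free_unit; tpure; rewrite autV_hmul.
- move=> h; rewrite F_hopf_coactE /free_unit; tpure; rewrite Delta_autV.
  rewrite [@hp_coact _ _ (lcov_unit H) h]/=.
  by tind (Delta (h : H)) h1 h2; tpure; rewrite hautVK.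
- move=> h a; rewrite F_lcov_ractE /free_unit; tpure.
  rewrite autV_hmul -(eps_counitr a); tind (Delta a) a1 a2; tpure.
  by rewrite (linZ (hmul_linr _)) pureZl -pureZr.
Qed.

Lemma free_unit_bij : bijective free_unit.
Proof.
have hu := rmod_unit_valid H.
exists (@hm_run k H) => [h|y]; rewrite /free_unit /hm_run; first by tpure; rewrite scale1r hautVK.
tind y h x; tpure; rewrite (linZ (lin_autV (hb_hmod H))) hautK pureZl -pureZr.
by congr (_ ⊗ _); exact: mulr1.
Qed.

Lemma free_tens_lun V x : is_rmod V ->
  tmap (fun h : H => h) (@hm_lun k V)
    (@free_tens k H (rmod_unit H) V (tensorH_map
      (M := lcov_unit H) (N := F_lcov V) (M' := F_lcov (rmod_unit H)) (N' := F_lcov V)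
      free_unit (fun z => z) x))
  = @tensorH_lun k H (F_lcov V) x.
Proof.
move=> hV; have hu := rmod_unit_valid H; have hFV := F_lcov_valid hV.
have hFu := F_lcov_valid hu; have hlu := lcov_unit_valid H.
have mu := free_unit_mor; have mi := is_lcov_mor_id (F_lcov V).
have l1 := tensorH_map_klin hlu hFu hFV hFV mu mi.
have l2 := free_tens_klin hu hV; have l3 := tensorH_lun_klin hFV.
have l4 : klinear (@hm_lun k V) by rewrite /hm_lun; lin.
tindH x h y; rewrite tensorH_mapE //. rewrite tensorH_lunE // free_tensE // F_hopf_actE.
rewrite /free_tens_fun /free_unit; tind y g v.
move: l4; clear -hV; move=> l4; tpure.
rewrite (lin_pull _ _ (tmap_klin (@lin_id _ _) l4)).
(* The bare [g] is expanded by the counit, so that both sides are sums over [Delta g]. *)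
rewrite -[X in _ ⋅ X ⊗ _](hautVK g) -(eps_counitr g).
tind (Delta g) a b; rewrite /hm_lun; tpure.
rewrite (linZ (lin_aut (hb_hmod H))) (linZ (hmul_linr _)) pureZl -pureZr.
by congr (_ ⊗ (_ *: _)); exact: mulr1.
Qed.

Lemma free_tens_run V x : is_rmod V ->
  tmap (fun h : H => h) (@hm_run k V)
    (@free_tens k H V (rmod_unit H) (tensorH_map
      (M := F_lcov V) (N := lcov_unit H) (M' := F_lcov V) (N' := F_lcov (rmod_unit H))
      (fun z => z) free_unit x))
  = @tensorH_run k H (F_lcov V) x.
Proof.
move=> hV; have hu := rmod_unit_valid H; have hFV := F_lcov_valid hV.
have hFu := F_lcov_valid hu; have hlu := lcov_unit_valid H.
have mu := free_unit_mor; have mi := is_lcov_mor_id (F_lcov V).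
have l1 := tensorH_map_klin hFV hFV hlu hFu mi mu.
have l2 := free_tens_klin hV hu; have l3 := tensorH_run_klin hFV.
have l4 : klinear (@hm_run k V) by rewrite /hm_run; lin.
tindH x y h; rewrite tensorH_mapE // tensorH_runE // free_tensE // F_lcov_ractE.
rewrite /free_tens_fun /free_unit; move: l4; clear -hV; move=> l4; tind y g v; tpure.
rewrite Delta_autV.
rewrite (lin_pull _ _ (tmap_klin (@lin_id _ _) l4)).
tind (Delta h) a b; rewrite /hm_run; tpure.
by rewrite !(rmod_rules hV) !hrules scale1r.
Qed.

End FreeTensorCoherence.

(** * Right colinearity of the comparison maps *)

Section FreeTensorBicovariant.
Variables (k : comPzRingType) (H : monHomHopf k).
Local Notation "m ⊗H n" := (@pureH k H _ _ m n) (at level 45, no associativity).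

(* Up to coassociativity of H the two sides are those of the Yetter-Drinfeld
   condition for [autV v] and [aut g_2]. *)
Lemma free_tens_rcolinear (V W : yd_data H) z : is_yd V -> is_yd W ->
  @bc_coact k H (F_bicov (yd_tens V W)) (@free_tens k H V W z)
  = slet y ⊗ c := @bc_coact k H (bicov_tens (F_bicov V) (F_bicov W)) z in
      @free_tens k H V W y ⊗ c.
Proof.
move=> hV hW; have hRV := yd_is_rmod hV; have hRW := yd_is_rmod hW.
have hVW := yd_tens_valid hV hW; have hBV := F_bicov_valid hV.
have hBW := F_bicov_valid hW; have hBVW := F_bicov_valid hVW.
have hT := bicov_tens_valid hBV hBW.
have l1 := free_tens_klin hRV hRW; have l2 := bicov_colin hT; have l3 := bicov_colin hBVW.
have eV := yd_coact_autV hV.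
have lb := free_tens_bilin W hRV.
have lb1 x : @klinear k (F_lcov W) (F_lcov (rmod_tens V W)) (free_tens_fun x) by exact: lb.1.
have lb2 y : @klinear k (F_lcov V) (F_lcov (rmod_tens V W)) (fun x => free_tens_fun x y)
  by exact: lb.2.
tindH (z : tensorH (F_lcov V) (F_lcov W)) x y.
rewrite tensH_rcoactE // free_tensE // !F_bicov_coactE.
transitivity (slet x0 ⊗ x1 := @bc_coact k H (F_bicov V) x in
  slet y0 ⊗ y1 := @bc_coact k H (F_bicov W) y in
  free_tens_fun x0 y0 ⊗ (x1 ⋅ y1)); last first.
  rewrite -!F_bicov_coactE.
  tind (@bc_coact k H (F_bicov V) x) x0 x1; tind (@bc_coact k H (F_bicov W) y) y0 y1.
  by tpure; rewrite free_tensE.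
rewrite !F_bicov_coactE /free_tens_fun.
clear -hV hW hRV hRW hVW eV.
tind x h v; tind y g w.
have cE (v' : V) (w' : W) : @yd_coact k H (yd_tens V W) (v' ⊗ w')
    = slet v0 ⊗ v1 := yd_coact v' in slet w0 ⊗ w1 := yd_coact w' in
      (v0 ⊗ w0) ⊗ (v1 ⋅ w1) by rewrite /=; tpure.
transitivity (slet h1 ⊗ h2 := Delta h in slet a ⊗ b := Delta g in
  slet r ⊗ s := (slet c1 ⊗ c2 := Delta (aut b) in
    slet p0 ⊗ p1 := yd_coact (rm_act (autV v) c2) in p0 ⊗ autV (c1 ⋅ p1)) in
  slet w0 ⊗ w1 := yd_coact w in
  ((h1 ⋅ a) ⊗ (r ⊗ w0)) ⊗ (aut h2 ⋅ (s ⋅ w1))).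
  snl ltac:(rewrite ?Delta_hmul ?Delta_tmap ?cE); snr ltac:(rewrite ?Delta_tmap).
  tind (Delta h) h1 h2; tind (yd_coact w) w0 w1; tpure.
  foldl (@Delta k H) (Delta g); foldr (@Delta k H) (Delta g).
  rewrite Delta_coassoc; tind (tmap id (@Delta k H) (Delta g)) a y.
  tind y b c; tpure.
  by tind (yd_coact (rm_act (autV v) (aut c))) p0 p1; tpure; rewrite !hrules.
transitivity (slet h1 ⊗ h2 := Delta h in slet a ⊗ b := Delta g in
  slet r ⊗ s := (slet n0 ⊗ n1 := yd_coact (autV v) in slet c1 ⊗ c2 := Delta (aut b) in
    rm_act n0 (autV c1) ⊗ (n1 ⋅ autV c2)) in
  slet w0 ⊗ w1 := yd_coact w in
  ((h1 ⋅ a) ⊗ (r ⊗ w0)) ⊗ (aut h2 ⋅ (s ⋅ w1))).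
  apply: eq_tlift => h1 h2; apply: eq_tlift => a b; congr tlift.
  by symmetry; exact: yd_compatible hV (autV v) (aut b).
snl ltac:(rewrite ?Delta_tmap ?eV); snr ltac:(idtac).
tind (Delta h) h1 h2; tind (yd_coact w) w0 w1; tind (yd_coact v) v0 v1; tpure.
foldl (@Delta k H) (Delta g); foldr (@Delta k H) (Delta g).
rewrite Delta_coassoc; tind (tmap id (@Delta k H) (Delta g)) a y.
by tind y b c; tpure; rewrite !hrules.
Qed.

Lemma free_unit_rcolinear h :
  @bc_coact k H (F_bicov (yd_unit H)) (@free_unit k H h)
  = slet y ⊗ c := @bc_coact k H (bicov_unit H) h in @free_unit k H y ⊗ c.
Proof.
have hu := yd_unit_valid H; have lu : klinear (@free_unit k H) := lcov_mor_klin (free_unit_mor H).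
rewrite F_bicov_coactE /free_unit; tpure; rewrite Delta_autV.
change (@bc_coact k H (bicov_unit H) h) with (Delta (h : H)).
by tind (Delta (h : H)) h1 h2; tpure; rewrite hmul1 hautVK.
Qed.

End FreeTensorBicovariant.

(** * The monoidal categories and the strong monoidal free functors *)

Section FreeMonoidal.
Variables (k : comPzRingType) (H : monHomHopf k).

Definition RMod_monoidal : monoidal (RMod H) :=
  concrete_monoidal (@rmod_reflects_iso k H) (@rmod_tensor_laws k H).
Definition LCov_monoidal : monoidal (LCov H) :=
  concrete_monoidal (@lcov_reflects_iso k H) (@lcov_tensor_laws k H).
Definition YD_monoidal : monoidal (YD H) :=
  concrete_monoidal (@yd_reflects_iso k H) (@yd_tensor_laws k H).
Definition Bicov_monoidal : monoidal (Bicov H) :=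
  concrete_monoidal (@bicov_reflects_iso k H) (@bicov_tensor_laws k H).

Definition FreeL_tens (V W : RMod H) :
    homc (tens LCov_monoidal (FreeL H V) (FreeL H W)) (FreeL H (tens RMod_monoidal V W)) :=
  @CHom k (LCov H) (tens LCov_monoidal (FreeL H V) (FreeL H W))
    (FreeL H (tens RMod_monoidal V W)) (@free_tens k H (dat V) (dat W))
    (free_tens_mor (cobP V) (cobP W)).

Definition FreeL_one : homc (tunit LCov_monoidal) (FreeL H (tunit RMod_monoidal)) :=
  @CHom k (LCov H) (tunit LCov_monoidal) (FreeL H (tunit RMod_monoidal))
    (@free_unit k H) (free_unit_mor H).

Definition FreeL_monoidal : strong_monoidal RMod_monoidal LCov_monoidal (FreeL H).
Proof.
refine (@StrongMonoidal _ _ RMod_monoidal LCov_monoidal (FreeL H) FreeL_tens FreeL_one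
  _ _ _ _ _ _).
- move=> A A' B B' f g; apply: chom_eq => x.
  exact: free_tens_nat (cobP A) (cobP A') (cobP B) (cobP B') (chomP f) (chomP g).
- move=> A B; apply: bij_iso; first exact: lcov_reflects_iso.
  exact: free_tens_bij (cobP A) (cobP B).
- apply: bij_iso; first exact: lcov_reflects_iso.
  exact: free_unit_bij.
- move=> A B E; apply: chom_eq => x.
  exact: free_tens_assoc (cobP A) (cobP B) (cobP E).
- by move=> A; apply: chom_eq => x; exact: free_tens_lun (cobP A).
- by move=> A; apply: chom_eq => x; exact: free_tens_run (cobP A).
Defined.

Definition FreeB_tens (V W : YD H) :
    homc (tens Bicov_monoidal (FreeB H V) (FreeB H W)) (FreeB H (tens YD_monoidal V W)) :=
  @CHom k (Bicov H) (tens Bicov_monoidal (FreeB H V) (FreeB H W))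
    (FreeB H (tens YD_monoidal V W)) (@free_tens k H (dat V) (dat W))
    (@IsBicovMor k H (bicov_tens (F_bicov (dat V)) (F_bicov (dat W)))
       (F_bicov (yd_tens (dat V) (dat W))) _
       (free_tens_mor (yd_is_rmod (cobP V)) (yd_is_rmod (cobP W)))
       (fun z => free_tens_rcolinear z (cobP V) (cobP W))).

Definition FreeB_one : homc (tunit Bicov_monoidal) (FreeB H (tunit YD_monoidal)) :=
  @CHom k (Bicov H) (tunit Bicov_monoidal) (FreeB H (tunit YD_monoidal))
    (@free_unit k H)
    (@IsBicovMor k H (bicov_unit H) (F_bicov (yd_unit H)) _ (free_unit_mor H)
       (@free_unit_rcolinear k H)).

(** Morphisms are equal as soon as their functions are, so the coherence equations are those of the
    underlying right modules. *)
Definition FreeB_monoidal : strong_monoidal YD_monoidal Bicov_monoidal (FreeB H).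
Proof.
have R (A : YD H) : is_rmod (dat A) := yd_is_rmod (cobP A).
refine (@StrongMonoidal _ _ YD_monoidal Bicov_monoidal (FreeB H) FreeB_tens FreeB_one
  _ _ _ _ _ _).
- move=> A A' B B' f g; apply: chom_eq => x.
  exact: free_tens_nat (R A) (R A') (R B) (R B') (yd_rmod_mor (chomP f))
    (yd_rmod_mor (chomP g)).
- move=> A B; apply: bij_iso; first exact: bicov_reflects_iso.
  exact: free_tens_bij (R A) (R B).
- apply: bij_iso; first exact: bicov_reflects_iso.
  exact: free_unit_bij.
- by move=> A B E; apply: chom_eq => x; exact: free_tens_assoc (R A) (R B) (R E).
- by move=> A; apply: chom_eq => x; exact: free_tens_lun (R A).
- by move=> A; apply: chom_eq => x; exact: free_tens_run (R A).
Defined.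

Lemma FreeL_tensor_equivalence :
  tensor_equivalence RMod_monoidal LCov_monoidal (FreeL_equiv H).
Proof.
exact: tensor_equivalence_of_strong (@FreeL_zig k H) (@FreeL_zag k H) FreeL_monoidal.
Qed.

Lemma FreeB_tensor_equivalence :
  tensor_equivalence YD_monoidal Bicov_monoidal (FreeB_equiv H).
Proof.
exact: tensor_equivalence_of_strong (@FreeB_zig k H) (@FreeB_zag k H) FreeB_monoidal.
Qed.

End FreeMonoidal.

(** * Comparison with the equivalence for Hopf modules *)

Section Induced.
Variables (k : comPzRingType) (H : monHomHopf k).

(* The restricted functors form the same submodule [coH M] from other proofs
   that it is one. *)
Lemma coH_irr (M : hopf_data H) (W W' : is_submod (@coinvariant k H M)) : coH W = coH W'.
Proof. by rewrite (Prop_irrelevance W W'). Qed.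

Lemma coH_mor_irr (M N : hopf_data H) (f : M -> N) (WM WM' : is_submod (@coinvariant k H M))
    (WN WN' : is_submod (@coinvariant k H N)) :
  @Arrow k (submod WM) (submod WN) (fun v => to_coH WN (f (val v)))
  = @Arrow k (submod WM') (submod WN') (fun v => to_coH WN' (f (val v))).
Proof. by rewrite (Prop_irrelevance WM WM') (Prop_irrelevance WN WN'). Qed.

Lemma hopf_unit_irr (V : hmod_data k) (W W' : is_submod (@coinvariant k H (F_hopf H V))) :
  @Arrow k V (submod W) (hopf_unit W) = @Arrow k V (submod W') (hopf_unit W').
Proof. by rewrite (Prop_irrelevance W W'). Qed.

Lemma hopf_counit_irr (M : hopf_data H) (W W' : is_submod (@coinvariant k H M)) :
  @Arrow k (tensor H (submod W)) M (@hopf_counit k H M W)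
  = @Arrow k (tensor H (submod W')) M (@hopf_counit k H M W').
Proof. by rewrite (Prop_irrelevance W W'). Qed.

Lemma FreeL_induced :
  induced_by (RMod_HM H) (LCov_HopfMod H) (Free_equiv H) (FreeL_equiv H).
Proof.
split=> //.
- by move=> M; exact: coH_irr.
- by move=> M N g; exact: coH_mor_irr.
- by move=> V; exact: hopf_unit_irr.
- by move=> M; exact: hopf_counit_irr.
Qed.

Lemma FreeB_induced :
  induced_by (YD_HM H) (Bicov_HopfMod H) (Free_equiv H) (FreeB_equiv H).
Proof.
split=> //.
- by move=> M; exact: coH_irr.
- by move=> M N g; exact: coH_mor_irr.
- by move=> V; exact: hopf_unit_irr.
- by move=> M; exact: hopf_counit_irr.
Qed.

End Induced.

Theorem theorem7p7 (k : comPzRingType) (H : monHomHopf k) :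
  exists (F : functor (HM k) (HopfMod H)) (G : functor (HopfMod H) (HM k))
         (E : equivalence F G),
  [/\ (forall V : HM k, dat (F V) = F_hopf H (dat V))
        /\ (forall (V W : HM k) (f : homc V W),
              arr (fmap F f) = Arrow _ _ (tmap (fun h : H => h) (fn f))),
      (forall M : HopfMod H, dat (G M) = G_hopf M)
        /\ (forall (M N : HopfMod H) (f : homc M N),
              arr (fmap G f) = Arrow _ _ (G_mor f)),
      induces_tensor_equivalence (RMod_HM H) (LCov_HopfMod H) E
        (RMod_tensor H) (LCov_tensor H) (@F_lcov k H) (@G_lcov k H)
    & induces_tensor_equivalence (YD_HM H) (Bicov_HopfMod H) E
        (YD_tensor H) (Bicov_tensor H) (@F_bicov k H) (@G_bicov k H)].
Proof.
(* The functors and monoidal structures were built transparently, so the prescribed formulas on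
   objects and morphisms hold by conversion. *)
exists (Free H), (Coinv H), (Free_equiv H); split=> //.
- exists (RMod_monoidal H), (LCov_monoidal H), (FreeL H), (CoinvL H), (FreeL_equiv H).
  split=> //.
  + exact: FreeL_induced.
  + exact: FreeL_tensor_equivalence.
- exists (YD_monoidal H), (Bicov_monoidal H), (FreeB H), (CoinvB H), (FreeB_equiv H).
  split=> //.
  + exact: FreeB_induced.
  + exact: FreeB_tensor_equivalence.
Qed.
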